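(* Let $E \subset \mathbb{C}$ be compact with $\mathrm{cap}(E)>0$, where $\mathrm{cap}(E)$ denotes the logarithmic capacity of $E$ and $\mu_E$ its equilibrium measure. Let $d_E(z):=\max_{t\in E}|z-t|$ and $C_E := \int \log d_E(z)\, d\mu_E(z) - \log\mathrm{cap}(E)$. Suppose that $\nu_j$, $j=1,\ldots,m$, are positive compactly supported Borel measures with potentials $p_j(z)=\int\log|z-t|\,d\nu_j(t)$, such that the total mass of $\sum_{j=1}^m \nu_j$ equals $1$. Then \[ \sum_{j=1}^m \sup_E p_j \le C_E(m) + \sup_E \sum_{j=1}^m p_j, \] where \[ C_E(m):=\max_{c_k\in\partial E} \int \log \max_{1 \le k \le m} |z-c_k|\, d\mu_E(z) - \log\mathrm{cap}(E) \] cannot be replaced by a smaller constant for each fixed $m\ge 2$. Furthermore, if $m < \mathrm{card}(\mathfrak{D}_E)$ then $C_E(m) < C_E$, while $C_E(m)=C_E$ for $m \ge \mathrm{card}(\mathfrak{D}_E)$. When $\mathfrak{D}_E$ is infinite, $C_E(m)<C_E$ holds for all $m\in\mathbb{N}$, $m\ge 2$.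
   Context: A closed set $S\subset E$ is called dominant if $d_E(z)=\max_{t\in S}|z-t|$ for all $z\in\mathrm{supp}(\mu_E)$. When $E$ has a finite dominant set, $\mathfrak{D}_E$ denotes a dominant set with the smallest number of points; otherwise $\mathfrak{D}_E$ is taken to be any dominant set (e.g. $\partial E$), with $\mathrm{card}(\mathfrak{D}_E)=\infty$. *)

(* Defs.v *)
(* The complex plane C is modelled as R * R
   (product topology = Euclidean topology, product sigma-algebra of Borel
   sets = Borel sigma-algebra of R^2), with the Euclidean distance. *)
From HB Require Import structures.
From mathcomp Require Import all_boot all_order all_algebra.
From mathcomp Require Import all_classical all_reals all_analysis.
Set Implicit Arguments. Unset Strict Implicit. Unset Printing Implicit Defensive.
Import Order.TTheory GRing.Theory Num.Theory.
Import numFieldNormedType.Exports.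
Local Open Scope classical_set_scope.
Local Open Scope ring_scope.

Section Defs.
Variable R : realType.
Local Notation C := (R * R)%type.

Definition cdist (z t : C) : R :=
  Num.sqrt ((z.1 - t.1) ^+ 2 + (z.2 - t.2) ^+ 2).

Definition elog (x : R) : \bar R := if x == 0 then -oo%E else (ln x)%:E.

Definition bdry (E : set C) : set C := closure E `\` interior E.

Definition cmeasure := {measure set C -> \bar R}.

Definition prob_on (E : set C) (mu : cmeasure) : Prop :=
  mu setT = 1%E /\ mu (~` E) = 0%E.

Definition compactly_supported (nu : cmeasure) : Prop :=
  exists K : set C, compact K /\ nu (~` K) = 0%E.

Definition msupp (mu : cmeasure) : set C :=
  [set z | forall r : R, 0 < r -> (0 < mu [set t | (cdist z t < r)%R])%E].

Definition potential (nu : cmeasure) (z : C) : \bar R :=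
  (\int[nu]_t elog (cdist z t))%E.

Definition energy (mu : cmeasure) : \bar R :=
  (\int[mu]_z \int[mu]_t (- elog (cdist z t)))%E.

Definition log_cap (E : set C) : \bar R :=
  (- ereal_inf [set x | exists nu : cmeasure, prob_on E nu /\ x = energy nu])%E.

Definition is_equilibrium (E : set C) (mu : cmeasure) : Prop :=
  prob_on E mu /\ energy mu = (- log_cap E)%E.

Definition dE (E : set C) (z : C) : R := sup [set cdist z t | t in E].

Definition CE (E : set C) (mu : cmeasure) : \bar R :=
  (\int[mu]_z elog (dE E z) - log_cap E)%E.

Definition CEm (E : set C) (mu : cmeasure) (m : nat) : \bar R :=
  ereal_sup [set x | exists c : 'I_m -> C, (forall k, bdry E (c k)) /\
     x = (\int[mu]_z elog (\big[Num.max/0%R]_(k < m) cdist z (c k))%R - log_cap E)%E].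

Definition dominant (E : set C) (mu : cmeasure) (S : set C) : Prop :=
  closed S /\ S `<=` E /\
  forall z, msupp mu z -> dE E z = sup [set cdist z t | t in S].

(* card(D_E) <= m : there is a dominant set with at most m points *)
Definition cardD_le (E : set C) (mu : cmeasure) (m : nat) : Prop :=
  exists s : seq C, (size s <= m)%N /\ dominant E mu [set` s].

Definition cardD_infinite (E : set C) (mu : cmeasure) : Prop :=
  forall s : seq C, ~ dominant E mu [set` s].

Definition supE (E : set C) (f : C -> \bar R) : \bar R := ereal_sup (f @` E).

End Defs.

(* Main.v *)
(* Potentials are approximated from above by the Lipschitz potentials [rpot e nu] of the
   kernel [ln (|z - t|^2 + e^2) / 2]; a discrete four-point maximum principle replaces
   subharmonicity and yields Frostman's theorem and the Bernstein-Walsh inequality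
   [p_nu <= sup_E p_nu - log cap + p_mu].

   Inequality: [sup_E p_j] is nearly attained at some [c_j] on the boundary, so the left side
   is at most the [nu]-integral of [ln max_j |t - c_j|], with [nu] the sum of the [nu_j]. For
   large [n], the max is approximated in the mean by [|P|^(1/n)] for a combination [P] of the
   [(X - c_j)^n]; factoring [P] turns the integral into a sum of values of [p_nu] at the roots
   of [P], Bernstein-Walsh bounds these by values of [p_mu], and [|P| <= m max_j |t - c_j|^n]
   brings the [mu]-integral of [ln max_j |t - c_j|] back.

   Sharpness: restrict [mu] to the sets where [|t - c_k|] is the largest of the distances. The
   exceptional polar set where [p_mu] is not small is suppressed by a small mass of Evans type,
   split between two distinct [c_k] so that no [p_k (c_k)] is affected much.

   Strictness: the maximum defining [C_E(m)] is attained, and equality with [C_E] forces the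
   optimal points to be dominant. *)
Require Import Defs.
From HB Require Import structures.
From mathcomp Require Import all_boot all_order all_algebra.
From mathcomp Require Import all_classical all_reals all_analysis.
From mathcomp Require Import measurable_realfun complex zify ring lra.
Import Order.TTheory GRing.Theory Num.Theory.
Import numFieldNormedType.Exports.
Local Open Scope classical_set_scope.
Local Open Scope ring_scope.
Set Implicit Arguments. Unset Strict Implicit. Unset Printing Implicit Defensive.

(** The inequality rests on a fact of Riesz type: [ln max_j |z - c_j|] is the potential of a
    probability measure [sigma]. Its [nu]-integral is therefore the [sigma]-integral of [p_nu], to
    which Bernstein-Walsh applies point by point, and symmetry of the kernel returns the
    [mu]-integral. The normalised root counts of the polynomials [P] stand in for [sigma].

    The maximum principles must work without an attained maximum. Over a cross of radius [r], the
    four-point sum of [ln |z - t|] has an error of order [r^4] only, whereas that of the kernel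
    regularised at scale [e] exceeds four times the central value by an amount of order [r^2 e^2].
    For small [r] the gain wins, uniformly for [z] in a bounded set away from the singularities.

    Potentials can be [-oo] and are merely upper semicontinuous. Estimates are therefore made for
    [rpot e] with [e > 0], where everything is real and Lipschitz; the limit is taken by monotone
    convergence, or by a Dini argument when a supremum over a compact set is involved. *)

Section Geometry.
Variable R : realType.
Local Notation C := (R * R)%type.
Implicit Types (z t w : C) (e r : R).

(** * Euclidean distance, the regularised kernel and its four-point sums *)

Lemma cdist_ge0 z t : 0 <= cdist z t.
Proof. exact: sqrtr_ge0. Qed.

Lemma sqr_cdist z t : cdist z t ^+ 2 = (z.1 - t.1) ^+ 2 + (z.2 - t.2) ^+ 2.
Proof. by rewrite sqr_sqrtr// addr_ge0// sqr_ge0. Qed.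

Lemma cdistC z t : cdist z t = cdist t z.
Proof. by rewrite /cdist; congr Num.sqrt; ring. Qed.

Lemma cdistxx z : cdist z z = 0.
Proof. by rewrite /cdist !subrr expr0n addr0 sqrtr0. Qed.

Lemma cdist_eq0 z t : (cdist z t == 0) = (z == t).
Proof.
apply/idP/eqP => [|->]; last by rewrite cdistxx.
rewrite -sqrf_eq0 sqr_cdist paddr_eq0 ?sqr_ge0// !sqrf_eq0 !subr_eq0.
by case: z t => [a b] [c d] /= /andP[/eqP -> /eqP ->].
Qed.

Lemma ler_sqr_sqrt (x b : R) : 0 <= b -> x <= b ^+ 2 -> Num.sqrt x <= b.
Proof.
move=> b0 xb; rewrite -(ger0_norm b0) -sqrtr_sqr.
by apply: ler_wsqrtr.
Qed.

Lemma cdist_triangle w z t : cdist z t <= cdist z w + cdist w t.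
Proof.
have p0 := cdist_ge0 z w; have q0 := cdist_ge0 w t.
rewrite {1}/cdist; apply: ler_sqr_sqrt; [exact: addr_ge0|].
rewrite [leRHS]sqrrD !sqr_cdist -mulr_natr.
have : (z.1 - w.1) * (w.1 - t.1) + (z.2 - w.2) * (w.2 - t.2) <= cdist z w * cdist w t.
  have := sqr_cdist z w; have := sqr_cdist w t.
  set a := z.1 - w.1; set b := z.2 - w.2; set c := w.1 - t.1; set d := w.2 - t.2.
  set p := cdist z w in p0 *; set q := cdist w t in q0 * => hq hp.
  apply: le_trans (ler_norm _) _.
  rewrite -(@ler_pXn2r _ 2)// ?nnegrE ?normr_ge0 ?mulr_ge0// real_normK ?num_real//.
  (* Lagrange's identity: the two sides of Cauchy-Schwarz, squared, differ by this square. *)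
  rewrite exprMn hp hq; have := sqr_ge0 (a * d - b * c); nra.
nra.
Qed.

Lemma abs1_le_cdist z t : `|z.1 - t.1| <= cdist z t.
Proof. by rewrite -sqrtr_sqr ler_wsqrtr// lerDl sqr_ge0. Qed.

Lemma abs2_le_cdist z t : `|z.2 - t.2| <= cdist z t.
Proof. by rewrite -sqrtr_sqr ler_wsqrtr// lerDr sqr_ge0. Qed.

Lemma cdist_le_abs z t : cdist z t <= `|z.1 - t.1| + `|z.2 - t.2|.
Proof.
apply: ler_sqr_sqrt; [exact: addr_ge0|].
rewrite [leRHS]sqrrD !real_normK ?num_real//.
by rewrite lerD2r lerDl mulrn_wge0// mulr_ge0.
Qed.

Lemma ln_le (x y : R) : 0 < x -> x <= y -> ln x <= ln y.
Proof. by move=> x0 xy; rewrite ler_ln// posrE (lt_le_trans x0). Qed.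

Lemma ln_sqrt (x : R) : 0 < x -> ln (Num.sqrt x) = ln x / 2.
Proof.
move=> x0; rewrite -{2}(sqr_sqrtr (ltW x0)) lnXn ?sqrtr_gt0//.
by rewrite mulr2n; lra.
Qed.

(* The logarithmic kernel regularised at scale [e]; at [e = 0] it is
   [ln |z - t|], with the junk value [0] on the diagonal. *)
Definition smooth_dist e z t : R := Num.sqrt (cdist z t ^+ 2 + e ^+ 2).
Definition phi e z t : R := ln (smooth_dist e z t).

Lemma smooth_distC e z t : smooth_dist e z t = smooth_dist e t z.
Proof. by rewrite /smooth_dist cdistC. Qed.

Lemma phiC e z t : phi e z t = phi e t z.
Proof. by rewrite /phi smooth_distC. Qed.

Lemma cdist_le_smooth e z t : cdist z t <= smooth_dist e z t.
Proof.
rewrite -{1}(ger0_norm (cdist_ge0 z t)) -sqrtr_sqr ler_wsqrtr//.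
by rewrite lerDl sqr_ge0.
Qed.

Lemma smooth_dist_ge e z t : 0 <= e -> e <= smooth_dist e z t.
Proof.
move=> e0; rewrite -{1}(ger0_norm e0) -sqrtr_sqr ler_wsqrtr//.
by rewrite lerDr sqr_ge0.
Qed.

Lemma smooth_dist_le e z t : 0 <= e -> smooth_dist e z t <= cdist z t + e.
Proof.
move=> e0; apply: ler_sqr_sqrt; [exact: addr_ge0 (cdist_ge0 _ _) _|].
by rewrite [leRHS]sqrrD lerD2r lerDl mulrn_wge0// mulr_ge0 ?cdist_ge0.
Qed.

Lemma smooth_dist0 z t : smooth_dist 0 z t = cdist z t.
Proof. by rewrite /smooth_dist expr0n addr0 sqrtr_sqr ger0_norm ?cdist_ge0. Qed.

Lemma phi0 z t : phi 0 z t = ln (cdist z t).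
Proof. by rewrite /phi smooth_dist0. Qed.

Lemma smooth_dist_gt0 e z t : 0 < e -> 0 < smooth_dist e z t.
Proof. by move=> e0; apply: lt_le_trans e0 (smooth_dist_ge _ _ (ltW e0)). Qed.

Lemma le_smooth_dist e e' z t : 0 <= e -> e <= e' -> smooth_dist e z t <= smooth_dist e' z t.
Proof. by move=> e0 ee'; rewrite ler_wsqrtr// lerD2l lerXn2r// nnegrE (le_trans e0). Qed.

Lemma le_phi e e' z t : 0 < e -> e <= e' -> phi e z t <= phi e' z t.
Proof. by move=> e0 ee'; apply: ln_le; [exact: smooth_dist_gt0|exact: le_smooth_dist (ltW _) _]. Qed.

Lemma phi_ge e z t : 0 < e -> ln e <= phi e z t.
Proof. by move=> e0; apply: ln_le => //; apply: smooth_dist_ge (ltW _). Qed.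

Lemma phi_le e z t b : 0 < e -> cdist z t + e <= b -> phi e z t <= ln b.
Proof.
move=> e0 h; apply: ln_le; first exact: smooth_dist_gt0.
exact: le_trans (smooth_dist_le _ _ (ltW e0)) _.
Qed.

Lemma smooth_dist_lip e z w t : 0 <= e ->
  smooth_dist e z t <= smooth_dist e w t + cdist z w.
Proof.
move=> e0; apply: ler_sqr_sqrt; [by rewrite addr_ge0 ?cdist_ge0 ?sqrtr_ge0|].
have tri := cdist_triangle w z t.
have h := cdist_le_smooth e w t.
have : smooth_dist e w t ^+ 2 = cdist w t ^+ 2 + e ^+ 2.
  by rewrite sqr_sqrtr// addr_ge0// sqr_ge0.
have := cdist_ge0 w t; have := cdist_ge0 z t; have := cdist_ge0 z w.
move: tri h; set s := smooth_dist _ _ _; set a := cdist z t; set b := cdist z w.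
set c := cdist w t => tri h b0 a0 c0 E.
have : a ^+ 2 <= (b + c) ^+ 2 by rewrite lerXn2r// nnegrE addr_ge0.
have hbc : b * c <= b * s by exact: ler_wpM2l.
rewrite !sqrrD E !mulr2n (mulrC s b); lra.
Qed.

(** [smooth_dist] is 1-Lipschitz and never below [e], so its logarithm has Lipschitz constant
    [1 / e]. *)
Lemma phi_lip e z w t : 0 < e -> phi e z t <= phi e w t + cdist z w / e.
Proof.
move=> e0; have Nw := smooth_dist_gt0 w t e0.
rewrite -lerBlDl -ln_div ?posrE ?smooth_dist_gt0//.
have := smooth_dist_lip z w t (ltW e0).
set s := smooth_dist _ z _; set s' := smooth_dist _ w _ in Nw * => h.
have h2 : s / s' <= 1 + cdist z w / e.
  rewrite ler_pdivrMr// mulrDl mul1r (le_trans h)// lerD2l -mulrA.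
  rewrite ler_peMr ?cdist_ge0// mulrC ler_pdivlMr// mul1r.
  exact: smooth_dist_ge (ltW e0).
have p : 0 < s / s' by rewrite divr_gt0 ?smooth_dist_gt0.
apply: le_trans (ln_le p h2) _.
apply: le_ln1Dx; apply: lt_le_trans (_ : 0 <= _); first by rewrite ltrN10.
by rewrite divr_ge0 ?cdist_ge0// ltW.
Qed.

(** Here [x], [y] are the squared coordinate differences and [e], [s] the squares of scale and
    radius. Multiplying opposite arms of the cross turns the four squared smoothed distances into
    the two factors on the right. The excess over the fourth power reflects the positive Laplacian
    of the regularised kernel. *)
Lemma four_point_ge (x y e s : R) : 0 <= x -> 0 <= y -> 0 <= s -> s <= e ->
  (x + y + e) ^+ 4 + 2 * s * e * (x + y + e) ^+ 2 <=
  ((x + y + e + s) ^+ 2 - 4 * s * x) * ((x + y + e + s) ^+ 2 - 4 * s * y).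
Proof.
move=> x0 y0 s0 se; have e0 := le_trans s0 se; rewrite -subr_ge0.
have -> : ((x + y + e + s) ^+ 2 - 4 * s * x) * ((x + y + e + s) ^+ 2 - 4 * s * y)
    - ((x + y + e) ^+ 4 + 2 * s * e * (x + y + e) ^+ 2)
   = 2 * s * (e - s) * (x + y + e) ^+ 2 + s ^+ 4 + 16 * s ^+ 2 * x * y
     + 8 * s ^+ 2 * e * (x + y + e) + 4 * s ^+ 3 * e by ring.
by rewrite !addr_ge0 ?mulr_ge0 ?exprn_ge0 ?subr_ge0 ?addr_ge0.
Qed.

(** Without regularisation the four distances multiply to [|w^4 - r^4|] with [w = z - t], which is
    at most [|w|^4 + r^4]. There is no term in [r^2]: the logarithm is harmonic. *)
Lemma four_point_le (x y s : R) :
  ((x + y + s) ^+ 2 - 4 * s * x) * ((x + y + s) ^+ 2 - 4 * s * y) <=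
  ((x + y) ^+ 2 + s ^+ 2) ^+ 2.
Proof.
rewrite -subr_ge0.
have -> : ((x + y) ^+ 2 + s ^+ 2) ^+ 2 -
    ((x + y + s) ^+ 2 - 4 * s * x) * ((x + y + s) ^+ 2 - 4 * s * y)
    = 4 * (s * (x - y)) ^+ 2 by ring.
by rewrite mulr_ge0// sqr_ge0.
Qed.

Definition sum4 (f : C -> R) z r : R :=
  f (z.1 + r, z.2) + f (z.1 - r, z.2) + f (z.1, z.2 + r) + f (z.1, z.2 - r).

Lemma sum4_prod e z t r :
  (forall w, (cdist w z <= r) -> 0 < smooth_dist e w t) -> 0 <= r ->
  sum4 (phi e ^~ t) z r = ln (
    ((cdist z t ^+ 2 + e ^+ 2 + r ^+ 2) ^+ 2 - 4 * r ^+ 2 * (z.1 - t.1) ^+ 2) *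
    ((cdist z t ^+ 2 + e ^+ 2 + r ^+ 2) ^+ 2 - 4 * r ^+ 2 * (z.2 - t.2) ^+ 2)) / 2.
Proof.
move=> pos r0.
have sq w : cdist w z <= r -> 0 < cdist w t ^+ 2 + e ^+ 2.
  by move=> /pos; rewrite sqrtr_gt0.
have d1 : cdist (z.1 + r, z.2) z <= r.
  by rewrite /cdist /= subrr expr0n addr0 addrAC subrr add0r sqrtr_sqr ger0_norm.
have d2 : cdist (z.1 - r, z.2) z <= r.
  by rewrite /cdist /= subrr expr0n addr0 addrAC subrr add0r sqrtr_sqr normrN ger0_norm.
have d3 : cdist (z.1, z.2 + r) z <= r.
  by rewrite /cdist /= subrr expr0n add0r addrAC subrr add0r sqrtr_sqr ger0_norm.
have d4 : cdist (z.1, z.2 - r) z <= r.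
  by rewrite /cdist /= subrr expr0n add0r addrAC subrr add0r sqrtr_sqr normrN ger0_norm.
have [[[s1 s2] s3] s4] := (sq _ d1, sq _ d2, sq _ d3, sq _ d4).
rewrite /sum4 /phi /smooth_dist !ln_sqrt// -!mulrDl; congr (_ / 2).
rewrite -!lnM ?posrE ?mulr_gt0//; congr ln.
rewrite !sqr_cdist /=; ring.
Qed.

(** Divided by [B^4], [four_point_ge] yields a term [ln (1 + x)] with [x = 2 r^2 e^2 / B^2 <= 2],
    and on that range [ln (1 + x) >= x / 3]; hence the 3. Replacing [B] by [b] makes the gain
    uniform. *)
Lemma phi4_ge e r z t b : 0 < r -> r <= e -> cdist z t ^+ 2 + e ^+ 2 <= b ->
  4 * phi e z t + r ^+ 2 * e ^+ 2 / (3 * b ^+ 2) <= sum4 (phi e ^~ t) z r.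
Proof.
move=> r0 re; have e0 := lt_le_trans r0 re.
set B := _ + _ => Bb; have B0 : 0 < B by rewrite ltr_wpDl ?sqr_ge0 ?exprn_gt0.
rewrite (sum4_prod (fun w _ => smooth_dist_gt0 w t e0) (ltW r0)).
rewrite -/B /phi /smooth_dist -/B ln_sqrt//.
set P := (X in _ <= ln X / 2).
have hr : r ^+ 2 <= e ^+ 2 by rewrite lerXn2r// nnegrE ltW.
have HP : B ^+ 4 * (1 + 2 * r ^+ 2 * e ^+ 2 / B ^+ 2) <= P.
  rewrite mulrDr mulr1; have -> : B ^+ 4 * (2 * r ^+ 2 * e ^+ 2 / B ^+ 2) = 2 * r ^+ 2 * e ^+ 2 * B ^+ 2.
    by field; rewrite gt_eqF.
  rewrite /P /B sqr_cdist.
  exact: four_point_ge (sqr_ge0 _) (sqr_ge0 _) (sqr_ge0 _) hr.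
have x0 : 0 <= 2 * r ^+ 2 * e ^+ 2 / B ^+ 2 by apply: divr_ge0; [apply: mulr_ge0; [apply: mulr_ge0|]|]; rewrite ?sqr_ge0// ltW// exprn_gt0.
have -> : 4 * (ln B / 2) = ln (B ^+ 4) / 2 by rewrite lnXn// -mulr_natr; field.
have Q0 : 0 < 1 + 2 * r ^+ 2 * e ^+ 2 / B ^+ 2 by lra.
have := ln_le (mulr_gt0 (exprn_gt0 4 B0) Q0) HP.
rewrite lnM ?posrE ?exprn_gt0// => h.
suff : 2 * (r ^+ 2 * e ^+ 2 / (3 * b ^+ 2)) <= ln (1 + 2 * r ^+ 2 * e ^+ 2 / B ^+ 2) by lra.
have : 2 * r ^+ 2 * e ^+ 2 / B ^+ 2 <= 2.
  rewrite ler_pdivrMr ?exprn_gt0// -mulrA ler_pM2l// expr2 ler_pM ?sqr_ge0//.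
    by rewrite (le_trans hr)// lerDr sqr_ge0.
  by rewrite lerDr sqr_ge0.
move: x0 Q0 {h}; set x := _ / B ^+ 2 => x0 Q0 x2.
have lx : x / 3 <= ln (1 + x).
  rewrite -lerN2 -lnV ?posrE//.
  have -> : (1 + x)^-1 = 1 + (- (x / (1 + x))) by field; rewrite gt_eqF.
  have : x / 3 <= x / (1 + x) by rewrite ler_wpM2l// lef_pV2 ?posrE//; lra.
  have : x / (1 + x) < 1 by rewrite ltr_pdivrMr//; lra.
  move=> h1 h2; apply: le_trans (le_ln1Dx _) _; [lra|lra].
apply: le_trans lx.
have b0 := lt_le_trans B0 Bb.
have -> : 2 * (r ^+ 2 * e ^+ 2 / (3 * b ^+ 2)) = 2 * r ^+ 2 * e ^+ 2 / 3 * (b ^+ 2)^-1.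
  by field; rewrite gt_eqF.
have -> : x / 3 = 2 * r ^+ 2 * e ^+ 2 / 3 * (B ^+ 2)^-1 by rewrite /x; field; rewrite gt_eqF.
apply: ler_wpM2l.
  by apply: divr_ge0 => //; apply: mulr_ge0; [apply: mulr_ge0|]; rewrite ?sqr_ge0.
by rewrite lef_pV2 ?posrE ?exprn_gt0// lerXn2r// nnegrE ltW.
Qed.

(** The condition [r < d] keeps the four arms away from [t], where [phi 0] has a junk value. *)
Lemma phi4_le r d z t : 0 < r -> r < d -> d <= cdist z t ->
  sum4 (phi 0 ^~ t) z r <= 4 * phi 0 z t + r ^+ 4 / d ^+ 4.
Proof.
move=> r0 rd dz; have d0 := lt_trans r0 rd; have D0 := lt_le_trans d0 dz.
have pos w : cdist w z <= r -> 0 < smooth_dist 0 w t.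
  move=> wz; rewrite smooth_dist0; have := cdist_triangle w z t.
  rewrite (cdistC z w); lra.
rewrite (sum4_prod pos (ltW r0)).
rewrite phi0; set D := cdist z t in dz D0 *.
rewrite expr0n addr0; set P := (X in ln X / 2 <= _).
have HP : P <= (D ^+ 4 * (1 + r ^+ 4 / D ^+ 4)) ^+ 2.
  have -> : D ^+ 4 * (1 + r ^+ 4 / D ^+ 4) = (D ^+ 2) ^+ 2 + (r ^+ 2) ^+ 2 by field; rewrite gt_eqF.
  rewrite /P /D sqr_cdist; exact: four_point_le.
have q0 : 0 <= r ^+ 4 / D ^+ 4 by rewrite divr_ge0 ?exprn_ge0// ltW.
have P0 : 0 < P.
  have -> : P = (((D^+2 + r^+2) ^+ 2 - 4 * r ^+ 2 * (z.1 - t.1) ^+ 2) *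
    ((D^+2 + r ^+ 2) ^+ 2 - 4 * r ^+ 2 * (z.2 - t.2) ^+ 2)) by [].
  have h2 : 0 < (D^+2 - r^+2)^+2.
    rewrite exprn_gt0// subr_gt0 ltrXn2r// ?nnegrE ?ltW//; lra.
  have hD := sqr_cdist z t; rewrite -/D in hD.
  have s0 : 0 <= r ^+ 2 by exact: sqr_ge0.
  rewrite hD in h2 *; apply: mulr_gt0.
    have -> : ((z.1 - t.1) ^+ 2 + (z.2 - t.2) ^+ 2 + r ^+ 2) ^+ 2 - 4 * r ^+ 2 * (z.1 - t.1) ^+ 2
      = ((z.1 - t.1) ^+ 2 + (z.2 - t.2) ^+ 2 - r ^+ 2) ^+ 2 + 4 * r ^+ 2 * (z.2 - t.2) ^+ 2 by ring.
    by rewrite ltr_wpDr// mulr_ge0 ?sqr_ge0// mulr_ge0.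
  have -> : ((z.1 - t.1) ^+ 2 + (z.2 - t.2) ^+ 2 + r ^+ 2) ^+ 2 - 4 * r ^+ 2 * (z.2 - t.2) ^+ 2
    = ((z.1 - t.1) ^+ 2 + (z.2 - t.2) ^+ 2 - r ^+ 2) ^+ 2 + 4 * r ^+ 2 * (z.1 - t.1) ^+ 2 by ring.
  by rewrite ltr_wpDr// mulr_ge0 ?sqr_ge0// mulr_ge0.
have := ln_le P0 HP; rewrite lnXn; last by rewrite mulr_gt0 ?exprn_gt0//; lra.
rewrite lnM ?posrE ?exprn_gt0//; last by lra.
rewrite lnXn// => h.
have h1 := le_ln1Dx (lt_le_trans (ltrN10 _) q0).
have : r ^+ 4 / D ^+ 4 <= r ^+ 4 / d ^+ 4.
  apply: ler_wpM2l; first by rewrite exprn_ge0 ?ltW.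
  rewrite lef_pV2 ?posrE ?exprn_gt0//.
  by rewrite lerXn2r// nnegrE ltW.
lra.
Qed.

End Geometry.

(** * A maximum principle for four-point sums *)

Section MaxPrinciple.
Variable R : realType.
Local Notation C := (R * R)%type.
Implicit Types (z t w : C) (e r : R).

Lemma cdist_sum4 z r w : 0 <= r ->
  w \in [:: (z.1 + r, z.2); (z.1 - r, z.2); (z.1, z.2 + r); (z.1, z.2 - r)] ->
  cdist w z = r.
Proof.
move=> r0; rewrite !inE => /or4P[]/eqP->; rewrite /cdist /= subrr expr0n ?addr0 ?add0r;
  by rewrite addrAC subrr add0r sqrtr_sqr ?normrN ger0_norm.
Qed.

Lemma sum4_le (f : C -> R) z r b : 0 <= r ->
  (forall w, cdist w z = r -> f w <= b) -> sum4 f z r <= 4 * b.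
Proof.
move=> r0 h; rewrite /sum4.
have [h1 h2 h3 h4] : [/\ f (z.1 + r, z.2) <= b, f (z.1 - r, z.2) <= b,
    f (z.1, z.2 + r) <= b & f (z.1, z.2 - r) <= b].
  by split; apply/h/(cdist_sum4 r0); rewrite !inE eqxx ?orbT.
lra.
Qed.

(* A near-maximiser of [f] stays away from [S] and from infinity, where the
   four-point gain contradicts it. *)
Lemma discrete_max_principle (S : set C) (f : C -> R) :
  (forall b, exists c, forall z, ~ S z -> cdist z 0 <= b -> f z <= c) ->
  (forall e, 0 < e -> exists2 d, 0 < d &
     forall z s, ~ S z -> S s -> cdist z s < d -> f z <= e) ->
  (forall e, 0 < e -> exists b, forall z, ~ S z -> b <= cdist z 0 -> f z <= e) ->
  (forall d b, 0 < d -> exists r g, [/\ 0 < r, r < d, 0 < g &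
     forall z, ~ S z -> cdist z 0 <= b -> (forall s, S s -> d <= cdist z s) ->
       4 * f z + g <= sum4 f z r]) ->
  forall z, ~ S z -> f z <= 0.
Proof.
move=> bnd nearS far gain z0 Sz0; rewrite leNgt; apply/negP => fz0.
have e0 : 0 < f z0 / 2 by rewrite divr_gt0.
have [d d0 hd] := nearS _ e0; have [b hb] := far _ e0; have [c hc] := bnd b.
have [r [g [r0 rd g0 hg]]] := gain d b d0.
pose F := [set f z | z in ~` S].
have Fub : ubound F (Num.max c (f z0 / 2)).
  move=> _ [z Sz <-]; rewrite le_max.
  have [zb|/ltW zb] := leP (cdist z 0) b; first by rewrite hc.
  by rewrite hb// orbT.
have supF : has_sup F by split; [exists (f z0), z0|exists (Num.max c (f z0 / 2))].
have fz0F : f z0 <= sup F by apply: (ub_le_sup supF.2); exists z0.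
(* A point within [f z0 / 4] of the supremum has a value above [f z0 / 2], so it is neither near [S]
   nor far out. Within [g / 8] of the supremum, the gain [g] pushes the four-point sum above four
   times the supremum. *)
pose m := Num.min (g / 8) (f z0 / 4).
have m0 : 0 < m by rewrite lt_min !divr_gt0.
have m1 : m <= g / 8 by rewrite ge_min lexx.
have m2 : m <= f z0 / 4 by rewrite ge_min lexx orbT.
have [_ [z Sz <-] hz] := sup_adherent m0 supF.
have zfar s : S s -> d <= cdist z s.
  move=> Ss; rewrite leNgt; apply/negP => /(hd _ _ Sz Ss); lra.
have zb : cdist z 0 <= b.
  rewrite leNgt; apply/negP => /ltW /(hb _ Sz); lra.
have := hg z Sz zb zfar.
have : sum4 f z r <= 4 * sup F.
  apply: (sum4_le (ltW r0)) => w wz; apply: (ub_le_sup supF.2); exists w => // Sw.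
  by have := zfar _ Sw; rewrite cdistC wz; lra.
lra.
Qed.

End MaxPrinciple.

(** * Compactness in the plane: ultralimits and a Dini argument *)

Section Topology.
Variable R : realType.
Local Notation C := (R * R)%type.
Implicit Types (z t w : C) (e r : R).

Lemma nbhs_cdistP z (A : set C) :
  nbhs z A <-> exists2 r : R, 0 < r & forall t, cdist z t < r -> A t.
Proof.
split=> [/nbhs_ballP [r /= r0 rA]|[r r0 rA]].
  exists r => // t zt; apply: rA; split; rewrite /ball/=.
    exact: le_lt_trans (abs1_le_cdist _ _) zt.
  exact: le_lt_trans (abs2_le_cdist _ _) zt.
apply/nbhs_ballP; exists (r / 2) => /=; first by rewrite divr_gt0.
move=> t [] /=; rewrite /ball /= => h1 h2; apply: rA.
by apply: le_lt_trans (cdist_le_abs _ _) _; lra.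
Qed.

Lemma lipschitz_continuous (f : C -> R) (k : R) :
  (forall z w, f z <= f w + k * cdist z w) -> continuous f.
Proof.
move=> h z; apply/cvgrPdist_lt => e e0.
have k0 : 0 < `|k| + 1 by rewrite ltr_wpDl.
apply/nbhs_cdistP; exists (e / (`|k| + 1)); first by rewrite divr_gt0.
move=> t; rewrite ltr_pdivlMr// => zt; apply: le_lt_trans zt.
have kk : k * cdist z t <= cdist z t * (`|k| + 1).
  by rewrite mulrC ler_wpM2l ?cdist_ge0// (le_trans (ler_norm _))// lerDl.
have := h z t; have := h t z; rewrite (cdistC t z) ler_norml; move: kk; lra.
Qed.

Lemma compact_cdist_bounded (K : set C) z : compact K ->
  exists2 b : R, 0 < b & forall t, K t -> cdist z t <= b.
Proof.
move=> /compact_bounded [M [_ hM]]; have {}hM : forall t, K t -> `|t| <= M + 1 by apply: hM; rewrite ltrDl.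
have M1 := ler_norm (M + 1).
exists (`|z.1| + `|z.2| + `|M + 1| + `|M + 1| + 1).
  by have := normr_ge0 z.1; have := normr_ge0 z.2; have := normr_ge0 (M + 1); lra.
move=> t Kt; have := hM _ Kt; rewrite /= prod_normE/= ge_max => /andP[h1 h2].
apply: le_trans (cdist_le_abs _ _) _.
have := ler_normB z.1 t.1; have := ler_normB z.2 t.2; lra.
Qed.

Lemma compact_closedC (K : set C) : compact K -> closed K.
Proof. by apply: compact_closed; exact: norm_hausdorff. Qed.

(* Ultralimits replace extraction of subsequences throughout. *)
Lemma exists_ultrafilter : exists U : set_system nat,
  UltraFilter U /\ forall n, U [set k | (n <= k)%N].
Proof.
have [U [UU sub]] := @ultraFilterLemma nat eventually _.
by exists U; split => // n; apply: sub; exists n.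
Qed.

Lemma fmap_ultra T (U : set_system nat) (x : nat -> T) :
  UltraFilter U -> UltraFilter (x @ U).
Proof.
move=> UU; split; first exact: fmap_proper_filter.
move=> G GF UG; apply/seteqP; split => // A GA.
have [//|UC] := in_ultra_setVsetC (x @^-1` A) UU.
by have [t [/= ? ?]] := @filter_ex _ G _ _ (@filterI _ G _ _ _ GA (UG (~` A) UC)).
Qed.

Lemma ultra_cvg (U : set_system nat) (K : set C) (x : nat -> C) :
  UltraFilter U -> compact K -> (forall n, K (x n)) ->
  exists2 a, K a & forall e, 0 < e -> U [set n | cdist (x n) a < e].
Proof.
move=> UU cK Kx; move: cK; rewrite compact_ultra => cK.
have xK : (x @ U) K by exact: (@filterS _ U _ setT _ (fun n _ => Kx n) filterT).
have [a [Ka xa]] := cK (x @ U) (fmap_ultra x UU) xK.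
exists a => // e e0; apply: (xa [set t | cdist t a < e]).
by apply/nbhs_cdistP; exists e => // t; rewrite cdistC.
Qed.

Lemma ultra_cvgR (U : set_system nat) (b : R) (x : nat -> R) :
  UltraFilter U -> (forall n, `|x n| <= b) ->
  exists a : R, forall e : R, 0 < e -> U [set n | `|x n - a| < e].
Proof.
move=> UU bx; have := @segment_compact R (- b) b.
rewrite compact_ultra => cK.
have xK : (x @ U) `[- b, b]%classic.
  by apply: (@filterS _ U _ setT _ _ filterT) => n _ /=; rewrite in_itv /= -ler_norml.
have [a [_ xa]] := cK (x @ U) (fmap_ultra x UU) xK.
exists a => e e0; apply: (xa [set t | `|t - a| < e]).
by apply/nbhs_ballP; exists e => // t; rewrite /ball /= distrC.
Qed.

(** Near-optimal tuples [x n] for [f n] converge along an ultrafilter to [c]. For fixed [k],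
    monotonicity carries the bound from [f n] to [f k], and only the Lipschitz constant of that one
    [f k] is used to pass to [c]; so [L k] may blow up with [k]. *)
Lemma dini_attained m (K : set C) (f : nat -> ('I_m -> C) -> R) (L : nat -> R) (s : R) :
  compact K ->
  (forall k c c' d, (forall i, cdist (c i) (c' i) <= d) -> f k c' <= f k c + L k * d) ->
  (forall k l c, (k <= l)%N -> f l c <= f k c) ->
  (forall e n, 0 < e -> exists c, (forall i, K (c i)) /\ s - e <= f n c) ->
  exists c, (forall i, K (c i)) /\ forall k, s <= f k c.
Proof.
move=> cK lip dec ex; have [U [UU Uge]] := exists_ultrafilter.
have /choice[x hx] n : exists c, (forall i, K (c i)) /\ s - n.+1%:R^-1 <= f n c.
  by apply: ex; rewrite invr_gt0.
have /choice[c hc] i : exists a, K a /\ forall e, 0 < e -> U [set n | cdist (x n i) a < e].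
  have [a Ka ha] := @ultra_cvg U K (x ^~ i) UU cK (fun n => (hx n).1 i).
  by exists a.
exists c; split => [i|k]; first by have [] := hc i.
apply/ler_addgt0Pr => e e0.
have d0 : 0 < e / 2 / (`|L k| + 1) by rewrite !divr_gt0// ltr_wpDl.
have U1 : U [set n | forall i, cdist (x n i) (c i) < e / 2 / (`|L k| + 1)].
  by apply: filter_forall => i; exact: (hc i).2.
have [N hN] : exists N : nat, N.+1%:R^-1 <= e / 2.
  exists (Num.truncn (e / 2)^-1); rewrite -[leRHS]invrK lef_pV2 ?posrE ?invr_gt0 ?divr_gt0//.
  exact/ltW/truncnS_gt.
have U2 := Uge (maxn k N).
have [n [/= hn]] := filter_ex (filterI U1 U2).
rewrite geq_max => /andP[kn Nn].
have h1 := dec k n (x n) kn; have h2 : s - n.+1%:R^-1 <= f n (x n) := (hx n).2.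
have h3 : f k (x n) <= f k c + L k * (e / 2 / (`|L k| + 1)).
  by apply: lip => i; rewrite cdistC ltW.
have h4 : L k * (e / 2 / (`|L k| + 1)) <= e / 2.
  rewrite mulrCA ger_pMr ?divr_gt0// ler_pdivrMr ?ltr_wpDl// mul1r.
  by rewrite (le_trans (ler_norm _))// lerDl.
have h5 : n.+1%:R^-1 <= N.+1%:R^-1 :> R by rewrite lef_pV2 ?posrE// ler_nat.
move: (n.+1%:R^-1) (N.+1%:R^-1) h2 h5 hN => u v; move: (L k * _) h3 h4 => y; lra.
Qed.

Lemma dini_attained1 (K : set C) (f : nat -> C -> R) (L : nat -> R) (s : R) :
  compact K ->
  (forall k z w, f k w <= f k z + L k * cdist z w) ->
  (forall k l z, (k <= l)%N -> f l z <= f k z) ->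
  (forall e n, 0 < e -> exists2 z, K z & s - e <= f n z) ->
  exists2 z, K z & forall k, s <= f k z.
Proof.
move=> cK lip dec ex.
have [||e n e0|c [Kc hc]] := @dini_attained 1 K (fun k c => f k (c ord0)) (fun k => `|L k|) s cK.
- move=> k c c' d h; apply: le_trans (lip k (c ord0) _) _.
  rewrite lerD2l (le_trans (ler_wpM2r (cdist_ge0 _ _) (ler_norm _)))//.
  by rewrite ler_wpM2l.
- by move=> *; apply: dec.
- by have [z Kz hz] := ex e n e0; exists (fun=> z).
by exists (c ord0).
Qed.

Lemma attains_max (K : set C) (f : C -> R) (k : R) : compact K -> K !=set0 ->
  (forall z w, f z <= f w + k * cdist z w) ->
  exists2 z, K z & forall w, K w -> f w <= f z.
Proof.
move=> cK K0 lip; have cf := lipschitz_continuous lip.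
have [|c] := @compact_EVT_max _ _ f K K0 cK; first exact: continuous_subspaceT.
by rewrite inE => Kc hc; exists c => // w Kw; apply: hc; rewrite inE.
Qed.

End Topology.

(** * Borel sets and measurable functions on the plane *)

Section Measurability.
Variable R : realType.
Local Notation C := (R * R)%type.
Implicit Types (z t w : C) (e r : R).

Lemma measurable_cdist d (T : measurableType d) (f g : T -> C) :
  measurable_fun setT f -> measurable_fun setT g ->
  measurable_fun setT (fun x => cdist (f x) (g x)).
Proof.
move=> mf mg; rewrite /cdist.
have ms : measurable_fun [set: R] (@Num.sqrt R).
  by apply: continuous_measurable_fun; exact: sqrt_continuous.
apply: (measurableT_comp ms); apply: measurable_funD; apply: measurable_funX;
  apply: measurable_funB.
- exact: (measurableT_comp measurable_fst mf).
- exact: (measurableT_comp measurable_fst mg).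
- exact: (measurableT_comp measurable_snd mf).
- exact: (measurableT_comp measurable_snd mg).
Qed.

Lemma measurable_phi d (T : measurableType d) e (f g : T -> C) :
  measurable_fun setT f -> measurable_fun setT g ->
  measurable_fun setT (fun x => phi e (f x) (g x)).
Proof.
move=> mf mg; rewrite /phi /smooth_dist.
apply: (measurableT_comp (@measurable_realfun.measurable_ln R)).
have ms : measurable_fun [set: R] (@Num.sqrt R).
  by apply: continuous_measurable_fun; exact: sqrt_continuous.
apply: (measurableT_comp ms); apply: measurable_funD => //.
by apply: measurable_funX; apply: measurable_cdist.
Qed.

Lemma measurable_elog d (T : measurableType d) (f : T -> R) :
  measurable_fun setT f -> measurable_fun setT (fun x => elog (f x)).
Proof.
move=> mf; rewrite /elog; apply: measurable_fun_ifT => //.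
  exact: measurable_fun_eqr.
by apply/measurable_EFinP; apply: (measurableT_comp (@measurable_realfun.measurable_ln R)).
Qed.

(** A countable base: it makes open sets measurable for the product sigma-algebra, and it later
    covers the complement of a support by countably many null balls. *)
Definition rat_ball (q : rat * rat * rat) : set C :=
  [set t | cdist (ratr q.1.1, ratr q.1.2) t < ratr q.2].

Lemma measurable_cball z r : measurable [set t : C | cdist z t < r].
Proof.
have := @measurable_cdist _ C (fun=> z) id (measurable_cst _) (@measurable_id _ _ _).
move=> /(_ measurableT `]-oo, r[%classic) /(_ (measurable_itv _)).
by rewrite setTI; congr measurable; apply/seteqP; split => t /=; rewrite in_itv.
Qed.

Lemma rat_ball_basis z r : 0 < r ->
  exists q, rat_ball q z /\ forall t, rat_ball q t -> cdist z t < r.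
Proof.
move=> r0; have h : 0 < r / 2 by rewrite divr_gt0.
have [c] := rat_in_itvoo h; rewrite in_itv /= => /andP[c0 cr].
have h1 : z.1 < z.1 + ratr c / 2 by rewrite ltrDl divr_gt0.
have h2 : z.2 < z.2 + ratr c / 2 by rewrite ltrDl divr_gt0.
have [a] := rat_in_itvoo h1; rewrite in_itv /= => /andP[a1 a2].
have [b] := rat_in_itvoo h2; rewrite in_itv /= => /andP[b1 b2].
have qz : cdist (ratr a, ratr b) z < ratr c.
  apply: le_lt_trans (cdist_le_abs _ _) _ => /=.
  have -> : `|ratr a - z.1| = ratr a - z.1 by rewrite ger0_norm// subr_ge0 ltW.
  have -> : `|ratr b - z.2| = ratr b - z.2 by rewrite ger0_norm// subr_ge0 ltW.
  lra.
exists (a, b, c); split=> //= t; rewrite /rat_ball /= => qt.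
by have := cdist_triangle (ratr a, ratr b) z t; rewrite (cdistC z (_, _)); lra.
Qed.

Lemma open_measurable2 (A : set C) : open A -> measurable A.
Proof.
move=> oA; have -> : A = \bigcup_q (if `[< rat_ball q `<=` A >] then rat_ball q else set0).
  apply/seteqP; split => z.
    move=> Az; have /nbhs_cdistP[r r0 rA] : nbhs z A by exact: open_nbhs_nbhs.
    have [q [qz hq]] := rat_ball_basis z r0; exists q => //.
    by rewrite ifT//; apply/asboolP => t /hq /rA.
  by move=> [q _]; case: ifPn => // /asboolP h /h.
apply: countable_bigcupT_measurable => [|q]; first exact: countableP.
by case: ifP => // _; exact: measurable_cball.
Qed.

Lemma closed_measurable2 (A : set C) : closed A -> measurable A.
Proof. by move/closed_openC/open_measurable2/measurableC; rewrite setCK. Qed.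

Lemma compact_measurable2 (A : set C) : compact A -> measurable A.
Proof. by move/compact_closedC/closed_measurable2. Qed.

Lemma continuous_measurable2 (f : C -> R) : continuous f -> measurable_fun setT f.
Proof.
move=> /continuousP cf; apply: (measurability _ (RGenOpens.measurableE R)).
move=> _ [_ [a [b ->] <-]]; rewrite setTI; apply: open_measurable2.
exact/cf/interval_open.
Qed.

End Measurability.

(** * Real-valued integrals against finite measures carried by a compact set *)

Section FiniteIntegrals.
Variable R : realType.
Local Notation C := (R * R)%type.
Implicit Types (z t w : C) (e r : R) (f g : C -> R).

Definition fin_on (nu : cmeasure R) (K : set C) : Prop :=
  [/\ compact K, nu (~` K) = 0%E & (nu setT < +oo)%E].

(** Bounds are asked on the carrier [K] alone, since kernels and potentials are unbounded at
    infinity. *)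
Definition bm (K : set C) (f : C -> R) : Prop :=
  measurable_fun setT f /\ exists b, forall t, K t -> `|f t| <= b.

Definition mass (nu : cmeasure R) : R := fine (nu setT).

Variable K : set C.

Lemma bm_cst c : bm K (fun=> c).
Proof. by split; [exact: measurable_cst|exists `|c|]. Qed.

Lemma bmD f g : bm K f -> bm K g -> bm K (fun t => f t + g t).
Proof.
move=> [mf [a ha]] [mg [b hb]]; split; first exact: measurable_funD.
by exists (a + b) => t Kt; rewrite (le_trans (ler_normD _ _))// lerD ?ha ?hb.
Qed.

Lemma bmN f : bm K f -> bm K (fun t => - f t).
Proof.
move=> [mf [a ha]]; split; first exact: measurableT_comp.
by exists a => t Kt; rewrite normrN ha.
Qed.

Lemma bmB f g : bm K f -> bm K g -> bm K (fun t => f t - g t).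
Proof. by move=> bf bg; apply: bmD => //; exact: bmN. Qed.

Lemma bmZ c f : bm K f -> bm K (fun t => c * f t).
Proof.
move=> [mf [a ha]]; split; first exact: measurable_funM.
by exists (`|c| * a) => t Kt; rewrite normrM ler_wpM2l// ha.
Qed.

Lemma bm_sum I (s : seq I) (P : pred I) (F : I -> C -> R) :
  (forall i, bm K (F i)) -> bm K (fun t => \sum_(i <- s | P i) F i t).
Proof.
move=> bF; elim: s => [|i s IH].
  rewrite (_ : (fun t => _) = (fun=> 0)); first exact: bm_cst.
  by apply/funext => t; rewrite big_nil.
have [Pi|Pi] := boolP (P i); last first.
  by rewrite (_ : (fun t => _) = (fun t => \sum_(j <- s | P j) F j t))//;
    apply/funext => t; rewrite big_cons (negbTE Pi).
rewrite (_ : (fun t => _) = (fun t => F i t + \sum_(j <- s | P j) F j t)).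
  exact: bmD.
by apply/funext => t; rewrite big_cons Pi.
Qed.

Lemma bm_indic (A : set C) : measurable A -> bm K (\1_A).
Proof.
move=> mA; split; first exact: measurable_indic.
by exists 1 => t _; rewrite indicE; case: (_ \in _); rewrite ?normr1 ?normr0.
Qed.

Lemma bm_le f a b : measurable_fun setT f -> (forall t, K t -> a <= f t <= b) -> bm K f.
Proof.
move=> mf h; split=> //; exists (`|a| + `|b|) => t Kt; have /andP[h1 h2] := h _ Kt.
rewrite ler_norml; have := ler_norm b; have := ler_norm (- a); rewrite normrN.
have := normr_ge0 a; have := normr_ge0 b; lra.
Qed.

Lemma bm_EFin f : bm K f -> measurable_fun setT (EFin \o f).
Proof. by move=> [mf _]; apply/measurable_EFinP. Qed.

Variable nu : cmeasure R.
Hypothesis nuK : fin_on nu K.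

Let cK : compact K. Proof. by case: nuK. Qed.
Let mK : measurable K. Proof. exact: compact_measurable2. Qed.
Let nuC : nu (~` K) = 0%E. Proof. by case: nuK. Qed.

Lemma massE : nu setT = (mass nu)%:E.
Proof.
by case: nuK => _ _ h; rewrite /mass fineK// ge0_fin_numE.
Qed.

Lemma mass_ge0 : 0 <= mass nu.
Proof. by rewrite -lee_fin -massE. Qed.

Lemma measureK : nu K = (mass nu)%:E.
Proof.
rewrite -massE -[in RHS](setvU K) measureU//.
- by rewrite [X in (X + _)%E](_ : _ = 0%E) ?add0e.
- exact: measurableC.
- by rewrite setICl.
Qed.

Lemma measure_lty (A : set C) : measurable A -> (nu A < +oo)%E.
Proof.
move=> mA; case: nuK => _ _; apply: le_lt_trans.
by apply: le_measure; rewrite ?inE.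
Qed.

Let setTDK : setT `\` ~` K = K.
Proof. by rewrite setTD setCK. Qed.

Lemma fin_integrable f : bm K f -> nu.-integrable setT (EFin \o f).
Proof.
move=> [mf [b hb]].
apply/(@negligible_integrable _ _ _ nu setT (~` K)) => //.
- exact: measurableC.
- exact/measurable_EFinP.
rewrite setTDK; apply: measurable_bounded_integrable => //.
- by rewrite measureK ltry.
- exact: measurable_funTS.
exists b; split; first exact: num_real.
by move=> x bx t Kt /=; rewrite (le_trans (hb _ Kt))// ltW.
Qed.

Lemma fin_EFin f : bm K f -> (\int[nu]_t (f t)%:E)%E = (\int[nu]_t f t)%:E.
Proof.
move=> bf; rewrite /Rintegral fineK//.
by apply: integrable_fin_num => //; exact: fin_integrable.
Qed.

Lemma integral_on (v : C -> \bar R) : measurable_fun setT v ->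
  (\int[nu]_t v t = \int[nu]_(t in K) v t)%E.
Proof.
move=> mv; rewrite integralE [RHS]integralE.
by congr (_ - _)%E; (rewrite (@ge0_negligible_integral _ _ _ _ _ (~` K)) ?setTDK//;
  [exact: measurableC|]); [exact: measurable_funepos|exact: measurable_funeneg].
Qed.

Lemma fin_le f g : bm K f -> bm K g -> (forall t, K t -> f t <= g t) ->
  \int[nu]_t f t <= \int[nu]_t g t.
Proof.
move=> bf bg fg; rewrite -lee_fin -!fin_EFin//.
rewrite (integral_on (bm_EFin bf)) (integral_on (bm_EFin bg)).
apply: le_integral => //; last by move=> t Kt; rewrite lee_fin; apply: fg; rewrite inE in Kt.
- exact: (integrableS measurableT mK (@subsetT _ K) (fin_integrable bf)).
- exact: (integrableS measurableT mK (@subsetT _ K) (fin_integrable bg)).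
Qed.

Lemma finD f g : bm K f -> bm K g ->
  \int[nu]_t (f t + g t) = \int[nu]_t f t + \int[nu]_t g t.
Proof. by move=> bf bg; apply: RintegralD => //; exact: fin_integrable. Qed.

Lemma finB f g : bm K f -> bm K g ->
  \int[nu]_t (f t - g t) = \int[nu]_t f t - \int[nu]_t g t.
Proof. by move=> bf bg; apply: RintegralB => //; exact: fin_integrable. Qed.

Lemma finZ c f : bm K f -> \int[nu]_t (c * f t) = c * \int[nu]_t f t.
Proof. by move=> bf; apply: RintegralZl => //; exact: fin_integrable. Qed.

Lemma fin_cst c : \int[nu]_t c = c * mass nu.
Proof. by rewrite Rintegral_cst. Qed.

Lemma fin_sum I (s : seq I) (F : I -> C -> R) : (forall i, bm K (F i)) ->
  \int[nu]_t (\sum_(i <- s) F i t) = \sum_(i <- s) \int[nu]_t F i t.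
Proof.
move=> bF; elim: s => [|i s IH].
  rewrite big_nil -[RHS](mul0r (mass nu)) -fin_cst.
  by apply: eq_Rintegral => t _; rewrite big_nil.
rewrite big_cons -IH -finD//; last exact: bm_sum.
by apply: eq_Rintegral => t _; rewrite big_cons.
Qed.

Lemma fin_indic (A : set C) : measurable A -> \int[nu]_t \1_A t = fine (nu A).
Proof. by move=> mA; rewrite /Rintegral integral_indic// setIT. Qed.

Lemma le_integral_on (v w : C -> \bar R) :
  measurable_fun K v -> measurable_fun K w ->
  (forall t, K t -> (v t <= w t)%E) -> (\int[nu]_(t in K) v t <= \int[nu]_(t in K) w t)%E.
Proof.
move=> mv mw vw; rewrite integralE [leRHS]integralE.
apply: leeB; apply: ge0_le_integral => //.
- exact: measurable_funepos.
- exact: measurable_funepos.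
- by move=> t Kt; rewrite !funeposE; apply: le_max2 => //; exact: vw.
- exact: measurable_funeneg.
- exact: measurable_funeneg.
- by move=> t Kt; rewrite !funenegE; apply: le_max2 => //; rewrite leeN2; exact: vw.
Qed.

Lemma fin_ele (v : C -> \bar R) g : measurable_fun setT v -> bm K g ->
  (forall t, K t -> (v t <= (g t)%:E)%E) -> (\int[nu]_t v t <= (\int[nu]_t g t)%:E)%E.
Proof.
move=> mv bg vg; have mg := bm_EFin bg.
rewrite -fin_EFin// !integral_on//; by apply: le_integral_on => //; exact: measurable_funTS.
Qed.

Lemma fin_funepos_lty (v : C -> \bar R) g : measurable_fun setT v -> bm K g ->
  (forall t, K t -> (v t <= (g t)%:E)%E) -> (\int[nu]_t v^\+ t < +oo)%E.
Proof.
move=> mv bg vg.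
have : nu.-integrable setT ((EFin \o g)^\+)%E.
  by apply: integrable_funepos => //; exact: fin_integrable.
move/(integrable_lty measurableT); apply: le_lt_trans.
have mgp : measurable_fun setT ((EFin \o g)^\+)%E.
  by apply: measurable_funepos; exact: bm_EFin.
rewrite !integral_on//; last exact: measurable_funepos.
apply: le_integral_on; [|exact: measurable_funTS|].
  exact/measurable_funTS/measurable_funepos.
by move=> t Kt; rewrite !funeposE; apply: le_max2 => //; exact: vg.
Qed.

(** The upper bound makes the positive part integrable; the negative part is then finite because the
    whole integral is not [-oo]. *)
Lemma fin_integrable_e (v : C -> \bar R) g : measurable_fun setT v -> bm K g ->
  (forall t, K t -> (v t <= (g t)%:E)%E) -> (-oo < \int[nu]_t v t)%E ->
  nu.-integrable setT v.
Proof.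
move=> mv bg vg vNy.
have pos := fin_funepos_lty mv bg vg.
have neg : (\int[nu]_t v^\- t < +oo)%E.
  rewrite ltey; apply/eqP => neg; move: vNy; rewrite integralE neg.
  by move: pos; case: (\int[nu]_t v^\+ t)%E.
apply/integrableP; split=> //.
rewrite (_ : (fun x => `|v x|)%E = (fun x => (v^\+ x + v^\- x)%E)).
  rewrite ge0_integralD//; [exact: lte_add_pinfty|exact: measurable_funepos|exact: measurable_funeneg].
by apply/funext => t; have := fune_abse v; move/(congr1 (fun h => h t)).
Qed.

(** Monotone convergence for a decreasing sequence, applied to the nonnegative increasing functions
    [v_ 0 - v_ n]. The limit enters only through its real lower bounds, so values [-oo] of [v] need
    no separate treatment. *)
Lemma fin_mc (v : C -> \bar R) (v_ : nat -> C -> R) (s : R) :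
  measurable_fun setT v -> (forall n, bm K (v_ n)) ->
  (forall n p t, K t -> (n <= p)%N -> v_ p t <= v_ n t) ->
  (forall t x, K t -> (forall n, x <= v_ n t) -> (x%:E <= v t)%E) ->
  (forall n, s <= \int[nu]_t v_ n t) ->
  (s%:E <= \int[nu]_t v t)%E.
Proof.
move=> mv bv dec inf sv.
pose u n t := (v_ 0%N t - v_ n t)%:E.
pose w t := limn (u ^~ t).
have mu n : measurable_fun K (u n).
  by apply/measurable_funTS/measurable_EFinP; apply: measurable_funB; [case: (bv 0%N)|case: (bv n)].
have u0 n t : K t -> (0 <= u n t)%E by move=> Kt; rewrite lee_fin subr_ge0 dec.
have nd t : K t -> {homo u ^~ t : n p / (n <= p)%N >-> (n <= p)%E}.
  by move=> Kt n p np; rewrite lee_fin lerB// dec.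
have cvgu t : K t -> u ^~ t @ \oo --> ereal_sup (range (u ^~ t)).
  by move=> Kt; apply: ereal_nondecreasing_cvgn; exact: nd.
have wE t : K t -> w t = ereal_sup (range (u ^~ t)).
  by move=> Kt; apply/cvg_lim => //; exact: cvgu.
have mw : measurable_fun K w.
  apply: (@emeasurable_fun_cvg _ _ _ _ u) => // t Kt.
  by rewrite wE//; exact: cvgu.
have w0 t : K t -> (0 <= w t)%E.
  by move=> Kt; rewrite wE//; apply: le_trans (u0 0%N t Kt) _; apply: ereal_sup_ubound; exists 0%N.
have intu n : (\int[nu]_(t in K) u n t = (\int[nu]_t v_ 0%N t - \int[nu]_t v_ n t)%:E)%E.
  have b0n := bmB (bv 0%N) (bv n).
  by rewrite -finB// -fin_EFin// integral_on//; exact: bm_EFin.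
have wle : (\int[nu]_(t in K) w t <= (\int[nu]_t v_ 0%N t - s)%:E)%E.
  rewrite /w monotone_convergence//; apply: lime_le.
    apply: ereal_nondecreasing_is_cvgn => n p np; rewrite !intu lee_fin lerB//.
    by apply: fin_le => // t Kt; exact: dec.
  by apply: nearW => n; rewrite intu lee_fin lerB.
have iw : nu.-integrable K w.
  apply/integrableP; split=> //; apply: le_lt_trans (ltry (\int[nu]_t v_ 0%N t - s)).
  apply: le_trans wle; rewrite le_eqVlt; apply/orP; left; apply/eqP.
  by apply: eq_integral => t; rewrite inE => Kt; rewrite gee0_abs// w0.
have i0 : nu.-integrable K (EFin \o v_ 0%N).
  exact: (integrableS measurableT mK (@subsetT _ K) (fin_integrable (bv 0%N))).
rewrite integral_on//.
apply: (@le_trans _ _ (\int[nu]_(t in K) ((EFin \o v_ 0%N) \- w) t)%E).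
  rewrite integralB// -integral_on; last exact: bm_EFin.
  rewrite fin_EFin//; have : (0 <= \int[nu]_(t in K) w t)%E by apply: integral_ge0.
  move: wle; case: (\int[nu]_(t in K) w t)%E => // x.
  by rewrite -EFinB !lee_fin; lra.
apply: le_integral_on.
- by apply: emeasurable_funB => //; apply: measurable_funTS; exact: (bm_EFin (bv 0%N)).
- exact: measurable_funTS.
move=> t Kt /=; have := wE t Kt; have := w0 t Kt.
case: (w t) => [x _ wt| |] //; last by rewrite leNye.
rewrite -EFinB; apply: inf => // n.
have : (u n t <= x%:E)%E by rewrite wt; apply: ereal_sup_ubound; exists n.
by rewrite lee_fin; lra.
Qed.

End FiniteIntegrals.

Section Eps.
Variable R : realType.

Definition eps (n : nat) : R := n.+1%:R^-1.

Lemma eps_gt0 n : 0 < eps n.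
Proof. by rewrite invr_gt0. Qed.

Lemma le_eps n p : (n <= p)%N -> eps p <= eps n.
Proof. by move=> np; rewrite lef_pV2 ?posrE// ler_nat. Qed.

Lemma eps_le1 n : eps n <= 1.
Proof. by rewrite invf_le1// ler1n. Qed.

Lemma eps_lt (x : R) : 0 < x -> exists n, eps n < x.
Proof.
move=> x0; exists (Num.truncn x^-1).
by rewrite -[ltRHS]invrK ltf_pV2 ?posrE ?invr_gt0//; exact: truncnS_gt.
Qed.

End Eps.

(** * Regularised potentials, their limit and their symmetry *)

Section RegularisedPotential.
Variable R : realType.
Local Notation C := (R * R)%type.
Implicit Types (z t w : C) (e r : R) (f g : C -> R) (nu mu : cmeasure R) (K : set C).
Local Notation eps := (@eps R).

Definition rpot e nu z : R := \int[nu]_t phi e z t.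

Lemma bm_phi K e z : compact K -> 0 < e -> bm K (phi e z).
Proof.
move=> cK e0; have [b b0 hb] := compact_cdist_bounded z cK.
apply: (@bm_le _ _ _ (ln e) (ln (b + e))).
  exact: measurable_phi.
by move=> t Kt; rewrite phi_ge// phi_le// lerD2r hb.
Qed.

Lemma elog_le_phi e z t : 0 < e -> (elog (cdist z t) <= (phi e z t)%:E)%E.
Proof.
move=> e0; rewrite /elog; case: ifPn => [|d0]; first by rewrite leNye.
rewrite lee_fin; apply: ln_le; last exact: cdist_le_smooth.
by rewrite lt_def d0 cdist_ge0.
Qed.

Lemma le_elog (d x : R) : 0 <= d ->
  (forall e, 0 < e -> x <= ln (d + e)) -> (x%:E <= elog d)%E.
Proof.
move=> d0 h; have [dx|xd] := ltP d (expR x).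
  have e0 : 0 < (expR x - d) / 2 by rewrite divr_gt0// subr_gt0.
  have := h _ e0; rewrite leNgt => /negP[].
  rewrite -ltr_expR lnK ?posrE; last by lra.
  by lra.
have d1 : 0 < d := lt_le_trans (expR_gt0 _) xd.
by rewrite /elog gt_eqF// lee_fin -ler_expR lnK.
Qed.

Lemma phi_inf z t x : (forall n, x <= phi (eps n) z t) -> (x%:E <= elog (cdist z t))%E.
Proof.
move=> h; apply: le_elog => [|e e0]; first exact: cdist_ge0.
have [n ne] := eps_lt e0; apply: le_trans (h n) _.
apply: phi_le; first exact: eps_gt0.
by rewrite lerD2l ltW.
Qed.

Lemma measurable_pot_kernel z : measurable_fun setT (fun t => elog (cdist z t)).
Proof. by apply/measurable_elog/measurable_cdist. Qed.

Section OneMeasure.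
Variables (nu : cmeasure R) (K : set C).
Hypothesis nuK : fin_on nu K.
Let cK : compact K. Proof. by case: nuK. Qed.

Lemma rpot_lip e z w : 0 < e -> rpot e nu z <= rpot e nu w + mass nu / e * cdist z w.
Proof.
move=> e0; rewrite -mulrA mulrC -(fin_cst nu) -(finD nuK); first last.
- exact: bm_cst.
- exact: bm_phi.
apply: (fin_le nuK); [exact: bm_phi|by apply: bmD; [exact: bm_phi|exact: bm_cst]|].
by move=> t _; rewrite mulrC; exact: phi_lip.
Qed.

Lemma rpot_continuous e : 0 < e -> continuous (rpot e nu).
Proof. by move=> e0; apply: lipschitz_continuous => z w; exact: rpot_lip. Qed.

Lemma bm_rpot K' e : compact K' -> 0 < e -> bm K' (rpot e nu).
Proof.
move=> cK' e0; have [b b0 hb] := compact_cdist_bounded 0 cK'.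
have k0 : 0 <= mass nu / e by rewrite divr_ge0 ?(mass_ge0 nuK)// ltW.
apply: (@bm_le _ _ _ (rpot e nu 0 - mass nu / e * b) (rpot e nu 0 + mass nu / e * b)).
  by apply: continuous_measurable2; exact: rpot_continuous.
move=> t Kt; have h := ler_wpM2l k0 (hb t Kt).
have := rpot_lip t 0 e0; have := rpot_lip 0 t e0; rewrite (cdistC t 0).
move: h; move: (rpot e nu t) (rpot e nu 0) (mass nu / e * cdist 0 t) (mass nu / e * b).
by clear => x y u v h h1 h2; apply/andP; split; lra.
Qed.

Lemma le_rpot e e' z : 0 < e -> e <= e' -> rpot e nu z <= rpot e' nu z.
Proof.
move=> e0 ee; have e'0 := lt_le_trans e0 ee.
by apply: (fin_le nuK) => [||t _]; [exact: bm_phi|exact: bm_phi|exact: le_phi].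
Qed.

Lemma potential_le_rpot e z : 0 < e -> (potential nu z <= (rpot e nu z)%:E)%E.
Proof.
move=> e0; apply: (fin_ele nuK); [exact: measurable_pot_kernel|exact: bm_phi|].
by move=> t _; exact: elog_le_phi.
Qed.

(** Together with [potential_le_rpot] this makes the potential the infimum of its regularisations;
    it is how lower bounds reach true potentials. *)
Lemma le_potential s z : (forall n, s <= rpot (eps n) nu z) -> (s%:E <= potential nu z)%E.
Proof.
move=> h; apply: (@fin_mc _ _ _ nuK _ (fun n => phi (eps n) z)) => //.
- exact: measurable_pot_kernel.
- by move=> n; apply: bm_phi => //; exact: eps_gt0.
- by move=> n p t _ np; apply: le_phi; [exact: eps_gt0|exact: le_eps].
- by move=> t x _; exact: phi_inf.
Qed.

Lemma potential_lty z : (potential nu z < +oo)%E.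
Proof. exact: le_lt_trans (potential_le_rpot z ltr01) (ltry _). Qed.

Lemma potential_measurable : measurable_fun setT (potential nu).
Proof.
apply: (@emeasurable_fun_cvg _ _ _ _ (fun n z => (rpot (eps n) nu z)%:E)) => [n|z _].
  by apply/measurable_EFinP; apply: continuous_measurable2; apply: rpot_continuous; exact: eps_gt0.
have -> : potential nu z = ereal_inf (range (fun n => (rpot (eps n) nu z)%:E)).
  apply/eqP; rewrite eq_le; apply/andP; split.
    by apply: le_ereal_inf_tmp => _ [n _ <-]; apply: potential_le_rpot; exact: eps_gt0.
  set i := ereal_inf _.
  have hi n : (i <= (rpot (eps n) nu z)%:E)%E by apply: ereal_inf_lbound; exists n.
  move: hi; case: i => [x hi| /(_ 0%N)//|]; last by rewrite leNye.
  by apply: le_potential => n; rewrite -lee_fin.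
apply: ereal_nonincreasing_cvgn => n p np; rewrite lee_fin.
by apply: le_rpot; [exact: eps_gt0|exact: le_eps].
Qed.

Lemma neg_potential z : (\int[nu]_t (- elog (cdist z t)) = - potential nu z)%E.
Proof.
apply/integralN/fin_num_adde_defr; rewrite ge0_fin_numE ?integral_ge0//.
apply: (fin_funepos_lty nuK (measurable_pot_kernel z) (bm_phi z cK ltr01)) => t _.
exact: elog_le_phi.
Qed.

End OneMeasure.

(** Fubini-Tonelli takes bundled sigma-finite measures; this rebundles a finite one. *)
Lemma fin_sigma_finite nu K : fin_on nu K ->
  exists nu' : {sigma_finite_measure set C -> \bar R}, nu = nu'.
Proof.
move=> [_ _ nuT]; have fin : fin_num_fun nu by exact: lty_fin_num_fun.
have sf : sigma_finite setT nu.
  by apply: fin_num_fun_sigma_finite => //; rewrite measure0.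
pose H2 := isSFinite.Build _ _ _ _ (sfinite_measure_sigma_finite sf).
pose H3 := isSigmaFinite.Build _ _ _ _ sf.
pose nu' := HB.pack_for {sigma_finite_measure set C -> \bar R} (Measure.sort nu) H2 H3.
by exists nu'; exact: eq_measure.
Qed.

(** Tonelli is applied to the nonnegative kernel [phi e - ln e]; the constant then cancels. *)
Lemma rpot_fubini e mu nu K K' : 0 < e -> fin_on mu K -> fin_on nu K' ->
  \int[mu]_z rpot e nu z = \int[nu]_z rpot e mu z.
Proof.
move=> e0 muK nuK.
have step nu1 nu2 K1 K2 : fin_on nu1 K1 -> fin_on nu2 K2 ->
    (\int[nu1]_x \int[nu2]_y (phi e x y - ln e)%:E =
    (\int[nu1]_x rpot e nu2 x - ln e * mass nu2 * mass nu1)%:E)%E.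
  move=> h1 h2; have [[c1 _ _] [c2 _ _]] := (h1, h2).
  rewrite -[X in (_ - X)%:E](fin_cst nu1) -(finB h1); [|exact: (bm_rpot h2)|exact: bm_cst].
  rewrite -(fin_EFin h1); last by apply: bmB; [exact: (bm_rpot h2)|exact: bm_cst].
  apply: eq_integral => x _; rewrite (fin_EFin h2); last by apply: bmB; [exact: bm_phi|exact: bm_cst].
  by rewrite (finB h2) ?(fin_cst nu2)//; [exact: bm_phi|exact: bm_cst].
have E1 := step mu nu _ _ muK nuK; have E2 := step nu mu _ _ nuK muK.
have : (\int[mu]_x \int[nu]_y (phi e x y - ln e)%:E =
        \int[nu]_x \int[mu]_y (phi e x y - ln e)%:E)%E.
  have [mu' ->] := fin_sigma_finite muK; have [nu' ->] := fin_sigma_finite nuK.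
  have := @fubini_tonelli _ _ _ _ _ mu' nu' (fun xy : C * C => (phi e xy.1 xy.2 - ln e)%:E).
  rewrite /= => ->.
  - apply: eq_integral => y _; apply: eq_integral => x _; by rewrite phiC.
  - apply/measurable_EFinP; apply: measurable_funB => //.
    by apply: measurable_phi; [exact: measurable_fst|exact: measurable_snd].
  - by move=> [x y]; rewrite lee_fin subr_ge0 phi_ge.
rewrite E1 E2 => -[]; lra.
Qed.

End RegularisedPotential.

(** * Scaling, adding and restricting measures; energy *)

Section MeasureOps.
Variable R : realType.
Local Notation C := (R * R)%type.
Implicit Types (z t w : C) (e r : R) (f g : C -> R) (nu mu : cmeasure R) (K : set C).
Local Notation eps := (@eps R).

Lemma fin_onS nu K K' : fin_on nu K -> compact K' -> K `<=` K' -> fin_on nu K'.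
Proof.
move=> [cK nuK nuT] cK' KK'; split=> //; apply/eqP; rewrite eq_le measure_ge0 andbT.
rewrite -nuK le_measure// ?inE; first last.
- exact: subsetC.
- by apply: measurableC; exact: compact_measurable2.
- by apply: measurableC; exact: compact_measurable2.
Qed.

Definition mscaled (a : {nonneg R}) nu : cmeasure R := [the cmeasure R of mscale a nu].
Definition madd mu nu : cmeasure R := [the cmeasure R of measure_add mu nu].
Definition mrestricted nu (A : set C) (mA : measurable A) : cmeasure R :=
  [the cmeasure R of mrestr nu mA].

Lemma fin_on_mscaled a nu K : fin_on nu K -> fin_on (mscaled a nu) K.
Proof.
move=> nuK; have := massE nuK; case: nuK => [cK nuK nuT] h; split=> //=.
  by rewrite /mscale/= nuK mule0.
by rewrite /mscale/= h -EFinM ltry.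
Qed.

Lemma fin_on_madd mu nu K : fin_on mu K -> fin_on nu K -> fin_on (madd mu nu) K.
Proof.
move=> [cK muK muT] [_ nuK nuT]; split=> //.
  by rewrite [LHS](measure_addE mu nu) muK nuK adde0.
by rewrite [ltLHS](measure_addE mu nu); exact: lte_add_pinfty.
Qed.

Lemma fin_on_mrestricted nu K A (mA : measurable A) :
  fin_on nu K -> fin_on (mrestricted nu mA) K.
Proof.
move=> nuK; have mlt := measure_lty nuK; case: nuK => [cK nuK nuT]; split=> //=.
  apply/eqP; rewrite eq_le measure_ge0 andbT /mrestr -nuK le_measure// ?inE.
  - by apply: measurableI => //; by apply: measurableC; exact: compact_measurable2.
  - by apply: measurableC; exact: compact_measurable2.
by rewrite /mrestr setTI; exact: mlt.
Qed.

Lemma int_mscaled a nu K f : fin_on nu K -> bm K f ->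
  \int[mscaled a nu]_t f t = a%:num * \int[nu]_t f t.
Proof.
move=> nuK bf; have h := fin_on_mscaled a nuK; have mf := bm_EFin bf.
have fi := fin_integrable nuK bf.
have : (\int[mscaled a nu]_t (f t)%:E = a%:num%:E * \int[nu]_t (f t)%:E)%E.
  rewrite integralE [X in (_ * X)%E]integralE muleBr//; last first.
    apply: fin_num_adde_defr.
    exact: integrable_pos_fin_num.
  congr (_ - _)%E; apply: ge0_integral_mscale => //.
    exact: measurable_funepos.
  exact: measurable_funeneg.
by rewrite (fin_EFin h)// (fin_EFin nuK)// -EFinM => -[].
Qed.

Lemma int_madd mu nu K f : fin_on mu K -> fin_on nu K -> bm K f ->
  \int[madd mu nu]_t f t = \int[mu]_t f t + \int[nu]_t f t.
Proof.
move=> muK nuK bf; have h := fin_on_madd muK nuK; have mf := bm_EFin bf.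
have : (\int[madd mu nu]_t (f t)%:E = \int[mu]_t (f t)%:E + \int[nu]_t (f t)%:E)%E.
  by apply: integral_measure_add => //; [exact: (fin_integrable muK)|exact: (fin_integrable nuK)].
by rewrite (fin_EFin h)// (fin_EFin muK)// (fin_EFin nuK)// -EFinD => -[].
Qed.

Lemma bm_restr K A f : measurable A -> bm K f -> bm K (fun t => f t * \1_A t).
Proof.
move=> mA [mf [b hb]]; split.
  by apply: measurable_funM => //; exact: measurable_indic.
exists b => t Kt; rewrite normrM (le_trans _ (hb t Kt))// ler_piMr//.
by rewrite indicE; case: (_ \in _); rewrite ?normr1 ?normr0.
Qed.

Lemma int_mrestricted nu K A (mA : measurable A) f : fin_on nu K -> bm K f ->
  \int[mrestricted nu mA]_t f t = \int[nu]_t (f t * \1_A t).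
Proof.
move=> nuK bf; have h := fin_on_mrestricted mA nuK; have mf := bm_EFin bf.
have bfA := bm_restr mA bf.
suff : (\int[mrestricted nu mA]_t (f t)%:E = \int[nu]_t (f t * \1_A t)%:E)%E.
  by rewrite (fin_EFin h)// (fin_EFin nuK)// => -[].
have -> : (\int[nu]_t (f t * \1_A t)%:E = \int[nu]_(t in A) (f t)%:E)%E.
  rewrite [RHS]integral_mkcond; apply: eq_integral => t _.
  by rewrite patchE indicE; case: (_ \in _); rewrite ?mulr1 ?mulr0.
rewrite (@negligible_integral _ _ _ _ _ (~` A))//; first last.
- by rewrite /= /mrestr setICl measure0.
- exact: (fin_integrable h).
- exact: measurableC.
rewrite setTD setCK; apply: eq_measure_integral => B mB BA /=.
by rewrite /mrestr; congr (nu _); exact/setIidPl.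
Qed.

Section Energy.
Variables (nu : cmeasure R) (K : set C).
Hypothesis nuK : fin_on nu K.
Let cK : compact K. Proof. by case: nuK. Qed.

Lemma energyE : (energy nu = - \int[nu]_z potential nu z)%E.
Proof.
rewrite /energy; under eq_integral do rewrite (neg_potential nuK).
apply/integralN/fin_num_adde_defr; rewrite ge0_fin_numE ?integral_ge0//.
apply: (fin_funepos_lty nuK (potential_measurable nuK) (bm_rpot nuK cK ltr01)) => t _.
exact: (potential_le_rpot nuK).
Qed.

Lemma energy_ge e : 0 < e -> ((- \int[nu]_z rpot e nu z)%:E <= energy nu)%E.
Proof.
move=> e0; rewrite energyE EFinN leeN2.
apply: (fin_ele nuK (potential_measurable nuK) (bm_rpot nuK cK e0)) => t _.
exact: (potential_le_rpot nuK).
Qed.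

Lemma energy_le s : (forall n, s <= \int[nu]_z rpot (eps n) nu z) ->
  (energy nu <= (- s)%:E)%E.
Proof.
move=> h; rewrite energyE EFinN leeN2.
apply: (@fin_mc _ _ _ nuK _ (fun n => rpot (eps n) nu)) => //.
- exact: (potential_measurable nuK).
- by move=> n; apply: (bm_rpot nuK cK); exact: eps_gt0.
- by move=> n p t _ np; apply: (le_rpot nuK); [exact: eps_gt0|exact: le_eps].
- by move=> t x _; exact: (le_potential nuK).
Qed.

End Energy.

End MeasureOps.

(** * Four-point sums of potentials *)

Section FourPointPotential.
Variable R : realType.
Local Notation C := (R * R)%type.
Implicit Types (z t w : C) (e r : R) (nu : cmeasure R) (K : set C).

Lemma sum4_int nu K (F : C -> C -> R) z r : fin_on nu K -> 0 <= r ->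
  (forall w, cdist w z = r -> bm K (F w)) ->
  sum4 (fun w => \int[nu]_t F w t) z r = \int[nu]_t sum4 (F ^~ t) z r.
Proof.
move=> nuK r0 h.
have [h1 h2 h3 h4] : [/\ bm K (F (z.1 + r, z.2)), bm K (F (z.1 - r, z.2)),
    bm K (F (z.1, z.2 + r)) & bm K (F (z.1, z.2 - r))].
  by split; apply/h/(cdist_sum4 r0); rewrite !inE eqxx ?orbT.
by rewrite /sum4 !(finD nuK) => //; do ?apply: bmD.
Qed.

Lemma bm_sum4 K (F : C -> C -> R) z r : 0 <= r ->
  (forall w, cdist w z = r -> bm K (F w)) -> bm K (fun t => sum4 (F ^~ t) z r).
Proof.
move=> r0 h; rewrite /sum4.
by do ?apply: bmD; apply/h/(cdist_sum4 r0); rewrite !inE eqxx ?orbT.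
Qed.

Lemma sum4_rpot_ge nu K e r z b : fin_on nu K -> 0 < r -> r <= e ->
  (forall t, K t -> cdist z t ^+ 2 + e ^+ 2 <= b) ->
  4 * rpot e nu z + mass nu * (r ^+ 2 * e ^+ 2 / (3 * b ^+ 2)) <= sum4 (rpot e nu) z r.
Proof.
move=> nuK r0 re hb; have cK : compact K by case: nuK.
have e0 := lt_le_trans r0 re.
rewrite /rpot (sum4_int nuK (ltW r0)); last by move=> *; exact: bm_phi.
have bz : bm K (phi e z) by exact: bm_phi.
rewrite [mass nu * _]mulrC -(fin_cst nu) -(finZ nuK)// -(finD nuK); [|exact: bmZ|exact: bm_cst].
apply: (fin_le nuK).
- by apply: bmD; [exact: bmZ|exact: bm_cst].
- by apply: bm_sum4 (ltW r0) _ => *; exact: bm_phi.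
- by move=> t Kt; apply: phi4_ge => //; exact: hb.
Qed.

Lemma bm_phi0 K d z : compact K -> 0 < d -> (forall t, K t -> d <= cdist z t) -> bm K (phi 0 z).
Proof.
move=> cK d0 hd; have [b b0 hb] := compact_cdist_bounded z cK.
apply: (@bm_le _ _ _ (ln d) (ln b)).
  exact: measurable_phi.
move=> t Kt; rewrite phi0 !ln_le ?hd ?hb//.
exact: lt_le_trans (hd t Kt).
Qed.

Lemma sum4_rpot0_le nu K d r z : fin_on nu K -> 0 < r -> r < d ->
  (forall t, K t -> d <= cdist z t) ->
  sum4 (rpot 0 nu) z r <= 4 * rpot 0 nu z + mass nu * (r ^+ 4 / d ^+ 4).
Proof.
move=> nuK r0 rd hd; have cK : compact K by case: nuK.
have bw w : cdist w z = r -> bm K (phi 0 w).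
  move=> wz; apply: (@bm_phi0 _ (d - r)) => //; first by rewrite subr_gt0.
  move=> t Kt; have := hd t Kt; have := cdist_triangle w z t; rewrite (cdistC z w) wz; lra.
have bz : bm K (phi 0 z) by apply: (bm_phi0 cK _ hd); exact: lt_trans rd.
rewrite /rpot (sum4_int nuK (ltW r0))//.
rewrite [mass nu * _]mulrC -(fin_cst nu) -(finZ nuK)// -(finD nuK); [|exact: bmZ|exact: bm_cst].
apply: (fin_le nuK).
- exact: bm_sum4 (ltW r0) _.
- by apply: bmD; [exact: bmZ|exact: bm_cst].
- by move=> t Kt; apply: phi4_le => //; exact: hd.
Qed.

(** A radius at which the quadratic gain of [sum4_rpot_ge] beats the quartic error of
    [sum4_rpot0_le], subject to the conditions [r <= e] and [r < d] of these two lemmas. *)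
Lemma gain_radius (k e d : R) : 0 < k -> 0 < e -> 0 < d ->
  exists r, [/\ 0 < r, r <= e, r < d & r ^+ 4 / d ^+ 4 < r ^+ 2 * k].
Proof.
move=> k0 e0 d0; have d40 : 0 < d ^+ 4 by rewrite exprn_gt0.
pose r := Num.min (Num.min e (d / 2)) (Num.min 1 (k * d ^+ 4 / 2)).
have r0 : 0 < r by rewrite !lt_min e0 ltr01 !divr_gt0 ?mulr_gt0.
have : r <= r by [].
rewrite {2}/r !le_min => /andP[/andP[re rd] /andP[r1 rk]].
exists r; split=> //; first by lra.
rewrite ltr_pdivrMr// -mulrA (exprM r 2 2) expr2 ltr_pM2l ?exprn_gt0//.
have : r ^+ 2 <= r by rewrite expr2 ler_piMr// ltW.
have : 0 < k * d ^+ 4 by rewrite mulr_gt0.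
lra.
Qed.

End FourPointPotential.

Lemma negligible_bigcup_countable d (T : measurableType d) (R : realType)
  (m : {measure set T -> \bar R}) (I : countType) (F : I -> set T) :
  (forall i, m.-negligible (F i)) -> m.-negligible (\bigcup_i F i).
Proof.
move=> hF.
have sub : \bigcup_i F i `<=` \bigcup_n oapp F set0 (unpickle n).
  by move=> x [i _ Fx]; exists (pickle i) => //; rewrite pickleK.
apply: negligibleS sub _; apply: negligible_bigcup => n; case: unpickle => [i|] /=; first exact: hF.
exact: negligible_set0.
Qed.

(** * The equilibrium measure: variational inequality and support *)

Section Equilibrium.
Variable R : realType.
Local Notation C := (R * R)%type.
Implicit Types (z t w : C) (e r : R).
Local Notation eps := (@eps R).
Variables (E : set C) (mu : cmeasure R).
Hypotheses (cE : compact E) (capE : (-oo < log_cap E)%E) (eqE : is_equilibrium E mu).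

Lemma eq_fin : fin_on mu E.
Proof. by case: eqE => -[muT muE] _; split=> //; rewrite muT ltry. Qed.

Lemma prob_mass (nu : cmeasure R) : nu setT = 1%E -> mass nu = 1.
Proof. by rewrite /mass => ->. Qed.

Lemma eq_mass : mass mu = 1.
Proof. by case: eqE => -[muT _] _; exact: prob_mass. Qed.

Lemma eq_cst c : \int[mu]_t c = c.
Proof. by rewrite fin_cst eq_mass mulr1. Qed.

Definition lc : R := fine (log_cap E).

Lemma log_capE : log_cap E = lc%:E.
Proof.
rewrite /lc fineK// fin_numE -ltNye capE/= -ltey.
case: eqE => _ h; have := energy_ge eq_fin ltr01; rewrite h.
by case: (log_cap E) => // x; rewrite ltry.
Qed.

Lemma lc_le e : 0 < e -> lc <= \int[mu]_z rpot e mu z.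
Proof.
move=> e0; case: eqE => _ h; have := energy_ge eq_fin e0.
by rewrite h log_capE -EFinN lee_fin lerN2.
Qed.

Lemma lc_max (s : cmeasure R) (x : R) : fin_on s E -> mass s = 1 ->
  (forall n, x <= \int[s]_z rpot (eps n) s z) -> x <= lc.
Proof.
move=> sE s1 hx; have := energy_le sE hx; rewrite EFinN => h.
have : (- log_cap E <= energy s)%E.
  rewrite /log_cap oppeK; apply: ereal_inf_lbound; exists s; split=> //.
  split; last by case: sE.
  by rewrite (massE sE) s1.
by move=> /le_trans/(_ h); rewrite log_capE -EFinN lee_fin lerN2.
Qed.

(** Extremality of [mu] is tested on the mixtures [(1 - a) mu + a s]. To first order in [a] it reads
    [2 a (x - lc) <= O(a^2)]; the finite energy bound [b] of [s] controls the quadratic term. *)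
Lemma variational (s : cmeasure R) (b x : R) : fin_on s E -> mass s = 1 ->
  (forall n, b <= \int[s]_z rpot (eps n) s z) ->
  (forall n, x <= \int[s]_z rpot (eps n) mu z) -> x <= lc.
Proof.
move=> sE s1 hb hx; have muE := eq_fin.
have key (a : R) : 0 < a -> a < 1 ->
    (1 - a) ^+ 2 * lc + 2 * a * (1 - a) * x + a ^+ 2 * b <= lc.
  move=> a0 a1; have a1' : 0 <= 1 - a by rewrite subr_ge0 ltW.
  pose A : {nonneg R} := NngNum (ltW a0); pose B : {nonneg R} := NngNum a1'.
  pose mix := madd (mscaled B mu) (mscaled A s).
  have fB := fin_on_mscaled B muE; have fA := fin_on_mscaled A sE.
  have fm : fin_on mix E := fin_on_madd fB fA.
  have intE f : bm E f -> \int[mix]_t f t = (1 - a) * \int[mu]_t f t + a * \int[s]_t f t.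
    by move=> bf; rewrite (int_madd fB fA bf) (int_mscaled _ muE bf) (int_mscaled _ sE bf).
  apply: (lc_max fm).
    have := intE (fun=> 1) (bm_cst E 1); rewrite !fin_cst eq_mass s1; lra.
  move=> n; have e0 := eps_gt0 R n.
  have bmu := bm_rpot muE cE e0; have bs := bm_rpot sE cE e0.
  have potE z : rpot (eps n) mix z = (1 - a) * rpot (eps n) mu z + a * rpot (eps n) s z.
    by rewrite /rpot intE//; exact: bm_phi.
  have -> : \int[mix]_z rpot (eps n) mix z =
      \int[mix]_z ((1 - a) * rpot (eps n) mu z + a * rpot (eps n) s z).
    by apply: eq_Rintegral => z _; exact: potE.
  rewrite intE; last by apply: bmD; apply: bmZ.
  rewrite (finD muE); [|exact: bmZ|exact: bmZ]; rewrite (finD sE); [|exact: bmZ|exact: bmZ].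
  rewrite !(finZ muE)// !(finZ sE)// (rpot_fubini e0 muE sE).
  have h1 := lc_le e0; have h2 := hx n; have h3 := hb n.
  move: h1 h2 h3; set p := \int[mu]_z _; set q := \int[s]_z rpot _ mu z; set v := \int[s]_z _.
  move=> h1 h2 h3.
  have k1 := ler_wpM2l (sqr_ge0 (1 - a)) h1; have k3 := ler_wpM2l (sqr_ge0 a) h3.
  have aa : 0 <= 2 * a * (1 - a) by rewrite !mulr_ge0// ltW.
  have k2 := ler_wpM2l aa h2.
  have -> : (1 - a) * ((1 - a) * p + a * q) + a * ((1 - a) * q + a * v) =
    (1 - a) ^+ 2 * p + 2 * a * (1 - a) * q + a ^+ 2 * v by ring.
  lra.
rewrite leNgt; apply/negP => lx.
(* [2 x - lc - b] is the coefficient of [a^2]; taking [a <= (x - lc) / m] keeps the quadratic term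
   below the linear one. *)
pose m := `|2 * x - lc - b| + 1.
have m0 : 0 < m by rewrite ltr_wpDl.
pose a := Num.min (1 / 2) ((x - lc) / m).
have a0 : 0 < a by rewrite lt_min !divr_gt0// subr_gt0.
have a1 : a <= 1 / 2 by rewrite ge_min lexx.
have a2 : a <= (x - lc) / m by rewrite ge_min lexx orbT.
have := key a a0; rewrite (le_lt_trans a1); last by lra.
move=> /(_ isT) h.
have h' : a * (2 * (x - lc)) <= a * (a * (2 * x - lc - b)) by lra.
rewrite ler_pM2l// in h'.
have : a * (2 * x - lc - b) <= a * m.
  by rewrite ler_wpM2l ?ltW// ltr_pwDr// ler_norm.
have : a * m <= x - lc by rewrite -ler_pdivlMr.
lra.
Qed.

Lemma kernel_bound : exists2 D, 1 <= D &
  forall e z t, 0 < e -> e <= 1 -> E z -> E t -> phi e z t <= D.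
Proof.
have [b b0 hb] := compact_cdist_bounded 0 cE.
exists (b + b + 1); first by lra.
move=> e z t e0 e1 Ez Et; apply: le_trans (phi_le (b := b + b + 1) _ _) _ => //.
  have := hb z Ez; have := hb t Et; have := cdist_triangle 0 z t; rewrite (cdistC z 0); lra.
by apply/ltW/ln_sublinear; lra.
Qed.

Lemma closed_rpot_ge (nu : cmeasure R) K e x : fin_on nu K -> 0 < e ->
  closed [set z | x <= rpot e nu z].
Proof.
move=> nuK e0.
have := @closed_comp _ _ (rpot e nu) [set y | x <= y] _ (@closed_ge R x).
apply=> z _; exact: (rpot_continuous nuK e0).
Qed.

(** Were the set of positive mass, [mu] restricted to it and normalised would be a competitor of
    finite energy in [variational], with [x = lc + d]. *)
Lemma high_potential_null d : 0 < d ->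
  mu [set z | forall n, lc + d <= rpot (eps n) mu z] = 0%E.
Proof.
move=> d0; set A := [set z | _]; have muE := eq_fin.
have mA : measurable A.
  have -> : A = \bigcap_n [set z | lc + d <= rpot (eps n) mu z].
    by apply/seteqP; split => z h; [move=> n _; exact: h|move=> n; exact: h].
  apply: bigcap_measurable => [|n _]; first by exists 0%N.
  apply: closed_measurable2; apply: (@closed_rpot_ge mu E _ _ muE); exact: eps_gt0.
apply/eqP; rewrite eq_le measure_ge0 andbT leNgt; apply/negP => muA0.
have muAfin : mu A \is a fin_num by rewrite ge0_fin_numE//; exact: (measure_lty muE).
pose a := fine (mu A); have a0 : 0 < a by rewrite fine_gt0// muA0 (measure_lty muE).
have ai0 : 0 < a^-1 by rewrite invr_gt0.
pose rs := mrestricted mu mA; have fr : fin_on rs E := fin_on_mrestricted mA muE.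
pose s := mscaled (NngNum (ltW ai0)) rs; have fs : fin_on s E := fin_on_mscaled _ fr.
have intE f : bm E f -> \int[s]_t f t = a^-1 * \int[mu]_t (f t * \1_A t).
  by move=> bf; rewrite (int_mscaled _ fr bf) (int_mrestricted mA muE bf).
have intA c : \int[mu]_t (c * \1_A t) = c * a.
  by rewrite (finZ muE) ?(fin_indic mu mA)//; exact: bm_indic.
have [D D1 hD] := kernel_bound.
suff : lc + d <= lc by lra.
(* Discarding the complement of [A] in each of the two variables costs at most the kernel bound [D],
   and normalising gives one factor [a^-1] per variable. *)
apply: (@variational s (a^-1 * (a^-1 * (lc - 2 * D)))) => //.
- have := intE _ (bm_cst E 1); rewrite fin_cst intA !mul1r mulVf// gt_eqF//.
- move=> n; have e0 := eps_gt0 R n; have e1 := eps_le1 R n.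
  have bq := bm_rpot fr cE e0.
  have qE z : rpot (eps n) rs z = \int[mu]_t (phi (eps n) z t * \1_A t).
    by rewrite /rpot (int_mrestricted mA muE)//; exact: bm_phi.
  have -> : \int[s]_z rpot (eps n) s z = a^-1 * \int[s]_z rpot (eps n) rs z.
    rewrite -(finZ fs)//; apply: eq_Rintegral => z _; rewrite /rpot.
    by rewrite (int_mscaled _ fr)//; exact: bm_phi.
  rewrite intE// !ler_pM2l// -(eq_cst (2 * D)).
  have bmu := bm_rpot muE cE e0.
  apply: (@le_trans _ _ (\int[mu]_z rpot (eps n) mu z - \int[mu]_z (2 * D))).
    by apply: lerB => //; exact: lc_le.
  rewrite -(finB muE)//; last exact: bm_cst.
  apply: (fin_le muE).
  - by apply: bmB => //; exact: bm_cst.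
  - exact: bm_restr.
  move=> z Ez.
  have bA := bm_restr mA (bm_phi z cE e0).
  have q1 : rpot (eps n) mu z - D <= rpot (eps n) rs z.
    rewrite qE -[D]eq_cst -(finB muE); [|exact: bm_phi|exact: bm_cst].
    apply: (fin_le muE) => [|//|t Et]; first by apply: bmB; [exact: bm_phi|exact: bm_cst].
    have := hD _ _ _ e0 e1 Ez Et; rewrite indicE; case: (_ \in _) => /=; lra.
  have q2 : rpot (eps n) rs z <= D.
    rewrite qE -[D]eq_cst.
    apply: (fin_le muE) => [//||t Et]; first exact: bm_cst.
    have := hD _ _ _ e0 e1 Ez Et; rewrite indicE; case: (_ \in _) => /=; lra.
  rewrite indicE; case: (_ \in _) => /=; lra.
- move=> n; have e0 := eps_gt0 R n; have bmu := bm_rpot muE cE e0.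
  rewrite intE// -(ler_pM2l a0) mulVKf ?gt_eqF// mulrC -intA.
  apply: (fin_le muE); [exact: (bm_restr mA (bm_cst E (lc + d)))|exact: bm_restr|].
  move=> z Ez; rewrite indicE; have [|Az] := boolP (z \in A); last by rewrite !mulr0.
  by rewrite inE !mulr1 => Az; exact: Az.
Qed.

Lemma msupp_sub : msupp mu `<=` E.
Proof.
move=> z sz; apply: contrapT => nEz; have muE := eq_fin.
have /nbhs_cdistP[r r0 hr] : nbhs z (~` E).
  by apply: open_nbhs_nbhs; split=> //; apply: closed_openC; exact: compact_closedC.
have := sz r r0; apply/negP; rewrite -leNgt.
case: (muE) => _ <- _; apply: le_measure; rewrite ?inE//.
- exact: measurable_cball.
- by apply: measurableC; exact: compact_measurable2.
Qed.

Lemma msupp_closed : closed (msupp mu).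
Proof.
rewrite closedE => z hz r r0.
have r2 : 0 < r / 2 by rewrite divr_gt0.
have [w [sw zw]] : exists w, msupp mu w /\ cdist z w < r / 2.
  apply: contrapT => h; apply: hz; apply/nbhs_cdistP; exists (r / 2) => // t zt st.
  by apply: h; exists t.
apply: lt_le_trans (sw _ r2) _; apply: le_measure; rewrite ?inE.
- exact: measurable_cball.
- exact: measurable_cball.
by move=> t /= wt; have := cdist_triangle w z t; lra.
Qed.

Lemma msupp_compact : compact (msupp mu).
Proof. exact: subclosed_compact msupp_closed cE msupp_sub. Qed.

(** The complement of the support is covered by the rational balls of measure zero, of which there
    are countably many. *)
Lemma msupp_fin : fin_on mu (msupp mu).
Proof.
have muE := eq_fin; split; [exact: msupp_compact| |by case: muE].
have sub : ~` msupp mu `<=` \bigcup_q (if mu (@rat_ball R q) == 0%E then @rat_ball R q else set0).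
  move=> z /existsNP [r /not_implyP[r0 /negP]]; rewrite -leNgt => hr.
  have [q [qz hq]] := rat_ball_basis z r0; exists q => //.
  rewrite ifT// eq_le measure_ge0 andbT (le_trans _ hr)// le_measure// ?inE.
  - exact: measurable_cball.
  - exact: measurable_cball.
have mS : measurable (~` msupp mu) by apply: measurableC; exact: compact_measurable2 msupp_compact.
apply: measure_negligible => //; apply: negligibleS sub _; apply: negligible_bigcup_countable => q.
case: ifPn => [/eqP h|_]; last exact: negligible_set0.
by exists (@rat_ball R q); split => //; exact: measurable_cball.
Qed.

Lemma msupp_nonempty : msupp mu !=set0.
Proof.
apply/set0P/eqP => h; have := measureK msupp_fin; rewrite h measure0 eq_mass.
by move=> [] /eqP; rewrite eq_sym oner_eq0.
Qed.

End Equilibrium.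

(** * The equilibrium potential on and near the support *)

Section EquilibriumSupport.
Variable R : realType.
Local Notation C := (R * R)%type.
Implicit Types (z t w : C) (e r : R).
Local Notation eps := (@eps R).
Variables (E : set C) (mu : cmeasure R).
Hypotheses (cE : compact E) (capE : (-oo < log_cap E)%E) (eqE : is_equilibrium E mu).
Local Notation lc := (lc E).
Local Notation S := (msupp mu).
Let muE : fin_on mu E. Proof. exact: eq_fin. Qed.
Let cS : compact S. Proof. exact: (msupp_compact cE eqE). Qed.
Let muS : fin_on mu S. Proof. exact: (msupp_fin cE eqE). Qed.
Let mass1 : mass mu = 1. Proof. exact: (eq_mass eqE). Qed.
Let cstE c : \int[mu]_t c = c. Proof. exact: (eq_cst eqE). Qed.

(** A deficit [2 h] at a support point persists, as a deficit [h], on a ball of positive mass. The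
    mean of the potential is at least [lc], so it would have to be compensated by high values, which
    occur only on sets of small mass. *)
Lemma rpot_ge_msupp z e : S z -> 0 < e -> lc <= rpot e mu z.
Proof.
move=> Sz e00; have [n0 hn0] := eps_lt e00; have e0 := eps_gt0 R n0.
apply: le_trans (le_rpot muE z e0 (ltW hn0)); rewrite leNgt; apply/negP => hz.
pose h := (lc - rpot (eps n0) mu z) / 2.
have h0 : 0 < h by rewrite divr_gt0// subr_gt0.
have r0 : 0 < h * eps n0 by rewrite mulr_gt0.
pose B := [set t | cdist z t < h * eps n0].
have mB : measurable B by exact: measurable_cball.
have hB t : B t -> rpot (eps n0) mu t <= lc - h.
  move=> Bt; have := rpot_lip muE t z e0; rewrite mass1 mul1r (cdistC t).
  have : (eps n0)^-1 * cdist z t <= h by rewrite mulrC ler_pdivrMr// ltW.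
  rewrite /h; move: (rpot _ _ t) (rpot _ _ z) ((eps n0)^-1 * _) => *; lra.
pose b := fine (mu B).
have b0 : 0 < b by rewrite fine_gt0// (Sz _ r0) (measure_lty muE).
have [D D1 hD] := kernel_bound cE.
pose M := `|D - lc| + h + 1.
have M0 : 0 < M by rewrite ltr_wpDl ?addr_ge0// ltW.
have d0 : 0 < h * b / 2 by rewrite divr_gt0// mulr_gt0.
pose A n := [set t | lc + h * b / 2 <= rpot (eps n) mu t].
have mA n : measurable (A n).
  by apply: closed_measurable2; apply: (@closed_rpot_ge _ mu E _ _ muE); exact: eps_gt0.
(* The sets [A n] decrease to a set that is null by [high_potential_null]; continuity from above
   applies because [mu] is finite. *)
have [n n0n hn] : exists2 n, (n0 <= n)%N & fine (mu (A n)) < h * b / (4 * M).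
  have : mu (A n) @[n --> \oo] --> mu (\bigcap_n A n).
    apply: nonincreasing_cvg_mu => //.
    - exact: (measure_lty muE).
    - exact: bigcapT_measurable.
    - move=> n p np; apply/subsetPset => t /= At; apply: le_trans At _.
      by apply: (le_rpot muE); [exact: eps_gt0|exact: le_eps].
  have -> : mu (\bigcap_n A n) = 0%E.
    rewrite -(high_potential_null cE capE eqE d0); congr (mu _).
    by apply/seteqP; split => t ht; [move=> n; exact: ht|move=> n _; exact: ht].
  move/fine_cvgP => [_ /cvgrPdist_lt /(_ (h * b / (4 * M)))].
  have q0 : 0 < h * b / (4 * M) by apply: divr_gt0; apply: mulr_gt0.
  move=> /(_ q0) [N _ hN].
  exists (maxn n0 N); first exact: leq_maxl.
  by have := hN (maxn n0 N) (leq_maxr _ _) => /=; rewrite sub0r normrN; apply: le_lt_trans (ler_norm _).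
have en := eps_gt0 R n.
have bB := bm_indic E mB; have bA := bm_indic E (mA n).
(* The majorant is [lc + h b / 2] in general, lowered to [lc - h] on [B] and raised by [M] on [A n].
   The loss [h b] on [B] exceeds [h b / 2] plus [M mu(A n) < h b / 4]. *)
have : lc <= \int[mu]_t ((lc + h * b / 2) - (h + h * b / 2) * \1_B t + M * \1_(A n) t).
  apply: le_trans (lc_le cE capE eqE en) _; apply: (fin_le muE).
  - exact: (bm_rpot muE cE en).
  - by apply: bmD; [apply: bmB; [exact: bm_cst|exact: bmZ]|exact: bmZ].
  move=> t Et; rewrite !indicE.
  have hM := ler_norm (D - lc).
  have tD : rpot (eps n) mu t <= D.
    rewrite -[D]cstE; apply: (fin_le muE); [exact: bm_phi|exact: bm_cst|].
    by move=> w Ew; apply: hD => //; exact: eps_le1.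
  have [|At] := boolP (t \in A n).
    by rewrite inE /M => _; case: (_ \in _); rewrite ?mulr1 ?mulr0; lra.
  have {}At : rpot (eps n) mu t < lc + h * b / 2.
    by rewrite ltNge; apply/negP => ht; move/negP: At; apply; rewrite inE.
  have [|Bt] := boolP (t \in B); rewrite ?mulr1 ?mulr0; last by lra.
  rewrite inE => /hB hBt; apply: le_trans (le_rpot muE t en (le_eps R n0n)) (le_trans hBt _).
  by rewrite addr0 opprD addrACA subrr addr0.
rewrite (finD muE); [|by apply: bmB; [exact: bm_cst|exact: bmZ]|exact: bmZ].
rewrite (finB muE); [|exact: bm_cst|exact: bmZ].
rewrite cstE !(finZ muE)// !(fin_indic mu)// -/b.
have : M * fine (mu (A n)) < h * b / 4.
  rewrite mulrC -ltr_pdivlMr//; apply: lt_le_trans hn _.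
  by rewrite le_eqVlt; apply/orP; left; apply/eqP; field; rewrite gt_eqF.
have hb0 : 0 < h * b by rewrite mulr_gt0.
have : 0 < h * b / 2 * b by rewrite mulr_gt0.
rewrite mulrDl; lra.
Qed.

(** The ball contributes at most [ln (2 r)] times its mass to [rpot r mu z], which is at least [lc]
    on the support. Hence small balls have mass of order [1 / ln (1 / r)], uniformly in their
    centre. *)
Lemma ball_mass_bound : exists2 D, 1 <= D &
  forall z r, S z -> 0 < r -> 2 * r <= 1 ->
    fine (mu [set t | cdist z t < r]) * (D - ln (2 * r)) <= D - lc.
Proof.
have [D D1 hD] := kernel_bound cE; exists D => // z r Sz r0 r1.
set B := [set t | _]; have mB : measurable B by exact: measurable_cball.
have bB := bm_indic E mB.
suff : rpot r mu z <= \int[mu]_t (D - (D - ln (2 * r)) * \1_B t).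
  rewrite (finB muE); [|exact: bm_cst|exact: bmZ].
  rewrite cstE (finZ muE)// (fin_indic mu)//; have := rpot_ge_msupp Sz r0.
  by rewrite [fine _ * _]mulrC; lra.
apply: (fin_le muE); [exact: bm_phi|by apply: bmB; [exact: bm_cst|exact: bmZ]|].
move=> t Et; rewrite indicE; have [|_] := boolP (t \in B).
  rewrite inE /B /= => zt; rewrite mulr1.
  have : phi r z t <= ln (2 * r) by apply: phi_le => //; lra.
  lra.
by rewrite mulr0 subr0; apply: hD => //; [lra|exact: (msupp_sub cE eqE)].
Qed.

Lemma closed_dist_gt0 (F : set C) z : closed F -> ~ F z ->
  exists2 d : R, 0 < d & forall t, F t -> d <= cdist z t.
Proof.
move=> cF nFz; have /nbhs_cdistP[r r0 hr] : nbhs z (~` F).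
  by apply: open_nbhs_nbhs; split=> //; apply: closed_openC.
exists r => // t Ft; rewrite leNgt; apply/negP => /hr; exact.
Qed.

(** Compare [z] with its nearest support point [z'], at scale [|z - z'|]. The smoothed distance from
    [z'] to a support point [t] is at most [3 |z - t|], and nearly [|z - t|] when [t] is far from
    [z']; the factor 3 only matters on a small ball, whose mass [ball_mass_bound] controls. *)
Lemma rpot0_near_msupp e : 0 < e -> exists2 d : R, 0 < d &
  forall z s, ~ S z -> S s -> cdist z s < d -> lc - e <= rpot 0 mu z.
Proof.
move=> e0; have [D D1 hD] := ball_mass_bound.
have l3 : 0 < ln 3 :> R by apply: ln_gt0; lra.
(* With [ln (2 r) = - L], the ball of radius [r] costs at most [e / 2] through the factor 3;
   [d <= e r / 8] keeps the far error [4 d / r] within the other [e / 2]. *)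
pose L := 2 * ln 3 * `|D - lc| / e.
have L0 : 0 <= L by apply: divr_ge0; last exact: ltW; apply: mulr_ge0 => //; apply: mulr_ge0 => //; exact: ltW.
pose r := expR (- L) / 2.
have r0 : 0 < r by rewrite divr_gt0 ?expR_gt0.
have r21 : 2 * r <= 1.
  rewrite /r mulrCA divff// mulr1 -[leRHS]expR0 ler_expR; lra.
have lr : ln (2 * r) = - L by rewrite /r mulrCA divff// mulr1 expRK.
pose d := Num.min (r / 2) (e * r / 8).
have d0 : 0 < d by rewrite lt_min; apply/andP; split; apply: divr_gt0 => //; exact: mulr_gt0.
have d1 : d <= r / 2 by rewrite ge_min lexx.
have d2 : d <= e * r / 8 by rewrite ge_min lexx orbT.
exists d => // z s nSz Ss zs.
have [z' Sz' hz'] : exists2 z', S z' & forall w, S w -> cdist z z' <= cdist z w.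
  have [||z' Sz' hz'] := @attains_max R S (fun w => - cdist z w) 1 cS.
  - by exists s.
  - move=> w w'; have := cdist_triangle w z w'; lra.
  by exists z' => // w /hz'; lra.
have dz : 0 < cdist z z'.
  rewrite lt_def cdist_ge0 andbT cdist_eq0; apply/eqP => zz.
  by rewrite zz in nSz.
have dzd : cdist z z' < d by apply: le_lt_trans (hz' _ Ss) zs.
have [dd dd0 hdd] := closed_dist_gt0 (compact_closedC cS) nSz.
have b0 : bm S (phi 0 z) by exact: bm_phi0 hdd.
set B := [set t | cdist z' t < r]; have mB : measurable B by exact: measurable_cball.
have bB := bm_indic S mB.
have key : rpot (cdist z z') mu z' <= \int[mu]_t (phi 0 z t + ln 3 * \1_B t + 4 * d / r).
  apply: (fin_le muS); first exact: bm_phi.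
    by apply: bmD; [apply: bmD => //; exact: bmZ|exact: bm_cst].
  move=> t St; have zt := hz' t St; have zt0 := lt_le_trans dz zt.
  have sm : smooth_dist (cdist z z') z' t <= cdist z t + 2 * cdist z z'.
    apply: le_trans (smooth_dist_le _ _ (cdist_ge0 _ _)) _.
    by have := cdist_triangle z z' t; rewrite (cdistC z' z); lra.
  have d4 : 0 <= 4 * d / r by apply: divr_ge0; [apply: mulr_ge0 => //|]; exact: ltW.
  rewrite indicE; have [|Bt] := boolP (t \in B) => /=.
    move=> _; rewrite mulr1 phi0.
    have : phi (cdist z z') z' t <= ln (cdist z t * 3).
      by apply: ln_le; [exact: smooth_dist_gt0|lra].
    by rewrite lnM ?posrE//; lra.
  have {}Bt : r <= cdist z' t.
    by rewrite leNgt; apply/negP => ht; move/negP: Bt; apply; rewrite inE.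
  rewrite mulr0 addr0 phi0.
  have zr : r / 2 <= cdist z t by have := cdist_triangle z z' t; rewrite (cdistC z' z); lra.
  have q : 2 * cdist z z' <= cdist z t * (4 * d / r).
    apply: (@le_trans _ _ (r / 2 * (4 * d / r))); last by rewrite ler_wpM2r.
    have -> : r / 2 * (4 * d / r) = 2 * d by field; rewrite gt_eqF.
    lra.
  have : phi (cdist z z') z' t <= ln (cdist z t * (1 + 4 * d / r)).
    apply: ln_le; first exact: smooth_dist_gt0.
    by rewrite mulrDr mulr1; lra.
  have p1 : 0 < 1 + 4 * d / r by lra.
  rewrite lnM ?posrE//; have := le_ln1Dx (lt_le_trans (ltrN10 _) d4); lra.
have := rpot_ge_msupp Sz' dz; move: key.
rewrite (finD muS); [|by apply: bmD => //; exact: bmZ|exact: bm_cst].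
rewrite (finD muS)//; last exact: bmZ.
rewrite cstE (finZ muS)// (fin_indic mu)// -/(rpot 0 mu z).
have hm := hD _ _ Sz' r0 r21; rewrite lr opprK -/B in hm.
have : ln 3 * fine (mu B) <= e / 2.
  have DL : 0 < D + L by lra.
  rewrite -(ler_pM2r DL) -mulrA.
  apply: (@le_trans _ _ (ln 3 * `|D - lc|)).
    by rewrite ler_pM2l// (le_trans hm)// ler_norm.
  have -> : ln 3 * `|D - lc| = e / 2 * L by rewrite /L; field; rewrite gt_eqF.
  by rewrite ler_pM2l ?divr_gt0//; lra.
have : 4 * d / r <= e / 2.
  rewrite ler_pdivrMr//; lra.
lra.
Qed.

End EquilibriumSupport.

Lemma sum4_affine (R : realType) (f g : R * R -> R) (a h c : R) z r :
  sum4 (fun w => a - f w + h * (g w - c)) z r =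
  4 * a - sum4 f z r + (h * sum4 g z r - 4 * h * c).
Proof.
rewrite /sum4; move: (f _) (f _) (f _) (f _) (g _) (g _) (g _) (g _).
by move=> *; ring.
Qed.

Lemma sum4_sub (R : realType) (f g : R * R -> R) (a b : R) z r :
  sum4 (fun w => f w - a + b - g w) z r = sum4 f z r - sum4 g z r + 4 * (b - a).
Proof.
rewrite /sum4; move: (f _) (f _) (f _) (f _) (g _) (g _) (g _) (g _).
by move=> *; ring.
Qed.

Section RpotBounds.
Variable R : realType.
Local Notation C := (R * R)%type.
Implicit Types (z t w : C) (e r : R).
Variables (nu : cmeasure R) (K : set C).
Hypotheses (nuK : fin_on nu K) (mass1 : mass nu = 1).
Let cK : compact K. Proof. by case: nuK. Qed.

Lemma rpot_le_bound e z x : 0 < e -> (forall t, K t -> phi e z t <= x) -> rpot e nu z <= x.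
Proof.
move=> e0 h; rewrite -[x]mulr1 -mass1 -(fin_cst nu).
by apply: (fin_le nuK); [exact: bm_phi|exact: bm_cst|].
Qed.

Lemma rpot0_ge_bound z d : 0 < d -> (forall t, K t -> d <= cdist z t) -> ln d <= rpot 0 nu z.
Proof.
move=> d0 h; rewrite -[ln d]mulr1 -mass1 -(fin_cst nu).
apply: (fin_le nuK); [exact: bm_cst|exact: bm_phi0 h|].
by move=> t Kt; rewrite phi0 ln_le// h.
Qed.

Lemma rpot0_le_rpot z e : 0 < e -> ~ K z -> rpot 0 nu z <= rpot e nu z.
Proof.
move=> e0 nKz; have [d d0 hd] := closed_dist_gt0 (compact_closedC cK) nKz.
apply: (fin_le nuK); [exact: bm_phi0 hd|exact: bm_phi|].
move=> t Kt; rewrite phi0; apply: ln_le; last exact: cdist_le_smooth.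
exact: lt_le_trans (hd t Kt).
Qed.

End RpotBounds.

(** * Frostman's theorem and the Bernstein-Walsh inequality *)

Section Frostman.
Variable R : realType.
Local Notation C := (R * R)%type.
Implicit Types (z t w : C) (e r : R).
Local Notation eps := (@eps R).
Variables (E : set C) (mu : cmeasure R).
Hypotheses (cE : compact E) (capE : (-oo < log_cap E)%E) (eqE : is_equilibrium E mu).
Local Notation lc := (lc E).
Local Notation S := (msupp mu).
Let muE : fin_on mu E. Proof. exact: eq_fin. Qed.
Let cS : compact S. Proof. exact: (msupp_compact cE eqE). Qed.
Let muS : fin_on mu S. Proof. exact: (msupp_fin cE eqE). Qed.
Let mass1 : mass mu = 1. Proof. exact: (eq_mass eqE). Qed.


(** [rpot 0 mu] is harmonic off the support and gives no strict gain; the term in [phi 1] supplies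
    one. Subtracting [c] makes that term nonpositive near the support, and [h <= 1 / 2] keeps its
    logarithmic growth below that of [rpot 0 mu]. *)
Lemma frostman_perturbed : exists c, forall h z, 0 < h -> h <= 1 / 2 -> ~ S z ->
  lc - rpot 0 mu z + h * (phi 1 z 0 - c) <= 0 :> R.
Proof.
have [b b0 hb] := compact_cdist_bounded 0 cS.
have c0 : 0 <= ln (b + 2) by apply: ln_ge0; lra.
exists (ln (b + 2)) => h z h0 h1; move: z.
have phi1_ge0 z : 0 <= phi 1 z 0 by rewrite -(@ln1 R); apply: phi_ge.
apply: discrete_max_principle => [b1|e e0|e e0|d b1 d0].
- have [d d0 hd] := rpot0_near_msupp cE capE eqE ltr01.
  exists (Num.max 1 (lc - ln d) + h * (ln (`|b1| + 1) - ln (b + 2))) => z nSz zb.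
  apply: lerD.
    rewrite le_max; have [[s [Ss zs]]|far] := pselect (exists s, S s /\ cdist z s < d).
      by apply/orP; left; have := hd z s nSz Ss zs; lra.
    apply/orP; right; rewrite lerD2l lerN2; apply: (rpot0_ge_bound muS mass1 d0) => t St.
    by rewrite leNgt; apply/negP => zt; apply: far; exists t.
  rewrite ler_pM2l// lerD2r; apply: phi_le => //.
  by rewrite lerD2r (le_trans zb)// ler_norm.
- have [d d0 hd] := rpot0_near_msupp cE capE eqE e0.
  exists (Num.min d 1); first by rewrite lt_min d0 ltr01.
  move=> z s nSz Ss; rewrite lt_min => /andP[zd z1].
  have := hd z s nSz Ss zd.
  have : h * (phi 1 z 0 - ln (b + 2)) <= 0.
    rewrite pmulr_rle0// subr_le0; apply: phi_le => //.
    by have := hb s Ss; have := cdist_triangle s z 0; rewrite (cdistC s 0); lra.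
  lra.
(* Beyond [2 b + 1] all distances to the support are at least [(|z| + 1) / 2]; beyond the second
   bound, half of [ln (|z| + 1)] exceeds [lc + ln 2]. *)
- exists (Num.max (2 * b + 1) (expR (2 * (lc + ln 2)))) => z nSz.
  rewrite ge_max => /andP[zb ze].
  have p0 : ln ((cdist z 0 + 1) / 2) <= rpot 0 mu z.
    apply: (rpot0_ge_bound muS mass1) => [|t St]; first by lra.
    by have := hb t St; have := cdist_triangle t z 0; rewrite (cdistC t 0); lra.
  have z0 : 0 < cdist z 0 + 1 by lra.
  rewrite ln_div ?posrE// in p0.
  have p1 : phi 1 z 0 <= ln (cdist z 0 + 1) by apply: phi_le.
  have p2 : h * phi 1 z 0 <= 1 / 2 * ln (cdist z 0 + 1).
    by apply: ler_pM => //; exact: ltW.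
  have p3 : 2 * (lc + ln 2) <= ln (cdist z 0 + 1).
    by rewrite -ler_expR lnK ?posrE//; lra.
  have p4 : 0 <= h * ln (b + 2) by rewrite mulr_ge0// ltW.
  rewrite mulrBr; lra.
- pose B0 := b1 ^+ 2 + 1; have B00 : 0 < B0 by rewrite ltr_wpDl ?sqr_ge0.
  have k0 : 0 < h / (3 * B0 ^+ 2) by rewrite divr_gt0// mulr_gt0// exprn_gt0.
  have [r [r0 r1 rd hr]] := gain_radius k0 ltr01 d0.
  exists r, (r ^+ 2 * (h / (3 * B0 ^+ 2)) - r ^+ 4 / d ^+ 4); split=> //.
    by rewrite subr_gt0.
  move=> z nSz zb hd.
  have g1 := sum4_rpot0_le muS r0 rd hd; rewrite mass1 mul1r in g1.
  have g2 : 4 * phi 1 z 0 + r ^+ 2 * 1 ^+ 2 / (3 * B0 ^+ 2) <= sum4 (phi 1 ^~ 0) z r.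
    apply: phi4_ge => //; rewrite expr1n lerD2r lerXn2r ?nnegrE ?cdist_ge0//.
    exact: le_trans (cdist_ge0 _ _) zb.
  rewrite expr1n mulr1 -(ler_pM2l h0) mulrDr in g2.
  have -> : r ^+ 2 * (h / (3 * B0 ^+ 2)) = h * (r ^+ 2 / (3 * B0 ^+ 2)) by ring.
  rewrite sum4_affine; move: g1 g2.
  move: (sum4 _ _ _) (h * sum4 _ _ _) (rpot _ _ _) (phi _ _ _) (r ^+ 4 / _) (h * (r ^+ 2 / _)).
  by move=> s1 s2 p q k1 k2; lra.
Qed.

Lemma frostman0 z : ~ S z -> lc <= rpot 0 mu z.
Proof.
move=> nSz; have [c hc] := frostman_perturbed.
apply/ler_addgt0Pr => e e0.
pose k := `|phi 1 z 0 - c| + 1.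
have k0 : 0 < k by rewrite ltr_wpDl.
pose h := Num.min (1 / 2) (e / k).
have h0 : 0 < h by rewrite lt_min !divr_gt0.
have h1 : h <= 1 / 2 by rewrite ge_min lexx.
have h2 : h <= e / k by rewrite ge_min lexx orbT.
have := hc h z h0 h1 nSz.
have : - (h * (phi 1 z 0 - c)) <= e.
  rewrite -mulrN; apply: (@le_trans _ _ (h * k)); last by rewrite -ler_pdivlMr.
  rewrite ler_pM2l// /k; have := ler_norm (- (phi 1 z 0 - c)); rewrite normrN; lra.
lra.
Qed.

Theorem frostman z e : 0 < e -> lc <= rpot e mu z.
Proof.
move=> e0; have [Sz|nSz] := pselect (S z); first exact: (rpot_ge_msupp cE capE eqE).
by apply: le_trans (frostman0 nSz) _; exact: (rpot0_le_rpot muS).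
Qed.

Lemma frostman_potential z : (lc%:E <= potential mu z)%E.
Proof. by apply: (le_potential muE) => n; apply: frostman; exact: eps_gt0. Qed.

Lemma rpot_mean_ge (nu : cmeasure R) K e : fin_on nu K -> mass nu = 1 -> 0 < e ->
  lc <= \int[mu]_z rpot e nu z.
Proof.
move=> nuK nu1 e0; have cK : compact K by case: nuK.
rewrite (rpot_fubini e0 muE nuK) -[lc]mulr1 -nu1 -(fin_cst nu).
apply: (fin_le nuK); [exact: bm_cst|exact: (bm_rpot muE)|].
by move=> t _; exact: frostman.
Qed.

(* [potential mu w - lc] plays the role of the Green function of the complement of [E]. *)
Theorem bernstein_walsh (nu : cmeasure R) K e M w : fin_on nu K -> mass nu = 1 -> 0 < e ->
  (forall z, E z -> rpot e nu z <= M) -> ((rpot e nu w - M + lc)%:E <= potential mu w)%E.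
Proof.
move=> nuK nu1 e0 hM; have cK : compact K by case: nuK.
apply: (le_potential muE) => n; have en := eps_gt0 R n.
have [Ew|nEw] := pselect (E w).
  by have := hM w Ew; have := frostman w en; lra.
have lcM : lc <= M.
  apply: le_trans (rpot_mean_ge nuK nu1 e0) _.
  rewrite -[M](eq_cst eqE); apply: (fin_le muE); [exact: (bm_rpot nuK)|exact: bm_cst|exact: hM].
have lip z z' : rpot e nu z <= rpot e nu z' + cdist z z' / e.
  by have := rpot_lip nuK z z' e0; rewrite nu1 mul1r mulrC.
have p0ge z : ~ E z -> lc <= rpot 0 mu z.
  by move=> nEz; apply: frostman0 => /(msupp_sub cE eqE).
apply: le_trans (rpot0_le_rpot muE en nEw).
suff : rpot e nu w - M + lc - rpot 0 mu w <= 0 by lra.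
move: w nEw.
have [bE bE0 hbE] := compact_cdist_bounded 0 cE.
have [bK bK0 hbK] := compact_cdist_bounded 0 cK.
(* Near [E] the Lipschitz bound gives [rpot e nu <= M] up to a small error, while [rpot 0 mu >= lc].
   At infinity both potentials grow like [ln |z|] and [lc <= M]. The strict gain comes from the
   regularised potential of [nu]. *)
apply: discrete_max_principle => [b1|d d0|d d0|d b1 d0].
- exists (rpot e nu 0 + b1 / e - M) => z nEz zb.
  have := p0ge z nEz; have := lip z 0.
  have : cdist z 0 / e <= b1 / e by rewrite ler_pM2r ?invr_gt0.
  move: (rpot 0 mu z) (rpot e nu z) (rpot e nu 0) (cdist z 0 / e) (b1 / e).
  by move=> p q q' k k'; lra.
- exists (d * e); first by rewrite mulr_gt0.
  move=> z s nEz Es zs; have := p0ge z nEz; have := lip z s; have := hM s Es.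
  have : cdist z s / e <= d by rewrite ler_pdivrMr// ltW.
  move: (rpot 0 mu z) (rpot e nu z) (rpot e nu s) (cdist z s / e).
  by move=> p q q' k; lra.
- pose k := bK + bE + e; have k0 : 0 < k by rewrite /k; lra.
  exists (bE + k / d) => z nEz zb.
  have kd : 0 < k / d by rewrite divr_gt0.
  have z0 : 0 < cdist z 0 - bE by lra.
  have q1 : rpot e nu z <= ln (cdist z 0 + bK + e).
    apply: (rpot_le_bound nuK nu1) => // t Kt; apply: phi_le => //.
    by have := hbK t Kt; have := cdist_triangle 0 z t; lra.
  have q2 : ln (cdist z 0 - bE) <= rpot 0 mu z.
    apply: (rpot0_ge_bound muE mass1) => // t Et.
    by have := hbE t Et; have := cdist_triangle t z 0; rewrite (cdistC t 0); lra.
  have -> : rpot e nu z - M + lc - rpot 0 mu z = (rpot e nu z - rpot 0 mu z) + (lc - M) by ring.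
  have -> : d = d + 0 by rewrite addr0.
  apply: lerD; last by lra.
  apply: (@le_trans _ _ (ln ((cdist z 0 - bE) * (1 + k / (cdist z 0 - bE))) - ln (cdist z 0 - bE))).
    apply: lerB => //; apply: le_trans q1 _.
    rewrite mulrDr mulr1 mulrCA divff ?gt_eqF// mulr1 /k.
    by apply: ln_le; lra.
  have kz : 0 < k / (cdist z 0 - bE) by rewrite divr_gt0.
  rewrite lnM ?posrE//; last by lra.
  have := le_ln1Dx (lt_le_trans (ltrN10 _) (ltW kz)).
  have : k / (cdist z 0 - bE) <= d.
    by rewrite ler_pdivrMr// mulrC -ler_pdivrMr//; lra.
  lra.
- pose B0 := (`|b1| + bK) ^+ 2 + e ^+ 2; have B00 : 0 < B0 by rewrite ltr_wpDl ?sqr_ge0 ?exprn_gt0.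
  have k0 : 0 < e ^+ 2 / (3 * B0 ^+ 2) by rewrite divr_gt0 ?mulr_gt0 ?exprn_gt0.
  have [r [r0 re rd hr]] := gain_radius k0 e0 d0.
  exists r, (r ^+ 2 * (e ^+ 2 / (3 * B0 ^+ 2)) - r ^+ 4 / d ^+ 4); split=> //.
    by rewrite subr_gt0.
  move=> z nEz zb hd.
  have g1 := sum4_rpot0_le muE r0 rd hd; rewrite mass1 mul1r in g1.
  have g2 : 4 * rpot e nu z + mass nu * (r ^+ 2 * e ^+ 2 / (3 * B0 ^+ 2)) <= sum4 (rpot e nu) z r.
    apply: (sum4_rpot_ge nuK) => // t Kt.
    rewrite lerD2r lerXn2r ?nnegrE ?cdist_ge0 ?addr_ge0// ?(ltW bK0)//.
    have := hbK t Kt; have := cdist_triangle 0 z t; have := ler_norm b1; lra.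
  rewrite nu1 mul1r in g2.
  have -> : r ^+ 2 * (e ^+ 2 / (3 * B0 ^+ 2)) = r ^+ 2 * e ^+ 2 / (3 * B0 ^+ 2) by ring.
  rewrite sum4_sub; move: g1 g2.
  move: (sum4 _ _ _) (sum4 _ _ _) (rpot _ _ _) (rpot _ _ _) (r ^+ 4 / _) (r ^+ 2 * e ^+ 2 / _).
  by move=> s1 s2 p q k1 k2; lra.
Qed.

End Frostman.

(** * Complex polynomials and the choice of a weight *)

Section MaxModulus.
Variable R : realType.
Local Notation C := (R * R)%type.
Local Notation normc := (@ComplexField.Normc.normc R).
Implicit Types (z t w : C) (e r : R).

Definition toC (z : C) : R[i] := (z.1 +i* z.2)%C.
Definition ofC (x : R[i]) : C := (complex.Re x, complex.Im x).

Lemma normc_ge0 (x : R[i]) : 0 <= normc x.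
Proof. by case: x => a b; exact: sqrtr_ge0. Qed.

Lemma normc_real (x : R) : normc (x%:C)%C = `|x|.
Proof. by rewrite /= expr0n addr0 sqrtr_sqr. Qed.

Lemma normc_sub z (x : R[i]) : normc (toC z - x) = cdist z (ofC x).
Proof. by case: x => a b. Qed.

Lemma normcX (x : R[i]) n : normc (x ^+ n) = normc x ^+ n.
Proof.
elim: n => [|n IH]; first by rewrite !expr0 ComplexField.Normc.normc1.
by rewrite !exprS ComplexField.Normc.normcM IH.
Qed.

Lemma normc_prod (s : seq R[i]) (F : R[i] -> R[i]) :
  normc (\prod_(r <- s) F r) = \prod_(r <- s) normc (F r).
Proof.
elim: s => [|x s IH]; first by rewrite !big_nil ComplexField.Normc.normc1.
by rewrite !big_cons ComplexField.Normc.normcM IH.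
Qed.

Definition polymod (P : {poly R[i]}) t : R := normc P.[toC t].

Lemma polymod_ge0 P t : 0 <= polymod P t. Proof. exact: normc_ge0. Qed.

(** The factorisation makes [ln |P|] a constant plus a sum of kernels at the roots, so that its
    integrals become values of potentials. *)
Lemma polymod_factor (P : {poly R[i]}) : exists rs : seq C,
  P != 0 -> size rs = (size P).-1 /\
  forall t, polymod P t = normc (lead_coef P) * \prod_(r <- rs) cdist t r.
Proof.
have [rs hrs] := closed_field_poly_normal P.
exists (map ofC rs) => P0; split.
  by rewrite size_map {1}hrs size_scale ?lead_coef_eq0// size_prod_XsubC.
move=> t; rewrite /polymod {1}hrs hornerZ ComplexField.Normc.normcM; congr (_ * _).
rewrite horner_prod normc_prod big_map; apply: eq_bigr => r _.
by rewrite hornerXsubC normc_sub.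
Qed.

Lemma measurable_polymod P : measurable_fun setT (polymod P).
Proof.
have [->|P0] := eqVneq P 0.
  rewrite (_ : polymod 0 = cst 0)//; apply/funext => t.
  by rewrite /polymod horner0 ComplexField.Normc.normc0.
have [rs hrs] := polymod_factor P; have [_ h] := hrs P0.
rewrite (_ : polymod P = fun t => normc (lead_coef P) * \prod_(r <- rs) cdist t r); last exact/funext.
apply: measurable_funM => //; elim: rs {hrs h} => [|r rs IH].
  by rewrite (_ : (fun t => _) = cst 1)//; apply/funext => t; rewrite big_nil.
rewrite (_ : (fun t => _) = fun t => cdist t r * \prod_(r <- rs) cdist t r).
  by apply: measurable_funM => //; exact: measurable_cdist.
by apply/funext => t; rewrite big_cons.
Qed.

(* At most one of the weights [w = j / N] makes [|a + w b|] smaller than [|b| / (2 N)]. *)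
Lemma selection_pointwise N (a b : R[i]) (H h G : R) : (0 < N)%N -> 0 < h -> h <= H ->
  normc a <= G -> normc b <= G -> H <= G ->
  N%:R * ln (Num.max (normc a) (Num.max (normc b) H))
    - N%:R * ln (2 * N%:R + 1) - (ln G - ln h) <=
  \sum_(j < N) ln (Num.max (normc (a + ((j.+1%:R / N%:R)%:C)%C * b)) H).
Proof.
move=> N0 h0 hH aG bG HG; have H0 := lt_le_trans h0 hH.
have N0' : 0 < N%:R :> R by rewrite ltr0n.
set X := Num.max (normc a) _.
have X0 : 0 < X by rewrite !lt_max H0 !orbT.
have XG : X <= G by rewrite !ge_max aG bG HG.
have hG := le_trans hH HG.
pose y (j : 'I_N) := normc (a + ((j.+1%:R / N%:R)%:C)%C * b).
pose bad (j : 'I_N) := y j < normc b / (2 * N%:R).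
have good j : ~~ bad j -> ln X - ln (2 * N%:R + 1) <= ln (Num.max (y j) H).
  rewrite -leNgt => gj.
  have k0 : 0 < 2 * N%:R + 1 :> R by lra.
  rewrite -ln_div ?posrE//; apply: ln_le; first exact: divr_gt0.
  rewrite ler_pdivrMr//; set m := Num.max _ _.
  have ym : y j <= m by rewrite le_max lexx.
  have Hm : H <= m by rewrite le_max lexx orbT.
  have m0 : 0 <= m by apply: le_trans Hm; exact: ltW.
  have bm : normc b <= m * (2 * N%:R).
    by rewrite -ler_pdivrMr ?mulr_gt0//; exact: le_trans ym.
  have w1 : `|j.+1%:R / N%:R| <= 1 :> R.
    by rewrite ger0_norm ?divr_ge0// ler_pdivrMr// mul1r ler_nat.
  have am : normc a <= m + normc b.
    have -> : a = (a + ((j.+1%:R / N%:R)%:C)%C * b) + - (((j.+1%:R / N%:R)%:C)%C * b) by rewrite addrK.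
    apply: le_trans (le_normcD _ _) _; rewrite normcN ComplexField.Normc.normcM normc_real.
    apply: lerD; first exact: ym.
    by rewrite ler_piMl// normc_ge0.
  have mN : 0 <= m * (2 * N%:R) by rewrite mulr_ge0// mulr_ge0.
  rewrite mulrDr mulr1 !ge_max; apply/andP; split; first by lra.
  by apply/andP; split; lra.
(* Distinct weights differ by at least [1 / N], so two bad ones would give
   [|b| / N <= y i + y j < |b| / N]. *)
have badU i j : bad i -> bad j -> i = j.
  move=> bi bj; apply/eqP; apply/negPn/negP => ij.
  have b0 : 0 < normc b.
    rewrite lt_def normc_ge0 andbT; apply/eqP => b0; move: bi.
    by rewrite /bad b0 mul0r ltNge normc_ge0.
  have : normc ((((i.+1%:R - j.+1%:R) / N%:R)%:C)%C * b) <= y i + y j.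
    have -> : ((((i.+1%:R - j.+1%:R) / N%:R)%:C)%C * b) =
      (a + ((i.+1%:R / N%:R)%:C)%C * b) + - (a + ((j.+1%:R / N%:R)%:C)%C * b).
      by rewrite mulrBl rmorphB /= mulrBl; ring.
    by apply: le_trans (le_normcD _ _) _; rewrite normcN.
  rewrite ComplexField.Normc.normcM normc_real normrM [`|N%:R^-1|]ger0_norm ?invr_ge0//.
  have d1 : 1 <= `|i.+1%:R - j.+1%:R| :> R.
    have dist (p q : nat) : (p < q)%N -> 1 <= `|p.+1%:R - q.+1%:R| :> R.
      move=> pq; rewrite distrC -natrB ?ltnS 1?ltnW// subSS ger0_norm// ler1n subn_gt0//.
    have := ij; rewrite -val_eqE neq_ltn => /orP[/dist//|/dist].
    by rewrite distrC.
  have : normc b / N%:R <= `|i.+1%:R - j.+1%:R| / N%:R * normc b.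
    by rewrite mulrAC ler_pM2r ?invr_gt0// ler_peMl// normc_ge0.
  move: bi bj; rewrite /bad (_ : normc b / (2 * N%:R) = normc b / N%:R / 2); last by field; rewrite gt_eqF.
  lra.
have term j : ln X - ln (2 * N%:R + 1) - (bad j)%:R * (ln G - ln h) <= ln (Num.max (y j) H).
  have [bj|gj] := boolP (bad j); last by rewrite mul0r subr0 good.
  rewrite mul1r; have l1 : 0 <= ln (2 * N%:R + 1) :> R by apply: ln_ge0; lra.
  have := ln_le X0 XG.
  have : ln h <= ln (Num.max (y j) H) by apply: ln_le => //; rewrite le_max hH orbT.
  lra.
apply: le_trans (ler_sum _ (fun j _ => term j)).
rewrite big_split /= sumrN -mulr_suml sumr_const card_ord.
have b1 : \sum_(j < N) (bad j)%:R <= 1 :> R.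
  have [j bj|none] := pickP bad.
    rewrite (bigD1 j)//= bj big1 ?addr0// => i ij.
    by case: (boolP (bad i)) => // bi; rewrite (badU _ _ bi bj) eqxx in ij.
  by rewrite big1// => j _; rewrite none.
have gh : 0 <= ln G - ln h by rewrite subr_ge0; exact: ln_le.
have := ler_wpM2r gh b1; rewrite mul1r -[(_ - _) *+ N]mulr_natl mulrBr; lra.
Qed.

End MaxModulus.

(** * Replacing a maximum of moduli by the modulus of one polynomial *)

Section Selection.
Variable R : realType.
Local Notation C := (R * R)%type.
Local Notation normc := (@ComplexField.Normc.normc R).
Implicit Types (z t w : C) (e r : R).
Variables (nu : cmeasure R) (K : set C).
Hypotheses (nuK : fin_on nu K) (mass1 : mass nu = 1).

Let cst1 c : \int[nu]_t c = c. Proof. by rewrite fin_cst mass1 mulr1. Qed.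

(** For [h > 0] the floor bounds the logarithm from below even at common zeros. *)
Definition maxmod (h : R) (fs : seq {poly R[i]}) t : R := \big[Num.max/h]_(f <- fs) polymod f t.

Lemma maxmod_ge h fs t : h <= maxmod h fs t.
Proof.
rewrite /maxmod; elim: fs => [|f fs IH]; first by rewrite big_nil.
by rewrite big_cons le_max IH orbT.
Qed.

Lemma maxmod_le h fs t G : h <= G -> (forall f, f \in fs -> polymod f t <= G) -> maxmod h fs t <= G.
Proof.
move=> hG; rewrite /maxmod; elim: fs => [|f fs IH] H; first by rewrite big_nil.
rewrite big_cons ge_max H ?mem_head//= IH// => g gs.
by apply: H; rewrite inE gs orbT.
Qed.

Lemma measurable_maxmod h fs : measurable_fun setT (maxmod h fs).
Proof.
rewrite /maxmod; elim: fs => [|f fs IH].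
  by rewrite (_ : (fun t => _) = cst h)//; apply/funext => t; rewrite big_nil.
rewrite (_ : (fun t => _) = fun t => Num.max (polymod f t) (\big[Num.max/h]_(f <- fs) polymod f t)).
  by apply: measurable_maxr => //; exact: measurable_polymod.
by apply/funext => t; rewrite big_cons.
Qed.

Lemma polymod_addZ f g (w : R) t : 0 <= w -> w <= 1 ->
  polymod (f + (w%:C)%C *: g) t <= polymod f t + polymod g t.
Proof.
move=> w0 w1; rewrite /polymod hornerD hornerZ.
apply: le_trans (le_normcD _ _) _; rewrite lerD2l ComplexField.Normc.normcM normc_real.
by rewrite ger0_norm// ler_piMl// normc_ge0.
Qed.

Variables (N : nat) (h G : R).
Hypotheses (N0 : (0 < N)%N) (h0 : 0 < h) (hG : h <= G).

Lemma bm_ln_maxmod fs : (forall t, K t -> forall f, f \in fs -> polymod f t <= G) ->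
  bm K (fun t => ln (maxmod h fs t)).
Proof.
move=> H; apply: (@bm_le _ _ _ (ln h) (ln G)).
  exact: (measurableT_comp (@measurable_ln R) (measurable_maxmod h fs)).
move=> t Kt; apply/andP; split; apply: ln_le => //; first exact: maxmod_ge.
  exact: lt_le_trans h0 (maxmod_ge _ _ _).
by apply: maxmod_le => //; exact: H.
Qed.

(** The price of one merging: [ln (2 N + 1)] for a good weight, and [ln G - ln h] for the single
    possible bad one, averaged over the [N] weights. *)
Local Notation loss := (ln (2 * N%:R + 1) + (ln G - ln h) / N%:R).

(** Which weight is bad depends on [t]. Integrating [selection_pointwise] bounds the average over
    all weights, and some weight does at least as well as the average. *)
Lemma selection_step f g fs :
  (forall t, K t -> polymod f t + polymod g t + \sum_(f <- fs) polymod f t <= G) ->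
  exists w : R, [/\ 0 <= w, w <= 1 &
   \int[nu]_t ln (maxmod h [:: f, g & fs] t) - loss <=
   \int[nu]_t ln (maxmod h (f + (w%:C)%C *: g :: fs) t)].
Proof.
move=> HG; have N0' : 0 < N%:R :> R by rewrite ltr0n.
pose w (j : 'I_N) : R := j.+1%:R / N%:R.
have w0 j : 0 <= w j by rewrite divr_ge0.
have w1 j : w j <= 1 by rewrite ler_pdivrMr// mul1r ler_nat.
have sumge t u : u \in fs -> polymod u t <= \sum_(f <- fs) polymod f t.
  move=> us; rewrite (big_rem u)//= lerDl sumr_ge0// => *; exact: polymod_ge0.
have fsG t : K t -> forall u, u \in fs -> polymod u t <= G.
  move=> Kt u us; apply: le_trans (sumge t u us) (le_trans _ (HG t Kt)).
  by rewrite lerDr addr_ge0// polymod_ge0.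
have sum0 t : 0 <= \sum_(f <- fs) polymod f t by rewrite sumr_ge0// => *; exact: polymod_ge0.
have fG t : K t -> polymod f t <= G.
  by move=> Kt; have := HG t Kt; have := polymod_ge0 g t; have := sum0 t; lra.
have gG t : K t -> polymod g t <= G.
  by move=> Kt; have := HG t Kt; have := polymod_ge0 f t; have := sum0 t; lra.
have b0 : bm K (fun t => ln (maxmod h [:: f, g & fs] t)).
  apply: bm_ln_maxmod => t Kt u; rewrite !inE => /or3P[/eqP->|/eqP->|]; [exact: fG|exact: gG|exact: fsG].
have bj j : bm K (fun t => ln (maxmod h (f + ((w j)%:C)%C *: g :: fs) t)).
  apply: bm_ln_maxmod => t Kt u; rewrite !inE => /orP[/eqP->|]; last exact: fsG.
  apply: le_trans (polymod_addZ _ _ _ (w0 j) (w1 j)) _.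
  by have := HG t Kt; have := sum0 t; lra.
have key : N%:R * (\int[nu]_t ln (maxmod h [:: f, g & fs] t) - loss) <=
    \sum_(j < N) \int[nu]_t ln (maxmod h (f + ((w j)%:C)%C *: g :: fs) t).
  rewrite -(fin_sum nuK)// -[loss]cst1 -(finB nuK)//; last exact: bm_cst.
  rewrite -(finZ nuK); last by apply: bmB => //; exact: bm_cst.
  apply: (fin_le nuK).
  - by apply: bmZ; apply: bmB => //; exact: bm_cst.
  - exact: bm_sum.
  move=> t Kt.
  have := @selection_pointwise R N f.[toC t] g.[toC t] (maxmod h fs t) h G N0 h0
    (maxmod_ge _ _ _) (fG t Kt) (gG t Kt) (maxmod_le hG (fsG t Kt)).
  rewrite (eq_bigr (fun j => ln (maxmod h (f + ((w j)%:C)%C *: g :: fs) t))); last first.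
    by move=> j _; rewrite /maxmod big_cons /polymod hornerD hornerZ.
  have -> : Num.max (normc f.[toC t]) (Num.max (normc g.[toC t]) (maxmod h fs t)) =
      maxmod h [:: f, g & fs] t by rewrite /maxmod !big_cons.
  have -> : N%:R * (ln (maxmod h [:: f, g & fs] t) - loss) = N%:R * ln (maxmod h [:: f, g & fs] t)
      - N%:R * ln (2 * N%:R + 1) - (ln G - ln h) by field; rewrite gt_eqF.
  by [].
apply: contrapT => H.
have lt j : \int[nu]_t ln (maxmod h (f + ((w j)%:C)%C *: g :: fs) t) <
    \int[nu]_t ln (maxmod h [:: f, g & fs] t) - loss.
  by rewrite ltNge; apply/negP => hj; apply: H; exists (w j).
move: key; apply/negP; rewrite -ltNge.
rewrite mulr_natl -[X in _ < _ *+ X]card_ord -sumr_const.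
by apply: ltr_sum => //; apply/hasP; exists (Ordinal N0) => //; exact: mem_index_enum.
Qed.

(** The bound is put on the sum of the moduli because a sum, unlike a maximum, does not grow when
    two polynomials are merged. *)
Lemma selection fs : forall f,
  (forall t, K t -> polymod f t + \sum_(g <- fs) polymod g t <= G) ->
  exists ws : seq R, [/\ size ws = size fs, all (fun x : R => 0 <= x <= 1) ws &
   \int[nu]_t ln (maxmod h (f :: fs) t) - (size fs)%:R * loss <=
   \int[nu]_t ln (maxmod h [:: f + \sum_(p <- zip ws fs) (p.1%:C)%C *: p.2] t)].
Proof.
elim: fs => [|g fs IH] f HG.
  by exists [::]; split=> //=; rewrite mul0r subr0 big_nil addr0.
have [|w [w0 w1 hw]] := @selection_step f g fs.
  by move=> t Kt; have := HG t Kt; rewrite big_cons addrA.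
have [|ws [sz alls hws]] := IH (f + (w%:C)%C *: g).
  move=> t Kt; have := HG t Kt; rewrite big_cons => Ht.
  apply: le_trans Ht; rewrite addrA lerD2r; exact: polymod_addZ.
exists (w :: ws); split; first by rewrite /= sz.
  by rewrite /= w0 w1.
rewrite /= big_cons /= addrA; apply: le_trans hws.
by rewrite -natr1 mulrDl mul1r; lra.
Qed.

End Selection.

Section Elog.
Variable R : realType.

Lemma elogM (x y : R) : 0 <= x -> 0 <= y -> elog (x * y) = (elog x + elog y)%E.
Proof.
move=> x0 y0; rewrite /elog mulf_eq0.
have [//|xn] := eqVneq x 0; have [|yn] := eqVneq y 0 => /=; first by rewrite addeNy.
by rewrite lnM ?posrE ?lt_def ?xn ?yn.
Qed.

Lemma le_elog_mono (x y : R) : 0 <= x -> x <= y -> (elog x <= elog y)%E.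
Proof.
move=> x0 xy; rewrite /elog; have [_|xn] := eqVneq x 0; first by rewrite leNye.
have x1 : 0 < x by rewrite lt_def xn.
by rewrite gt_eqF ?(lt_le_trans x1)// lee_fin ln_le.
Qed.

Lemma elog_gt0 (x : R) : 0 < x -> elog x = (ln x)%:E.
Proof. by move=> x0; rewrite /elog gt_eqF. Qed.

Lemma elogX (x : R) n : 0 <= x -> elog (x ^+ n.+1) = (n.+1%:R%:E * elog x)%E.
Proof.
move=> x0; rewrite /elog expf_eq0 /=; have [_|xn] := eqVneq x 0.
  by rewrite gt0_muleNy// lte_fin ltr0n.
by rewrite lnXn ?lt_def ?xn// -EFinM mulr_natl.
Qed.

Lemma elog_prod I (s : seq I) (F : I -> R) : (forall i, 0 <= F i) ->
  elog (\prod_(i <- s) F i) = (\sum_(i <- s) elog (F i))%E.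
Proof.
move=> F0; elim: s => [|i s IH]; first by rewrite !big_nil elog_gt0// ln1.
by rewrite !big_cons elogM// ?IH// prodr_ge0.
Qed.

Lemma ln_prod I (s : seq I) (F : I -> R) : (forall i, 0 < F i) ->
  ln (\prod_(i <- s) F i) = \sum_(i <- s) ln (F i).
Proof.
move=> F0; elim: s => [|i s IH]; first by rewrite !big_nil ln1.
by rewrite !big_cons lnM ?posrE ?IH// prodr_gt0.
Qed.

Lemma le_prod I (s : seq I) (F G : I -> R) : (forall i, 0 <= F i <= G i) ->
  \prod_(i <- s) F i <= \prod_(i <- s) G i.
Proof. by move=> FG; apply: ler_prod => i _; exact: FG. Qed.

Lemma le_exp (x y : R) n : 0 <= x -> x <= y -> x ^+ n <= y ^+ n.
Proof. by move=> x0 xy; rewrite lerXn2r// nnegrE// (le_trans x0). Qed.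

Lemma exp_le_prod I (s : seq I) (F : I -> R) e : 0 <= e -> (forall i, e <= F i) ->
  e ^+ size s <= \prod_(i <- s) F i.
Proof.
move=> e0 eF; elim: s => [|i s IH]; first by rewrite big_nil.
by rewrite big_cons /= exprS ler_pM// exprn_ge0.
Qed.

End Elog.

(** * The maximum of distances and powers of linear factors *)

Section MaxDist.
Variable R : realType.
Local Notation C := (R * R)%type.
Local Notation normc := (@ComplexField.Normc.normc R).
Implicit Types (z t w : C) (e r : R).

Definition max_dist e (cs : seq C) t : R := \big[Num.max/e]_(c <- cs) cdist t c.

Lemma max_dist_ge e cs t : e <= max_dist e cs t.
Proof.
rewrite /max_dist; elim: cs => [|f fs IH]; first by rewrite big_nil.
by rewrite big_cons le_max IH orbT.
Qed.

Lemma max_dist_ub e cs t c : c \in cs -> cdist t c <= max_dist e cs t.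
Proof.
rewrite /max_dist; elim: cs => // f fs IH; rewrite inE big_cons le_max.
by move=> /orP[/eqP->|/IH ->]; rewrite ?lexx ?orbT.
Qed.

Lemma max_dist_le e cs t b : e <= b -> (forall c, c \in cs -> cdist t c <= b) ->
  max_dist e cs t <= b.
Proof.
move=> eb; rewrite /max_dist; elim: cs => [|f fs IH] h; first by rewrite big_nil.
rewrite big_cons ge_max h ?mem_head//= IH// => c cfs.
by apply: h; rewrite inE cfs orbT.
Qed.

Lemma max_dist_ge0 e cs t : 0 <= e -> 0 <= max_dist e cs t.
Proof. by move=> e0; exact: le_trans e0 (max_dist_ge _ _ _). Qed.

Lemma measurable_max_dist e cs : measurable_fun setT (max_dist e cs).
Proof.
rewrite /max_dist; elim: cs => [|f fs IH].
  by rewrite (_ : (fun t => _) = cst e)//; apply/funext => t; rewrite big_nil.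
rewrite (_ : (fun t => _) = fun t => Num.max (cdist t f) (\big[Num.max/e]_(c <- fs) cdist t c)).
  by apply: measurable_maxr => //; exact: measurable_cdist.
by apply/funext => t; rewrite big_cons.
Qed.

Definition pow_poly n (c : C) : {poly R[i]} := ('X - (toC c)%:P) ^+ n.

Lemma polymod_pow n c t : polymod (pow_poly n c) t = cdist t c ^+ n.
Proof.
rewrite /polymod /pow_poly horner_exp hornerXsubC normcX normc_sub.
by case: c.
Qed.

Lemma maxmod_pow n e cs t : 0 <= e ->
  maxmod (e ^+ n) (map (pow_poly n) cs) t = max_dist e cs t ^+ n.
Proof.
move=> e0; rewrite /maxmod /max_dist; elim: cs => [|c cs IH]; first by rewrite !big_nil.
rewrite /= !big_cons IH polymod_pow.
set a := cdist t c; set b := \big[_/_]_(_ <- _) _.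
have a0 : 0 <= a by exact: cdist_ge0.
have b0 : 0 <= b by exact: (@max_dist_ge0 e cs t).
by case: (leP a b) => [ab|/ltW ab]; [apply/max_idPr|apply/max_idPl]; rewrite lerXn2r.
Qed.

Lemma coef_pow_poly n c : (pow_poly n c)`_n = 1.
Proof.
have := monicP (monic_exp n (monicXsubC (toC c))).
by rewrite lead_coefE size_exp_XsubC.
Qed.

Lemma size_pow_poly n c : size (pow_poly n c) = n.+1.
Proof. by rewrite /pow_poly size_exp_XsubC. Qed.

(** The weights are nonnegative reals and the powers are monic, so the leading coefficients add up
    without cancellation. The degree stays exactly [n], which fixes the number of roots. *)
Lemma comb_poly n c0 (cs : seq C) (ws : seq R) : all (fun x : R => 0 <= x <= 1) ws ->
  let P := pow_poly n c0 + \sum_(p <- zip ws (map (pow_poly n) cs)) (p.1%:C)%C *: p.2 in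
  [/\ size P = n.+1, 1 <= normc (lead_coef P) &
      forall t, polymod P t <= (size cs).+1%:R * max_dist 0 (c0 :: cs) t ^+ n].
Proof.
move=> hws P.
pose Q (us : seq R) (ds : seq C) : {poly R[i]} :=
  \sum_(p <- zip us (map (pow_poly n) ds)) (p.1%:C)%C *: p.2.
have [s [s0 cP sz]] : exists s : R, [/\ 0 <= s, (Q ws cs)`_n = (s%:C)%C &
    (size (Q ws cs) <= n.+1)%N].
  rewrite /Q; elim: ws cs hws {P} => [|w ws IH] [|c cs] /=;
    try by move=> _; exists 0; rewrite big_nil coef0 size_poly0.
  move=> /andP[/andP[w0 _] /(IH cs)[s [s0 cP sz]]]; rewrite big_cons /=.
  exists (w + s); split; first exact: addr_ge0.
    by rewrite coefD coefZ coef_pow_poly mulr1 cP rmorphD.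
  rewrite (leq_trans (size_polyD _ _))// geq_max sz andbT.
  by rewrite (leq_trans (size_scale_leq _ _))// size_pow_poly.
have Pn : P`_n = ((1 + s)%:C)%C by rewrite /P coefD coef_pow_poly cP rmorphD.
have Pn0 : P`_n != 0.
  apply/eqP => h; have := congr1 (@complex.Re R) h; rewrite Pn /=; lra.
have szP : size P = n.+1.
  apply/eqP; rewrite eqn_leq; apply/andP; split.
    by rewrite (leq_trans (size_polyD _ _))// geq_max sz size_pow_poly leqnn.
  by rewrite ltnNge; apply/negP => h; move/negP: Pn0; apply; rewrite nth_default.
split=> //; first by rewrite lead_coefE szP /= Pn normc_real ger0_norm; lra.
move=> t; set b := max_dist 0 (c0 :: cs) t.
have hb c : c \in c0 :: cs -> cdist t c ^+ n <= b ^+ n.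
  move=> cc; rewrite lerXn2r ?nnegrE ?cdist_ge0 ?max_dist_ge0//; exact: max_dist_ub.
have b0 : 0 <= b ^+ n by rewrite exprn_ge0// max_dist_ge0.
have tail : normc (\sum_(p <- zip ws (map (pow_poly n) cs)) (p.1%:C)%C *: p.2).[toC t]
    <= (size cs)%:R * b ^+ n.
  have {}hb c : c \in cs -> cdist t c ^+ n <= b ^+ n by move=> h; apply: hb; rewrite inE h orbT.
  move: (b ^+ n) b0 hb => B B0; elim: (ws) (cs) hws => [|w ws' IH] [|c cs'] hws' hb;
    rewrite ?big_nil ?horner0 ?ComplexField.Normc.normc0 ?mulr_ge0//.
  rewrite /= big_cons /= hornerD hornerZ; apply: le_trans (le_normcD _ _) _.
  rewrite -natr1 mulrDl mul1r addrC; move: hws' => /= /andP[/andP[w0 w1] hws']; apply: lerD.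
    by apply: IH => // c' c'c; apply: hb; rewrite inE c'c orbT.
  rewrite ComplexField.Normc.normcM normc_real ger0_norm//.
  have := hb c (mem_head _ _); rewrite -polymod_pow; apply: le_trans.
  by rewrite ler_piMl// polymod_ge0.
rewrite /polymod /P hornerD; apply: le_trans (le_normcD _ _) _.
rewrite -natr1 mulrDl mul1r addrC; apply: lerD => //.
by have := hb c0 (mem_head _ _); rewrite -polymod_pow.
Qed.

End MaxDist.

(** * The key estimate at a fixed degree *)

Section PolynomialInequality.
Variable R : realType.
Local Notation C := (R * R)%type.
Local Notation normc := (@ComplexField.Normc.normc R).
Implicit Types (z t w : C) (e r : R).
Local Notation eps := (@eps R).
Variables (E : set C) (mu : cmeasure R).
Hypotheses (cE : compact E) (capE : (-oo < log_cap E)%E) (eqE : is_equilibrium E mu).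
Local Notation lc := (lc E).
Let muE : fin_on mu E. Proof. exact: eq_fin. Qed.
Let mass1 : mass mu = 1. Proof. exact: (eq_mass eqE). Qed.

Lemma integrable_pot_kernel (r : C) : mu.-integrable setT (fun t => elog (cdist r t)).
Proof.
apply: (fin_integrable_e muE (measurable_pot_kernel r) (bm_phi r cE ltr01)).
  by move=> t _; exact: elog_le_phi.
exact: lt_le_trans (ltNyr _) (frostman_potential cE capE eqE r).
Qed.

Lemma max_dist_bounded (K : set C) (cs : seq C) : compact K ->
  exists2 b : R, 0 < b & forall t, K t -> max_dist 0 cs t <= b.
Proof.
move=> cK; elim: cs => [|c cs [b b0 hb]].
  by exists 1 => // t _; rewrite /max_dist big_nil.
have [b' b'0 hb'] := compact_cdist_bounded c cK.
exists (b + b'); first exact: addr_gt0.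
move=> t Kt; rewrite /max_dist big_cons ge_max; apply/andP; split.
  by rewrite cdistC (le_trans (hb' t Kt))// lerDr ltW.
by apply: le_trans (hb t Kt) _; rewrite lerDl ltW.
Qed.

Lemma measurable_elog_max_dist cs : measurable_fun setT (fun t => elog (max_dist (0 : R) cs t)).
Proof. by apply: measurable_elog; exact: measurable_max_dist. Qed.

Lemma integrable_max_dist cs (U : R) :
  (\int[mu]_t elog (max_dist 0 cs t) = U%:E)%E ->
  mu.-integrable setT (fun t => elog (max_dist 0 cs t)).
Proof.
move=> hU; have [b b0 hb] := max_dist_bounded cs cE.
apply: (fin_integrable_e muE (measurable_elog_max_dist cs) (bm_cst E (ln b))).
  move=> t Et; rewrite -elog_gt0//; apply: le_elog_mono; first exact: max_dist_ge0.
  exact: hb.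
by rewrite hU ltNyr.
Qed.

(** Selection bounds the left side by the integral of [ln |P|] with floor [e^(n+1)]; [up] and [low]
    then carry this bound from [nu] to [mu] through the roots of [P]. The term in [1 / N] is
    [(ln G - ln h) / N] written out. *)
Lemma poly_inequality (nu : cmeasure R) K e M c0 cs (U b : R) n N :
  fin_on nu K -> mass nu = 1 -> 0 < e -> e <= b ->
  (forall z, E z -> rpot e nu z <= M) ->
  (forall t, K t -> max_dist 0 (c0 :: cs) t <= b) ->
  (\int[mu]_t elog (max_dist 0 (c0 :: cs) t) = U%:E)%E -> (0 < N)%N ->
  n.+1%:R * \int[nu]_t ln (max_dist e (c0 :: cs) t) -
    (size cs)%:R * (ln (2 * N%:R + 1) +
      (ln (size cs).+1%:R + n.+1%:R * (ln b - ln e)) / N%:R) <=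
  n.+1%:R * (M - lc + U) + ln (size cs).+1%:R.
Proof.
move=> nuK nu1 e0 eb hM hb hU N0; have cK : compact K by case: nuK.
have b0 := lt_le_trans e0 eb.
pose m := (size cs).+1; have m0 : 0 < m%:R :> R by rewrite ltr0n.
pose G : R := m%:R * b ^+ n.+1.
have bn0 : 0 < b ^+ n.+1 by rewrite exprn_gt0.
have en0 : 0 < e ^+ n.+1 by rewrite exprn_gt0.
have hG : e ^+ n.+1 <= G.
  apply: (@le_trans _ _ (b ^+ n.+1)); first by apply: le_exp => //; exact: ltW.
  by rewrite /G ler_peMl ?ler1n//; exact: ltW.
have pb t c : K t -> c \in c0 :: cs -> polymod (pow_poly n.+1 c) t <= b ^+ n.+1.
  move=> Kt cc; rewrite polymod_pow; apply: le_exp; first exact: cdist_ge0.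
  exact: le_trans (max_dist_ub 0 t cc) (hb t Kt).
have sumG t : K t -> polymod (pow_poly n.+1 c0) t +
    \sum_(g <- map (pow_poly n.+1) cs) polymod g t <= G.
  move=> Kt; rewrite /G /m -natr1 mulrDl mul1r addrC; apply: lerD; last exact: (pb _ _ Kt (mem_head _ _)).
  rewrite big_map mulr_natl -[X in _ *+ X]card_ord -sumr_const (big_nth c0) big_mkord.
  by apply: ler_sum => i _; apply: (pb _ _ Kt); rewrite inE mem_nth ?orbT.
have [ws [szw allw hws]] := selection nuK nu1 N0 en0 hG sumG.
have [szP lP bP] := comb_poly n.+1 c0 cs allw.
move: hws szP lP bP; set P := pow_poly _ _ + _ => hws szP lP bP.
have P0 : P != 0 by rewrite -size_poly_eq0 szP.
have [rs hrs] := polymod_factor P; have [szrs facP] := hrs P0.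
rewrite szP /= in szrs.
set l := normc (lead_coef P) in lP facP.
have l0 : 0 < l := lt_le_trans ltr01 lP.
(* The floor is absorbed: [P] has [n + 1] roots, and each smoothed distance to a root is at least
   [e]. *)
have up : \int[nu]_t ln (maxmod (e ^+ n.+1) [:: P] t) <= ln l + \sum_(r <- rs) rpot e nu r.
  have -> : \sum_(r <- rs) rpot e nu r = \int[nu]_t (\sum_(r <- rs) phi e r t).
    by rewrite (fin_sum nuK)// => r; exact: bm_phi.
  have -> : ln l = \int[nu]_t (ln l) by rewrite fin_cst nu1 mulr1.
  rewrite -(finD nuK); [|exact: bm_cst|by apply: bm_sum => r; exact: bm_phi].
  apply: (fin_le nuK).
  - apply: (@bm_ln_maxmod _ K _ G) => // t Kt f; rewrite inE => /eqP ->.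
    apply: le_trans (bP t) _; rewrite /G ler_pM2l//; apply: le_exp; first exact: max_dist_ge0.
    exact: hb.
  - by apply: bmD; [exact: bm_cst|apply: bm_sum => r; exact: bm_phi].
  move=> t Kt; have sd0 (r : C) : 0 < smooth_dist e r t by exact: smooth_dist_gt0.
  rewrite /phi -ln_prod// -lnM ?posrE ?prodr_gt0//.
  apply: ln_le; first exact: lt_le_trans en0 (maxmod_ge _ _ _).
  apply: maxmod_le => [|f]; last first.
    rewrite inE => /eqP ->; rewrite facP ler_pM2l//; apply: le_prod => r.
    by rewrite cdist_ge0 cdistC cdist_le_smooth.
  apply: (@le_trans _ _ (\prod_(r <- rs) smooth_dist e r t)); last first.
    by rewrite ler_peMl// prodr_ge0// => r _; exact: ltW.
  by rewrite -szrs; apply: exp_le_prod => [|r]; [exact: ltW|exact: smooth_dist_ge (ltW e0)].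
(* Bernstein-Walsh is applied at each root; by the factorisation the potentials of [mu] at the roots
   sum to the [mu]-integral of [ln |P| - ln l]. *)
have low : ln l + \sum_(r <- rs) (rpot e nu r - M + lc) <= n.+1%:R * U + ln m%:R.
  rewrite -lee_fin.
  apply: (@le_trans _ _ ((ln l)%:E + \sum_(r <- rs) potential mu r)%E).
    rewrite EFinD leeD2l// -sumEFin; apply: lee_sum => r _.
    exact: (bernstein_walsh cE capE eqE _ nuK nu1 e0 hM).
  have int1 : mu.-integrable setT (fun t => (\sum_(r <- rs) elog (cdist r t))%E).
    by apply: integrable_sum => // r _; exact: integrable_pot_kernel.
  have int2 := integrable_max_dist hU.
  have -> : (\sum_(r <- rs) potential mu r = \int[mu]_t (\sum_(r <- rs) elog (cdist r t)))%E.
    by rewrite integral_sum// => r; exact: integrable_pot_kernel.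
  have intc c : mu.-integrable setT (fun=> c%:E).
    exact: (fin_integrable muE (bm_cst E c)).
  have cstE c : (\int[mu]_t c%:E = c%:E)%E.
    by rewrite (fin_EFin muE (bm_cst E c)) (eq_cst eqE).
  rewrite -[X in (X + _)%E]cstE -integralD//.
  have -> : ((n.+1%:R * U + ln m%:R)%:E =
     \int[mu]_t (n.+1%:R%:E * elog (max_dist 0 (c0 :: cs) t) + (ln m%:R)%:E))%E.
    by rewrite integralD// ?integralZl// ?hU ?cstE//; exact: integrableZl.
  apply: le_integral => //; [exact: integrableD|by apply: integrableD => //; exact: integrableZl|].
  move=> t _; have -> : ((ln l)%:E + \sum_(r <- rs) elog (cdist r t) = elog (polymod P t))%E.
    rewrite facP elogM; [|exact: ltW|by apply: prodr_ge0 => r _; exact: cdist_ge0].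
    rewrite elog_gt0// elog_prod; last by move=> r; exact: cdist_ge0.
    by congr (_ + _)%E; apply: eq_bigr => r _; rewrite cdistC.
  rewrite -elogX ?max_dist_ge0// addeC -elog_gt0// -elogM ?exprn_ge0 ?max_dist_ge0//.
  by apply: le_elog_mono; [exact: polymod_ge0|exact: bP].
have bme : bm K (fun t => ln (max_dist e (c0 :: cs) t)).
  apply: (@bm_le _ _ _ (ln e) (ln b)).
    exact: (measurableT_comp (@measurable_ln R) (measurable_max_dist e _)).
  move=> t Kt; have me := max_dist_ge e (c0 :: cs) t; rewrite !ln_le//.
    exact: lt_le_trans me.
  apply: max_dist_le => // c cc; exact: le_trans (max_dist_ub 0 t cc) (hb t Kt).
have -> : n.+1%:R * \int[nu]_t ln (max_dist e (c0 :: cs) t) =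
    \int[nu]_t ln (maxmod (e ^+ n.+1) (pow_poly n.+1 c0 :: map (pow_poly n.+1) cs) t).
  rewrite -(finZ nuK)//; apply: eq_Rintegral => t _.
  rewrite -[_ :: map _ cs]/(map (pow_poly n.+1) (c0 :: cs)) (maxmod_pow _ _ _ (ltW e0)).
  by rewrite lnXn ?mulr_natl//; exact: lt_le_trans e0 (max_dist_ge _ _ _).
have lnG : ln G - ln (e ^+ n.+1) = ln m%:R + n.+1%:R * (ln b - ln e).
  by rewrite /G lnM ?posrE// !lnXn// mulrBr !mulr_natl addrA.
rewrite size_map lnG in hws.
have sumE : \sum_(r <- rs) (rpot e nu r - M + lc) = \sum_(r <- rs) rpot e nu r + n.+1%:R * (lc - M).
  rewrite -szrs mulr_natl -[X in _ *+ X]card_ord -sumr_const.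
  rewrite (big_nth c0) big_mkord [in RHS](big_nth c0) big_mkord -big_split /=.
  by apply: eq_bigr => i _; rewrite -addrA [- M + _]addrC.
rewrite sumE in low; apply: le_trans hws _; apply: le_trans up _.
move: low; move: (\sum_(r <- rs) _) => x; rewrite !mulrDr !mulrN; move: (n.+1%:R * _) (n.+1%:R * _) (n.+1%:R * _) => *; lra.
Qed.

End PolynomialInequality.

(** * From fixed degree to the limit; maxima on the boundary *)

Section MaxDistInequality.
Variable R : realType.
Local Notation C := (R * R)%type.
Implicit Types (z t w : C) (e r : R).
Local Notation eps := (@eps R).
Variables (E : set C) (mu : cmeasure R).
Hypotheses (cE : compact E) (capE : (-oo < log_cap E)%E) (eqE : is_equilibrium E mu).
Local Notation lc := (lc E).
Let muE : fin_on mu E. Proof. exact: eq_fin. Qed.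
Let mass1 : mass mu = 1. Proof. exact: (eq_mass eqE). Qed.

Lemma le_div_nat (a d : R) : 0 < d -> exists2 n, (0 < n)%N & a <= n%:R * d.
Proof.
move=> d0; exists (Num.truncn (`|a| / d)).+1 => //.
rewrite -ler_pdivrMr//; apply: le_trans (ltW (truncnS_gt _)).
by rewrite ler_pM2r ?invr_gt0// ler_norm.
Qed.

(** After division by the degree one error, of order [(ln b - ln e) / N], does not decay. So [N] is
    chosen first to make it small, and then the degree absorbs all terms that depend on [N]. *)
Lemma max_dist_inequality (nu : cmeasure R) K e M c0 cs (U : R) :
  fin_on nu K -> mass nu = 1 -> 0 < e -> (forall z, E z -> rpot e nu z <= M) ->
  (\int[mu]_t elog (max_dist 0 (c0 :: cs) t) = U%:E)%E ->
  \int[nu]_t ln (max_dist e (c0 :: cs) t) <= M - lc + U.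
Proof.
move=> nuK nu1 e0 hM hU; have cK : compact K by case: nuK.
have [b' b'0 hb'] := max_dist_bounded (c0 :: cs) cK.
pose b := Num.max b' e; have eb : e <= b by rewrite le_max lexx orbT.
have hb t : K t -> max_dist 0 (c0 :: cs) t <= b.
  by move=> Kt; rewrite le_max hb'.
apply/ler_addgt0Pr => d d0.
have d2 : 0 < d / 2 by rewrite divr_gt0.
pose m : R := (size cs)%:R; have m0 : 0 <= m by exact: ler0n.
have k0 : 0 <= ln b - ln e by rewrite subr_ge0; exact: ln_le.
have [N N0 hN] := le_div_nat (m * (ln b - ln e)) d2.
have N0' : 0 < N%:R :> R by rewrite ltr0n.
have [n n0 hn] := le_div_nat (m * (ln (2 * N%:R + 1) + ln (size cs).+1%:R / N%:R) + ln (size cs).+1%:R) d2.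
have := poly_inequality cE capE eqE n.-1 nuK nu1 e0 eb hM hb hU N0.
rewrite prednK//; have n0' : 0 < n%:R :> R by rewrite ltr0n.
set I := \int[nu]_t _ => key; rewrite -(ler_pM2l n0').
have -> : n%:R * (M - lc + U + d) = n%:R * (M - lc + U) + n%:R * (d / 2) + n%:R * (d / 2) by field.
have : m * (n%:R * (ln b - ln e) / N%:R) <= n%:R * (d / 2).
  rewrite (_ : m * _ = n%:R * (m * (ln b - ln e) / N%:R)); last by ring.
  by rewrite ler_pM2l// ler_pdivrMr// [_ * N%:R]mulrC.
move: key hn; rewrite -/m.
have -> : m * (ln (2 * N%:R + 1) + (ln (size cs).+1%:R + n%:R * (ln b - ln e)) / N%:R) =
   m * (ln (2 * N%:R + 1) + ln (size cs).+1%:R / N%:R) + m * (n%:R * (ln b - ln e) / N%:R) by ring.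
move: (m * (ln (2 * N%:R + 1) + ln (size cs).+1%:R / N%:R)) => q1.
move: (m * (n%:R * (ln b - ln e) / N%:R)) => q2.
move: (n%:R * I) (n%:R * (d / 2)) (n%:R * (M - lc + U)) (ln (size cs).+1%:R).
by move=> *; lra.
Qed.

Lemma max_dist_integral c0 cs : exists2 U, lc <= U &
  (\int[mu]_t elog (max_dist 0 (c0 :: cs) t) = U%:E)%E.
Proof.
have mE := measurable_elog_max_dist (c0 :: cs).
have lo : (lc%:E <= \int[mu]_t elog (max_dist 0 (c0 :: cs) t))%E.
  apply: le_trans (frostman_potential cE capE eqE c0) _.
  rewrite /potential !(integral_on muE)//; last exact: measurable_pot_kernel.
  apply: (le_integral_on muE); [apply: measurable_funTS; exact: measurable_pot_kernel|exact: measurable_funTS|].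
  move=> t Et; apply: le_elog_mono; first exact: cdist_ge0.
  by rewrite cdistC; apply: max_dist_ub; exact: mem_head.
have [b b0 hb] := max_dist_bounded (c0 :: cs) cE.
have hi : (\int[mu]_t elog (max_dist 0 (c0 :: cs) t) <= (ln b)%:E)%E.
  rewrite -[ln b](eq_cst eqE); apply: (fin_ele muE mE (bm_cst E _)).
  move=> t Et; rewrite -elog_gt0//; apply: le_elog_mono; first exact: max_dist_ge0.
  exact: hb.
move: lo hi; case: (\int[mu]_t _)%E => // U lo _; exists U => //.
Qed.

Lemma bdry_closed_sub : bdry E `<=` E.
Proof. by move=> z [cz _]; apply: (compact_closedC cE). Qed.

Lemma E_nonempty : E !=set0.
Proof. by have [z /(msupp_sub cE eqE) Ez] := msupp_nonempty cE eqE; exists z. Qed.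

(** At an interior maximiser a small cross would stay in [E], and its four-point sum would exceed
    four times the maximum; the positive mass makes this gain strict. *)
Lemma argmax_bdry_pos (nu : cmeasure R) K e : fin_on nu K -> 0 < mass nu -> 0 < e ->
  exists2 c, bdry E c & forall z, E z -> rpot e nu z <= rpot e nu c.
Proof.
move=> nuK nu0 e0; have cK : compact K by case: nuK.
have [c Ec hc] := attains_max cE E_nonempty (fun z w => rpot_lip nuK z w e0).
exists c => //; split; first exact: subset_closure.
move=> /nbhs_cdistP[d d0 hd].
have [b b0 hb] := compact_cdist_bounded c cK.
pose r := Num.min e (d / 2).
have r0 : 0 < r by rewrite lt_min e0 divr_gt0.
have re : r <= e by rewrite ge_min lexx.
have rd : r < d by rewrite gt_min [X in _ || X](_ : _ = true) ?orbT//; lra.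
have B0 : 0 < b ^+ 2 + e ^+ 2 by rewrite ltr_wpDl ?sqr_ge0 ?exprn_gt0.
have hB t : K t -> cdist c t ^+ 2 + e ^+ 2 <= b ^+ 2 + e ^+ 2.
  by move=> Kt; rewrite lerD2r; apply: le_exp; [exact: cdist_ge0|exact: hb].
have := sum4_rpot_ge nuK r0 re hB.
have : sum4 (rpot e nu) c r <= 4 * rpot e nu c.
  apply: sum4_le (ltW r0) _ => w wc; apply/hc/hd; by rewrite cdistC wc.
have : 0 < mass nu * (r ^+ 2 * e ^+ 2 / (3 * (b ^+ 2 + e ^+ 2) ^+ 2)).
  by rewrite mulr_gt0// divr_gt0 ?mulr_gt0 ?exprn_gt0.
move: (mass nu * _) (sum4 _ _ _) (rpot _ _ _) => *; lra.
Qed.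

Lemma argmax_bdry (nu : cmeasure R) K e : fin_on nu K -> 0 < e ->
  exists2 c, bdry E c & forall z, E z -> rpot e nu z <= rpot e nu c.
Proof.
move=> nuK e0; have := mass_ge0 nuK; rewrite le_eqVlt => /orP[/eqP nu0|].
  (* The zero measure has a constant potential, so any boundary point serves; [mu] supplies one. *)
  have [c bc _] := argmax_bdry_pos muE (lt_le_trans ltr01 (eq_ind_r (fun x => 1 <= x) (lexx 1) mass1)) e0.
  exists c; first exact: bc.
  move=> z _; have := rpot_lip nuK z c e0.
  by rewrite -nu0 !mul0r addr0.
by move=> nu0; exact: (argmax_bdry_pos nuK nu0 e0).
Qed.

(** Only the sum is bounded below, not the terms. The first term is frozen at scale [k] while the
    others go to the limit by induction, and then [k] grows; monotonicity in the scale permits the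
    different scales. *)
Lemma le_sum_potential (J : Type) (s : seq J) (nu : J -> cmeasure R) K (z : J -> C) x :
  (forall j, fin_on (nu j) K) ->
  (forall k, x <= \sum_(j <- s) rpot (eps k) (nu j) (z j)) ->
  (x%:E <= \sum_(j <- s) potential (nu j) (z j))%E.
Proof.
move=> nuK; elim: s x => [|j s IH] x h.
  by have := h 0%N; rewrite !big_nil lee_fin.
have dec k l (j' : J) : (k <= l)%N -> rpot (eps l) (nu j') (z j') <= rpot (eps k) (nu j') (z j').
  by move=> kl; apply: (le_rpot (nuK j')); [exact: eps_gt0|exact: le_eps].
have B k : ((x - rpot (eps k) (nu j) (z j))%:E <= \sum_(j <- s) potential (nu j) (z j))%E.
  apply: IH => l.
  have [kl|/ltnW lk] := leqP k l.
    rewrite lerBlDr; apply: le_trans (h l) _; rewrite big_cons addrC lerD2l; exact: dec.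
  have : \sum_(j <- s) rpot (eps k) (nu j) (z j) <= \sum_(j <- s) rpot (eps l) (nu j) (z j).
    by apply: ler_sum => i _; exact: dec.
  move=> hs; rewrite lerBlDr; apply: le_trans (h k) _; rewrite big_cons addrC lerD2r; exact: hs.
have Blt : (\sum_(j <- s) potential (nu j) (z j) < +oo)%E.
  elim: (s) => [|i s' IHs]; first by rewrite big_nil ltry.
  by rewrite big_cons; apply: lte_add_pinfty => //; exact: (potential_lty (nuK i)).
rewrite big_cons; move: B Blt; case: (\sum_(j <- s) _)%E => [r B _|//|/(_ 0%N)//].
rewrite -leeBlDr// -EFinB; apply: (le_potential (nuK j)) => k.
by have := B k; rewrite lee_fin; lra.
Qed.

Definition mzero_c : cmeasure R := [the cmeasure R of mzero].

Lemma sum_measure m (nu : 'I_m -> cmeasure R) K : compact K -> (forall j, fin_on (nu j) K) ->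
  exists s : cmeasure R, fin_on s K /\
    forall f, bm K f -> \int[s]_t f t = \sum_(j < m) \int[nu j]_t f t.
Proof.
move=> cK; elim: m nu => [|m IH] nu nuK.
  exists mzero_c; split; first by split=> //=; rewrite /mzero ltry.
  by move=> f _; rewrite big_ord0 /Rintegral integral_measure_zero.
have [s [sK hs]] := IH (fun j => nu (lift ord0 j)) (fun j => nuK _).
exists (madd (nu ord0) s); split; first exact: fin_on_madd.
by move=> f bf; rewrite big_ord_recl (int_madd (nuK _) sK bf) hs.
Qed.

Definition box (b : R) : set C := `[- b, b]%classic `*` `[- b, b]%classic.

Lemma box_compact b : compact (box b).
Proof. by apply: compact_setX; exact: segment_compact. Qed.

Lemma compact_sub_box K : compact K -> exists b0, forall b, b0 <= b -> K `<=` box b.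
Proof.
move=> /(compact_cdist_bounded 0)[b0 _ hb]; exists b0 => b bb z Kz.
have hz := le_trans (hb z Kz) bb.
split; rewrite /= in_itv /= -ler_norml; apply: le_trans hz; rewrite cdistC.
  by have := abs1_le_cdist z 0; rewrite /= subr0.
by have := abs2_le_cdist z 0; rewrite /= subr0.
Qed.

(** A comparison of two scales: for [e = d e'] the error is [d], however small [e'] is. *)
Lemma phi_le_max e e' z t : 0 < e -> 0 < e' ->
  phi e z t <= ln (Num.max (cdist z t) e') + e / e'.
Proof.
move=> e0 e'0; set a := Num.max _ _.
have a0 : 0 < a by rewrite lt_max e'0 orbT.
have q0 : 0 < e / e' by rewrite divr_gt0.
apply: (@le_trans _ _ (ln (a * (1 + e / e')))).
  apply: phi_le => //; rewrite mulrDr mulr1; apply: lerD; first by rewrite le_max lexx.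
  rewrite mulrCA ler_peMr ?(ltW e0)// ler_pdivlMr// mul1r le_max lexx orbT//.
rewrite lnM ?posrE//; last by lra.
by rewrite lerD2l; apply: le_ln1Dx; lra.
Qed.

End MaxDistInequality.

(** * The inequality for suprema of potentials *)

Section ReverseTriangle.
Variable R : realType.
Local Notation C := (R * R)%type.
Implicit Types (z t w : C) (e r : R).
Local Notation eps := (@eps R).
Variables (E : set C) (mu : cmeasure R).
Hypotheses (cE : compact E) (capE : (-oo < log_cap E)%E) (eqE : is_equilibrium E mu).
Local Notation lc := (lc E).
Let muE : fin_on mu E. Proof. exact: eq_fin. Qed.
Let mass1 : mass mu = 1. Proof. exact: (eq_mass eqE). Qed.

Definition points m (c : 'I_m -> C) : seq C := [seq c k | k <- enum 'I_m].

Lemma mem_points m (c : 'I_m -> C) k : c k \in points c.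
Proof. by apply: map_f; rewrite mem_enum. Qed.

Lemma points_cons m (c : 'I_m.+1 -> C) : exists c0 cs, points c = c0 :: cs.
Proof. by rewrite /points enum_ordSl /=; eexists; eexists. Qed.

Lemma bigmax_max_dist m (c : 'I_m -> C) z :
  \big[Num.max/0%R]_(k < m) cdist z (c k) = max_dist 0 (points c) z.
Proof. by rewrite /max_dist /points big_map big_enum. Qed.

Lemma CEm_value m (c : 'I_m.+1 -> C) : exists2 U, lc <= U &
  (\int[mu]_z elog (\big[Num.max/0%R]_(k < m.+1) cdist z (c k))%R = U%:E)%E /\
  (\int[mu]_z elog (max_dist 0 (points c) z) = U%:E)%E.
Proof.
have [c0 [cs pE]] := points_cons c.
have [U lU hU] := max_dist_integral cE capE eqE c0 cs.
exists U => //; rewrite pE; split => //; rewrite -hU.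
by apply: eq_integral => z _; rewrite bigmax_max_dist pE.
Qed.

Lemma CEm_ge m (c : 'I_m.+1 -> C) U : (forall k, bdry E (c k)) ->
  (\int[mu]_z elog (max_dist 0 (points c) z) = U%:E)%E ->
  ((U - lc)%:E <= CEm E mu m.+1)%E.
Proof.
move=> bc hU; apply: ereal_sup_ubound; exists c; split=> //.
rewrite (log_capE cE capE eqE) EFinB -hU; congr (_ - _)%E.
by apply: eq_integral => z _; rewrite bigmax_max_dist.
Qed.

Theorem reverse_triangle m (nu : 'I_m -> cmeasure R) :
  (forall j, compactly_supported (nu j)) ->
  (\sum_(j < m) nu j setT)%E = 1%E ->
  (\sum_(j < m) supE E (potential (nu j))
     <= CEm E mu m + supE E (fun z => \sum_(j < m) potential (nu j) z))%E.
Proof.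
case: m nu => [|m] nu csupp nuT.
  by move: nuT; rewrite big_ord0 => -[] /eqP; rewrite eq_sym oner_eq0.
have nu_lty j : (nu j setT < +oo)%E.
  apply: le_lt_trans (ltry 1); rewrite -nuT (bigD1 j)//= leeDl//.
  by apply: sume_ge0 => i _; exact: measure_ge0.
have [b hb] : exists b, forall j, exists Kj, [/\ compact Kj, nu j (~` Kj) = 0%E & Kj `<=` box b].
  have /choice[b hb] j : exists b, exists Kj, [/\ compact Kj, nu j (~` Kj) = 0%E &
      forall b', b <= b' -> Kj `<=` box b'].
    have [Kj [cKj nuKj]] := csupp j; have [b hb] := compact_sub_box cKj.
    by exists b, Kj.
  exists (\sum_j `|b j|) => j; have [Kj [h1 h2 h3]] := hb j; exists Kj; split=> //.
  by apply: h3; rewrite (bigD1 j)//= ler_wpDr ?sumr_ge0// ler_norm.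
have nuK j : fin_on (nu j) (box b).
  have [Kj [h1 h2 h3]] := hb j.
  by apply: (@fin_onS _ _ Kj) => //; exact: box_compact.
have [s [sK hs]] := sum_measure (@box_compact R b) nuK.
have s1 : mass s = 1.
  have := hs (fun=> 1) (bm_cst _ 1); rewrite fin_cst mul1r => ->.
  have : (\sum_(j < m.+1) nu j setT = (\sum_(j < m.+1) mass (nu j))%:E)%E.
    by rewrite -sumEFin; apply: eq_bigr => j _; rewrite (massE (nuK j)).
  rewrite nuT => -[] H; rewrite [RHS]H; apply: eq_bigr => j _; by rewrite fin_cst mul1r.
have rE e z : 0 < e -> rpot e s z = \sum_(j < m.+1) rpot e (nu j) z.
  by move=> e0; rewrite /rpot hs//; apply: bm_phi => //; exact: box_compact.
set T := supE E _.
(* Otherwise compactness would give one point of [E] where every regularised potential, hence the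
   potential itself, is at least [x + d]. *)
have dini x d : (T <= x%:E)%E -> 0 < d -> exists n, forall z, E z -> rpot (eps n) s z <= x + d.
  move=> Tx d0; apply: contrapT => H.
  have [z Ez hz] : exists2 z, E z & forall k, x + d <= rpot (eps k) s z.
    apply: (@dini_attained1 R E (fun k => rpot (eps k) s) (fun k => mass s / eps k)) => //.
    - by move=> k z w; have := rpot_lip sK w z (eps_gt0 R k); rewrite cdistC.
    - by move=> k l z kl; apply: (le_rpot sK); [exact: eps_gt0|exact: le_eps].
    move=> e n e0; apply: contrapT => H2; apply: H; exists n => z Ez.
    rewrite leNgt; apply/negP => hz; apply: H2; exists z => //; lra.
  have : ((x + d)%:E <= T)%E.
    apply: (@le_trans _ _ (\sum_(j < m.+1) potential (nu j) z)%E).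
      apply: (@le_sum_potential _ _ _ nu (box b) (fun=> z)) => // k.
      by rewrite -rE ?eps_gt0//; exact: hz.
    by apply: ereal_sup_ubound; exists z.
  move=> /le_trans/(_ Tx); rewrite lee_fin; lra.
(* [T] may a priori be infinite, so the estimate is made for any real [x] above it. The first half
   then yields [T >= lc] and excludes [-oo]. *)
have claim x d : (T <= x%:E)%E -> 0 < d -> lc <= x + d /\
    (\sum_(j < m.+1) supE E (potential (nu j)) <= CEm E mu m.+1 + (x + d + d)%:E)%E.
  move=> Tx d0; have [n hn] := dini x d Tx d0; have e'0 := eps_gt0 R n.
  split.
    apply: le_trans (rpot_mean_ge cE capE eqE sK s1 e'0) _.
    rewrite -[x + d](eq_cst eqE); apply: (fin_le muE); [exact: (bm_rpot sK)|exact: bm_cst|exact: hn].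
  (* The scale [eps n] controls the sum on [E]; the points [c j] are chosen at the finer scale [e],
     so that [phi_le_max] loses only [d]. *)
  pose e := d * eps n; have e0 : 0 < e by rewrite mulr_gt0.
  have /choice[c hc] j : exists c, bdry E c /\ forall z, E z -> rpot e (nu j) z <= rpot e (nu j) c.
    by have [c bc hc] := argmax_bdry cE eqE (nuK j) e0; exists c.
  have [U lU [_ hU]] := CEm_value c.
  have h1 : (\sum_(j < m.+1) supE E (potential (nu j)) <= (\sum_(j < m.+1) rpot e (nu j) (c j))%:E)%E.
    rewrite -sumEFin; apply: lee_sum => j _; apply: ge_ereal_sup => _ [z Ez <-].
    apply: le_trans (potential_le_rpot (nuK j) z e0) _; rewrite lee_fin; exact: (hc j).2.
  apply: le_trans h1 _.
  apply: (@le_trans _ _ ((U - lc)%:E + (x + d + d)%:E)%E); last first.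
    by apply: leeD2r; apply: CEm_ge hU => k; exact: (hc k).1.
  rewrite -EFinD lee_fin.
  have [c0 [cs pE]] := points_cons c; rewrite pE in hU.
  have := max_dist_inequality cE capE eqE sK s1 e'0 hn hU.
  have [bb bb0 hbb] := max_dist_bounded (c0 :: cs) (@box_compact R b).
  have bm1 : bm (box b) (fun t => ln (max_dist (eps n) (c0 :: cs) t) + d).
    apply: bmD; last exact: bm_cst.
    apply: (@bm_le _ _ _ (ln (eps n)) (ln (Num.max bb (eps n)))).
      exact: (measurableT_comp (@measurable_ln R) (measurable_max_dist _ _)).
    move=> t Kt; have me := max_dist_ge (eps n) (c0 :: cs) t.
    rewrite !ln_le//; first exact: lt_le_trans me.
    apply: max_dist_le => [|c' cc]; first by rewrite le_max lexx orbT.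
    by rewrite le_max (le_trans (max_dist_ub 0 t cc))// hbb.
  have : \sum_(j < m.+1) rpot e (nu j) (c j) <= \int[s]_t (ln (max_dist (eps n) (c0 :: cs) t) + d).
    rewrite hs//; apply: ler_sum => j _; apply: (fin_le (nuK j)) => //.
      by apply: bm_phi => //; exact: box_compact.
    move=> t _; apply: le_trans (phi_le_max _ _ e0 e'0) _.
    rewrite /e mulfK ?gt_eqF// lerD2r; apply: ln_le; first by rewrite lt_max e'0 orbT.
    by rewrite ge_max max_dist_ge andbT cdistC max_dist_ub// -pE mem_points.
  rewrite (finD sK); [|have := bmB bm1 (bm_cst _ d); by under eq_fun do rewrite addrK|exact: bm_cst].
  rewrite fin_cst s1 mulr1; move: (\sum_(j < _) _) (\int[s]_t _) => *; lra.
have Tlc : (lc%:E <= T)%E.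
  rewrite leNgt; apply/negP => Tl.
  have [x [Tx xl]] : exists x, (T <= x%:E)%E /\ x < lc.
    have real_above (y : \bar R) : (y < lc%:E)%E -> exists x, (y <= x%:E)%E /\ x < lc.
      case: y => [y| |] //; rewrite ?lte_fin; first by exists y.
      by move=> _; exists (lc - 1); rewrite leNye; split=> //; lra.
    exact: real_above.
  have d0 : 0 < (lc - x) / 2 by rewrite divr_gt0// subr_gt0.
  have [h _] := claim x _ Tx d0; have : lc <= x by lra.
  by rewrite leNgt xl.
have Ege : (-oo < CEm E mu m.+1)%E.
  have [c bc _] := argmax_bdry cE eqE muE ltr01.
  have [U _ [_ hU]] := CEm_value (fun _ : 'I_m.+1 => c).
  exact: lt_le_trans (ltNyr _) (CEm_ge (fun=> bc) hU).
move: Tlc claim {dini}; move: T => [x _ claim| _ _|//]; last first.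
  by rewrite addey ?leey// -ltNye.
apply/lee_addgt0Pr => d d0.
have d2 : 0 < d / 2 by rewrite divr_gt0.
have [_] := claim x (d / 2) (lexx _) d2; rewrite -addeA -EFinD.
by rewrite (_ : x + d / 2 + d / 2 = x + d)//; lra.
Qed.

End ReverseTriangle.

(** * Dominant sets and strict inequality *)

Section DominantSets.
Variable R : realType.
Local Notation C := (R * R)%type.
Implicit Types (z t w : C) (e r : R).
Local Notation eps := (@eps R).
Variables (E : set C) (mu : cmeasure R).
Hypotheses (cE : compact E) (capE : (-oo < log_cap E)%E) (eqE : is_equilibrium E mu).
Local Notation lc := (lc E).
Local Notation S := (msupp mu).
Let muE : fin_on mu E. Proof. exact: eq_fin. Qed.
Let muS : fin_on mu S. Proof. exact: (msupp_fin cE eqE). Qed.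

Lemma has_sup_dist z (F : set C) : F !=set0 -> F `<=` E -> has_sup [set cdist z t | t in F].
Proof.
move=> [x Fx] FE; split; first by exists (cdist z x), x.
have [b b0 hb] := compact_cdist_bounded z cE.
by exists b => _ [t Ft <-]; apply: hb; exact: FE.
Qed.

Lemma cdist_le_dE z t : E t -> cdist z t <= dE E z.
Proof.
move=> Et; apply: ub_le_sup; last by exists t.
by have [] := has_sup_dist z (E_nonempty cE eqE) (@subset_refl _ E).
Qed.

Lemma dE_le z b : (forall t, E t -> cdist z t <= b) -> dE E z <= b.
Proof.
move=> h; apply: ge_sup => [|_ [t Et <-]]; last exact: h.
by have [] := has_sup_dist z (E_nonempty cE eqE) (@subset_refl _ E).
Qed.

Lemma dE_lip z w : dE E z <= dE E w + cdist z w.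
Proof.
apply: dE_le => t Et; apply: le_trans (cdist_triangle w z t) _.
by rewrite addrC lerD2r cdist_le_dE.
Qed.

Lemma measurable_dE : measurable_fun setT (dE E).
Proof.
apply: continuous_measurable2; apply: (@lipschitz_continuous _ _ 1) => z w.
by rewrite mul1r dE_lip.
Qed.

(** Otherwise [E] is the single point [z], whose potential at scale [e] is at most [ln e]; the scale
    [expR (lc - 1)] brings this below [lc], against [frostman]. *)
Lemma dE_gt0 z : 0 < dE E z.
Proof.
rewrite ltNge; apply/negP => d0.
have h t : E t -> cdist z t <= 0 by move=> /(cdist_le_dE z) /le_trans; exact.
have e0 := expR_gt0 (lc - 1).
have := frostman cE capE eqE z e0; apply/negP; rewrite -ltNge.
have : rpot (expR (lc - 1)) mu z <= ln (expR (lc - 1)).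
  apply: (rpot_le_bound muE (eq_mass eqE)) => // t Et; apply: phi_le => //.
  by rewrite gerDr h.
by rewrite expRK; lra.
Qed.

Lemma max_dist_le_dE cs z : (forall c, c \in cs -> E c) -> max_dist 0 cs z <= dE E z.
Proof.
move=> csE; apply: max_dist_le; first exact/ltW/dE_gt0.
by move=> c /csE; exact: cdist_le_dE.
Qed.

Lemma max_dist_attained cs z : (forall c, c \in cs -> E c) -> dE E z <= max_dist 0 cs z ->
  exists2 c, c \in cs & cdist z c = dE E z.
Proof.
move=> csE h; apply: contrapT => H.
have lt c : c \in cs -> cdist z c < dE E z.
  move=> cc; rewrite lt_neqAle; apply/andP; split; last by apply: cdist_le_dE; exact: csE.
  by apply/eqP => Ec; apply: H; exists c.
move: h; apply/negP; rewrite -ltNge; have := dE_gt0 z.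
move: (dE E z) lt => b lt b0; rewrite /max_dist {csE H}; elim: cs lt => [|c cs IH] lt.
  by rewrite big_nil.
rewrite big_cons gt_max lt ?mem_head//= IH// => c' c'c.
by apply: lt; rewrite inE c'c orbT.
Qed.

(* An interior point could be moved away from [z] inside [E]. *)
Lemma farthest_bdry z t : E t -> cdist z t = dE E z -> bdry E t.
Proof.
move=> Et zt; split; first exact: subset_closure.
move=> /nbhs_cdistP[r r0 hr]; have D0 := dE_gt0 z; rewrite -zt in D0.
pose l := r / (2 * cdist z t).
have l0 : 0 < l by rewrite divr_gt0// mulr_gt0.
pose t' : C := (t.1 + l * (t.1 - z.1), t.2 + l * (t.2 - z.2)).
have d1 : cdist t t' = l * cdist z t.
  rewrite /cdist /t' /= (_ : _ + _ = l ^+ 2 * ((z.1 - t.1) ^+ 2 + (z.2 - t.2) ^+ 2)); last by ring.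
  by rewrite sqrtrM ?sqr_ge0// sqrtr_sqr ger0_norm// ltW.
have l1 : 0 < 1 + l by lra.
have d2 : cdist z t' = (1 + l) * cdist z t.
  rewrite /cdist /t' /= (_ : _ + _ = (1 + l) ^+ 2 * ((z.1 - t.1) ^+ 2 + (z.2 - t.2) ^+ 2)); last by ring.
  by rewrite sqrtrM ?sqr_ge0// sqrtr_sqr ger0_norm// ltW.
have lr : l * cdist z t = r / 2 by rewrite /l; field; rewrite gt_eqF.
have /(cdist_le_dE z) : E t' by apply: hr; rewrite d1 lr; lra.
by rewrite d2 mulrDl mul1r lr zt; lra.
Qed.

Lemma elog_dE_integral : exists2 X,
  (\int[mu]_z elog (dE E z) = X%:E)%E & mu.-integrable setT (fun z => elog (dE E z)).
Proof.
have [c bc _] := argmax_bdry cE eqE muE ltr01.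
have [U lU hU] := max_dist_integral cE capE eqE c [::].
have [b b0 hb] := compact_cdist_bounded 0 cE.
have md : measurable_fun setT (fun z => elog (dE E z)) by apply: measurable_elog; exact: measurable_dE.
have up t : E t -> (elog (dE E t) <= (ln (b + b))%:E)%E.
  move=> Et; rewrite elog_gt0 ?dE_gt0// lee_fin; apply: ln_le; first exact: dE_gt0.
  apply: dE_le => s Es; have := cdist_triangle 0 t s; rewrite (cdistC t 0).
  by have := hb t Et; have := hb s Es; lra.
have hi : (\int[mu]_z elog (dE E z) <= (ln (b + b))%:E)%E.
  by rewrite -[ln (b + b)](eq_cst eqE); apply: (fin_ele muE md (bm_cst E _)).
have lo : (U%:E <= \int[mu]_z elog (dE E z))%E.
  rewrite -hU !(integral_on muE)//; last exact: measurable_elog_max_dist.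
  apply: (le_integral_on muE); [apply: measurable_funTS; exact: measurable_elog_max_dist|exact: measurable_funTS|].
  move=> t Et; apply: le_elog_mono; first exact: max_dist_ge0.
  apply: max_dist_le_dE => c'; rewrite inE => /eqP ->; exact: (bdry_closed_sub cE).
have int : mu.-integrable setT (fun z => elog (dE E z)).
  by apply: (fin_integrable_e muE md (bm_cst E _) up); exact: lt_le_trans (ltNyr _) lo.
move: lo hi int; case: (\int[mu]_z _)%E => // X _ _ int; by exists X.
Qed.

Lemma le_int_max_dist cs : (forall c, c \in cs -> E c) ->
  (\int[mu]_z elog (max_dist 0 cs z) <= \int[mu]_z elog (dE E z))%E.
Proof.
move=> csE.
have md : measurable_fun setT (fun z => elog (dE E z)) by apply: measurable_elog; exact: measurable_dE.
have mx := measurable_elog_max_dist cs.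
rewrite !(integral_on muE)//.
apply: (le_integral_on muE); [exact: measurable_funTS|exact: measurable_funTS|].
by move=> t Et; apply: le_elog_mono; [exact: max_dist_ge0|exact: max_dist_le_dE].
Qed.

Lemma CEm_le_CE m : (CEm E mu m <= CE E mu)%E.
Proof.
apply: ge_ereal_sup => _ [c [bc ->]]; apply: leeB => //.
under eq_integral do rewrite bigmax_max_dist.
by apply: le_int_max_dist => x /mapP[k _ ->]; exact: (bdry_closed_sub cE).
Qed.

Lemma CEm_eq m : (1 <= m)%N -> cardD_le E mu m -> CEm E mu m = CE E mu.
Proof.
case: m => // m _ [s [sm [_ [sE hs]]]].
apply/eqP; rewrite eq_le CEm_le_CE /=.
(* [CEm] admits boundary points only. By [farthest_bdry] the filter keeps every point of [s] that
   realises a value of [dE]. *)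
pose s' := [seq x <- s | `[< bdry E x >]].
have s'E c : c \in s' -> bdry E c by rewrite mem_filter => /andP[/asboolP].
have dom z : S z -> exists2 c, c \in s' & cdist z c = dE E z.
  move=> Sz; have [||c cs zc] := @max_dist_attained s z.
  - by move=> c cs; apply: sE.
  - rewrite (hs z Sz); have [[x xs]|ns] := pselect ([set` s] !=set0).
      apply: ge_sup; first by exists (cdist z x), x.
      by move=> _ [t ts <-]; exact: max_dist_ub.
    have -> : [set cdist z t | t in [set` s]] = set0.
      by apply/seteqP; split => // y [t ts _]; apply: ns; exists t.
    by rewrite sup0 max_dist_ge0.
  exists c => //; rewrite mem_filter cs andbT; apply/asboolP.
  by apply: farthest_bdry zc; exact: sE.
have [z0 Sz0] := msupp_nonempty cE eqE; have [x0 x0s _] := dom z0 Sz0.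
(* The default [x0], itself in [s'], pads the list to exactly [m.+1] boundary points. *)
pose c (k : 'I_m.+1) := nth x0 s' k.
have bc k : bdry E (c k).
  rewrite /c; have [ks|sk] := ltnP k (size s'); first by apply: s'E; exact: mem_nth.
  by rewrite nth_default//; exact: s'E.
have [U lU [_ hU]] := CEm_value cE capE eqE c.
have mE : measurable_fun setT (fun z => elog (dE E z)) by apply: measurable_elog; exact: measurable_dE.
have mx := measurable_elog_max_dist (points c).
suff XU : (\int[mu]_z elog (dE E z) <= U%:E)%E.
  apply: le_trans (CEm_ge cE capE eqE bc hU).
  by rewrite /CE (log_capE cE capE eqE) EFinB leeB.
rewrite -hU !(integral_on muS)//.
apply: (le_integral_on muS); [exact: measurable_funTS|exact: measurable_funTS|].
move=> z Sz; apply: le_elog_mono; first exact/ltW/dE_gt0.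
have [x xs <-] := dom z Sz; apply: max_dist_ub.
have xm : (index x s' < m.+1)%N.
  apply: leq_trans sm; apply: leq_trans (_ : _ <= size s')%N _; first by rewrite index_mem.
  by rewrite size_filter count_size.
by have := mem_points c (Ordinal xm); rewrite /c nth_index.
Qed.

(** A regularised [ln max_i |z - c_i|], Lipschitz in the points, as [dini_attained] requires; the
    floor [ln e] is already below every [phi e]. *)
Definition max_phi m e (c : 'I_m -> C) z : R := \big[Num.max/ln e]_(i < m) phi e (c i) z.

Lemma max_phi_ge m e (c : 'I_m -> C) z i : phi e (c i) z <= max_phi e c z.
Proof. exact: le_bigmax. Qed.

Lemma max_phi_ge_ln m e (c : 'I_m -> C) z : ln e <= max_phi e c z.
Proof. exact: bigmax_ge_id. Qed.

Lemma max_phi_le m e (c : 'I_m -> C) z b : ln e <= b -> (forall i, phi e (c i) z <= b) ->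
  max_phi e c z <= b.
Proof. by move=> eb h; apply/bigmax_leP; split=> // i _; exact: h. Qed.

Lemma bm_max_phi m e (c : 'I_m -> C) : 0 < e -> bm E (max_phi e c).
Proof.
move=> e0; rewrite /max_phi; elim: m c => [|m IH] c.
  rewrite (_ : (fun z => _) = cst (ln e)); first exact: bm_cst.
  by apply/funext => z; rewrite big_ord0.
rewrite (_ : (fun z => _) = fun z => Num.max (phi e (c ord0) z)
  (\big[Num.max/ln e]_(i < m) phi e (c (lift ord0 i)) z)).
  have [m1 [a ha]] := bm_phi (c ord0) cE e0; have [m2 [b hb]] := IH (fun i => c (lift ord0 i)).
  split; first exact: measurable_maxr.
  exists (Num.max a b) => z Ez; rewrite le_max; have := ha z Ez; have := hb z Ez.
  by case: (leP (phi _ _ _)) => _ h1 h2; apply/orP; [right|left].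
by apply/funext => z; rewrite big_ord_recl.
Qed.

(** In case of equality an optimal tuple exists. Its [max_dist] is continuous, at most [dE], and has
    a logarithm with the same integral, so the two agree on the support and the tuple is
    dominant. *)
Lemma CEm_lt m : (1 <= m)%N -> ~ cardD_le E mu m -> (CEm E mu m < CE E mu)%E.
Proof.
case: m => // m _ ncard; rewrite ltNge; apply/negP => leC; apply: ncard.
have [X hX iX] := elog_dE_integral.
have mE : measurable_fun setT (fun z => elog (dE E z)) by apply: measurable_elog; exact: measurable_dE.
have bcl : compact (bdry E).
  apply: (subclosed_compact _ cE (bdry_closed_sub cE)).
  by apply: closedI; [exact: closed_closure|apply: open_closedC; exact: open_interior].
have [c [bc hc]] : exists c : 'I_m.+1 -> C, (forall i, bdry E (c i)) /\
    forall k, X <= \int[mu]_z max_phi (eps k) c z.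
  apply: (@dini_attained R m.+1 (bdry E) (fun k c => \int[mu]_z max_phi (eps k) c z)
    (fun k => (eps k)^-1)) => //.
  - move=> k c c' d hd; have e0 := eps_gt0 R k.
    rewrite -[X in _ + X](eq_cst eqE) -(finD muE); [|exact: bm_max_phi|exact: bm_cst].
    apply: (fin_le muE); [exact: bm_max_phi|by apply: bmD; [exact: bm_max_phi|exact: bm_cst]|].
    move=> z _; have d0 : 0 <= d := le_trans (cdist_ge0 _ _) (hd ord0).
    have k0 : 0 <= (eps k)^-1 * d by rewrite mulr_ge0// invr_ge0 ltW.
    apply: max_phi_le; first by rewrite ler_wpDr// max_phi_ge_ln.
    move=> i; apply: le_trans (phi_lip (c' i) (c i) z e0) _.
    apply: lerD; first exact: max_phi_ge.
    by rewrite mulrC ler_pM2l ?invr_gt0// cdistC.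
  - move=> k l c kl; have k0 := eps_gt0 R k; have l0 := eps_gt0 R l; have le := le_eps R kl.
    apply: (fin_le muE); [exact: bm_max_phi|exact: bm_max_phi|] => z _.
    apply: max_phi_le; first by apply: le_trans (max_phi_ge_ln _ _ _); exact: ln_le.
    by move=> i; apply: le_trans (max_phi_ge _ _ _ i); exact: le_phi.
  move=> d n d0; have e0 := eps_gt0 R n.
  have : ((X - lc - d)%:E < CEm E mu m.+1)%E.
    apply: lt_le_trans leC; rewrite /CE hX (log_capE cE capE eqE) -EFinB lte_fin; lra.
  move=> /ereal_sup_gt[_ [c [bc ->]] hlt]; exists c; split=> //.
  have [U lU [hU _]] := CEm_value cE capE eqE c.
  move: hlt; rewrite hU (log_capE cE capE eqE) -EFinB lte_fin => hlt.
  have : (U%:E <= (\int[mu]_z max_phi (eps n) c z)%:E)%E.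
    rewrite -hU; apply: (fin_ele muE); last 2 first.
    - exact: bm_max_phi.
    - move=> z Ez; rewrite bigmax_max_dist.
      have [x0|xn] := eqVneq (max_dist 0 (points c) z) 0.
        by rewrite /elog x0 eqxx leNye.
      have x0 : 0 < max_dist 0 (points c) z by rewrite lt_def xn max_dist_ge0.
      rewrite elog_gt0// lee_fin -ler_expR lnK ?posrE//.
      apply: max_dist_le => [|x /mapP[i _ ->]]; first exact: expR_ge0.
      rewrite cdistC; apply: le_trans (cdist_le_smooth (eps n) _ _) _.
      by rewrite -[leLHS]lnK ?posrE ?smooth_dist_gt0// ler_expR max_phi_ge.
    by under eq_fun do rewrite bigmax_max_dist; exact: measurable_elog_max_dist.
  by rewrite lee_fin; lra.
pose cs := points c.
have csE x : x \in cs -> E x by move=> /mapP[k _ ->]; exact: (bdry_closed_sub cE).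
have mx := measurable_elog_max_dist cs.
have hv : (X%:E <= \int[mu]_z elog (max_dist 0 cs z))%E.
  apply: (@fin_mc _ _ _ muE _ (fun n => max_phi (eps n) c)) => //.
  - by move=> n; apply: bm_max_phi; exact: eps_gt0.
  - move=> n p t _ np; have p0 := eps_gt0 R p; have le := le_eps R np.
    apply: max_phi_le; first by apply: le_trans (max_phi_ge_ln _ _ _); exact: ln_le.
    by move=> i; apply: le_trans (max_phi_ge _ _ _ i); exact: le_phi.
  - move=> t x _ h; apply: le_elog => [|e e0]; first exact: max_dist_ge0.
    have [n ne] := eps_lt e0; have n0 := eps_gt0 R n; apply: le_trans (h n) _.
    have md0 := max_dist_ge0 cs t (lexx 0).
    apply: max_phi_le; first by apply: ln_le => //; lra.
    move=> i; apply: phi_le => //; rewrite cdistC.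
    by have := max_dist_ub 0 t (mem_points c i); rewrite -/cs; lra.
have [U lU [_ hU]] := CEm_value cE capE eqE c; rewrite -/cs in hU.
have iU := integrable_max_dist cE eqE hU.
have XU : X <= U by rewrite -lee_fin -hU.
have dom z : S z -> dE E z <= max_dist 0 cs z.
  move=> Sz; rewrite leNgt; apply/negP => gap.
  (* Both functions are 1-Lipschitz, so within distance [d] half of the gap survives, on a ball of
     positive mass; [k] is the resulting gap of logarithms. *)
  pose d := (dE E z - max_dist 0 cs z) / 4.
  have d0 : 0 < d by rewrite divr_gt0// subr_gt0.
  pose B := [set t | cdist z t < d]; have mB : measurable B by exact: measurable_cball.
  have md0 := max_dist_ge0 cs z (lexx 0).
  pose k := ln (dE E z - d) - ln (max_dist 0 cs z + d).
  have a0 : 0 < max_dist 0 cs z + d by lra.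
  have k0 : 0 < k.
    rewrite subr_gt0 ltr_ln ?posrE//; first by rewrite /d; lra.
    by rewrite /d; lra.
  have bB : mu.-integrable setT (fun t => (k * \1_B t)%:E).
    apply: (fin_integrable muE); apply: bmZ; exact: bm_indic.
  have : (\int[mu]_t (elog (max_dist 0 cs t) + (k * \1_B t)%:E) <= X%:E)%E.
    rewrite -hX !(integral_on muE)//; last first.
      by apply: emeasurable_funD => //; exact: measurable_int bB.
    apply: (le_integral_on muE); [apply: measurable_funTS|exact: measurable_funTS|].
      by apply: emeasurable_funD => //; exact: measurable_int bB.
    move=> t Et; have mt := max_dist_le_dE t csE.
    rewrite indicE; have [|_] := boolP (t \in B); last first.
      by rewrite mulr0 adde0; apply: le_elog_mono => //; exact: max_dist_ge0.
    rewrite inE /B /= mulr1 => zt.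
    have h1 : max_dist 0 cs t <= max_dist 0 cs z + d.
      apply: max_dist_le => [|x xc]; first by lra.
      by have := cdist_triangle z t x; rewrite (cdistC t z); have := max_dist_ub 0 z xc; lra.
    have h2 : dE E z - d <= dE E t by have := dE_lip z t; lra.
    have e1 : (elog (max_dist 0 cs t) <= (ln (max_dist 0 cs z + d))%:E)%E.
      by rewrite -elog_gt0//; apply: le_elog_mono => //; exact: max_dist_ge0.
    rewrite [leRHS]elog_gt0 ?dE_gt0//.
    apply: le_trans (leeD2r _ e1) _; rewrite -EFinD lee_fin /k addrC subrK.
    by apply: ln_le => //; rewrite /d; lra.
  rewrite integralD// hU (fin_EFin muE); last by apply: bmZ; exact: bm_indic.
  rewrite (finZ muE) ?(fin_indic mu mB); last exact: bm_indic.
  have b0 : 0 < fine (mu B) by rewrite fine_gt0// (Sz _ d0) (measure_lty muE).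
  have := mulr_gt0 k0 b0; rewrite -EFinD lee_fin; lra.
exists cs; split; first by rewrite size_map size_enum_ord.
split; first by apply: compact_closedC; apply: finite_compact; exact: finite_seq.
split; first by move=> x /=; exact: csE.
move=> z Sz; have [x xc zx] := max_dist_attained csE (dom z Sz).
apply/eqP; rewrite eq_le; apply/andP; split.
  rewrite -zx; apply: ub_le_sup; last by exists x.
  by exists (dE E z) => _ [t tc <-]; apply: cdist_le_dE; exact: csE.
apply: ge_sup => [|_ [t tc <-]]; first by exists (cdist z x), x.
by apply: cdist_le_dE; exact: csE.
Qed.

End DominantSets.

(** * Coding points of the plane by bits *)

Section BinaryCoding.
Variable R : realType.
Local Notation C := (R * R)%type.

(* The [i]-th bit tells on which side of the [i]-th rational horizontal or vertical line
   the point lies; long common codes force points to be close on compact sets. *)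
Definition bit (i : nat) (z : C) : bool :=
  if unpickle i is Some (b, (j, p)) then
    ((j : int)%:~R / (p : nat).+1%:R <= (if b : bool then z.1 else z.2)) else true.

Fixpoint bcode (k : nat) (z : C) : seq bool :=
  if k is k'.+1 then bit k' z :: bcode k' z else [::].

Lemma size_bcode k z : size (bcode k z) = k.
Proof. by elim: k => //= k ->. Qed.

Lemma bcode_bit k z w i : bcode k z = bcode k w -> (i < k)%N -> bit i z = bit i w.
Proof.
elim: k => // k IH /= [h1 h2]; rewrite ltnS leq_eqVlt => /orP[/eqP ->//|].
exact: IH.
Qed.

Lemma bcode_le k l z w : (k <= l)%N -> bcode l z = bcode l w -> bcode k z = bcode k w.
Proof.
elim: l => [|l IH]; first by rewrite leqn0 => /eqP ->.
rewrite leq_eqVlt => /orP[/eqP -> //|]; rewrite ltnS => kl /= [_].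
exact: IH.
Qed.

(** The last grid point not above [y] lies beyond [x]; the bound on [j] leaves finitely many lines
    to consider. *)
Lemma grid_separates (x y b : R) p (N : nat) : `|y| <= b -> b * p.+1%:R + 1 <= N%:R ->
  x + p.+1%:R^-1 <= y -> exists j : int, (`|j| <= N)%N /\
    (j%:~R / p.+1%:R <= y) && ~~ (j%:~R / p.+1%:R <= x :> R).
Proof.
move=> yb hN xy; have p0 : 0 < p.+1%:R :> R by [].
exists (Num.floor (y * p.+1%:R)).
have h1 := floor_le_tmp (y * p.+1%:R).
have h2 := floorD1_gt (y * p.+1%:R).
rewrite intrD in h2.
set j := Num.floor _ in h1 h2 *.
split.
  rewrite -(ler_nat R) natr_absz intr_norm ler_norml.
  have := ler_wpM2r (ltW p0) yb.
  have : `|y * p.+1%:R| <= b * p.+1%:R.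
    by rewrite normrM (ger0_norm (ltW p0)) ler_wpM2r// ltW.
  by rewrite ler_norml => /andP[g1 g2] _; apply/andP; split; lra.
rewrite ler_pdivrMr// h1 /= -ltNge ltr_pdivlMr//.
have := ler_wpM2r (ltW p0) xy; rewrite mulrDl mulVf ?gt_eqF//; lra.
Qed.

(** On a bounded set only finitely many lines of a given mesh can separate points, and [k] exceeds
    the index of each of them. *)
Lemma bcode_mesh (F : set C) d : compact F -> 0 < d -> exists k, forall z w, F z -> F w ->
  bcode k z = bcode k w -> cdist z w <= d.
Proof.
move=> cF d0; have [b b0 hb] := compact_cdist_bounded 0 cF.
have d2 : 0 < d / 2 by rewrite divr_gt0.
have [p hp] := eps_lt d2; rewrite /eps in hp.
have [N hN] : exists N : nat, b * p.+1%:R + 1 <= N%:R.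
  by exists (Num.truncn (b * p.+1%:R + 1)).+1; exact/ltW/truncnS_gt.
have bounded (g : bool -> int -> nat) : exists k, forall c j, (`|j| <= N)%N -> (g c j < k)%N.
  pose f (c : bool) (i : 'I_(N.*2.+1)) := g c (i%:Z - N%:Z)%R.
  exists (\sum_(c : bool) \sum_(i < N.*2.+1) (f c i).+1)%N => c j jN.
  have iN : (`|(j + N%:Z)%R| < N.*2.+1)%N by move: jN; rewrite -addnn; lia.
  have E : g c j = f c (Ordinal iN).
    by rewrite /f /= gez0_abs ?addrK//; clear -jN; lia.
  by rewrite E (bigD1 c)//= (bigD1 (Ordinal iN))//= -addnA leq_addr.
have [k hk] := bounded (fun c j => pickle (c, (j, p))).
exists k => z w Fz Fw zw.
have coord (c : bool) (u v : C) : F u -> F v -> bcode k u = bcode k v ->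
    (if c then v.1 else v.2) < (if c then u.1 else u.2) + p.+1%:R^-1.
  move=> Fu Fv uv; rewrite ltNge; apply/negP => H.
  have vb : `|if c then v.1 else v.2| <= b.
    have hv := hb v Fv; rewrite cdistC in hv; apply: le_trans hv; case: c {H}.
      by have := abs1_le_cdist v 0; rewrite /= subr0.
    by have := abs2_le_cdist v 0; rewrite /= subr0.
  have [j [jN /andP[h1 h2]]] := grid_separates vb hN H.
  have := bcode_bit uv (hk c j jN); rewrite /bit pickleK.
  by rewrite h1 (negbTE h2).
apply: le_trans (cdist_le_abs _ _) _.
have a1 := coord true z w Fz Fw zw; have a2 := coord true w z Fw Fz (esym zw).
have a3 := coord false z w Fz Fw zw; have a4 := coord false w z Fw Fz (esym zw).
rewrite /= in a1 a2 a3 a4; move: (p.+1%:R^-1) hp a1 a2 a3 a4 => q hp a1 a2 a3 a4.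
have n1 : `|z.1 - w.1| <= d / 2 by rewrite ler_norml; apply/andP; split; lra.
have n2 : `|z.2 - w.2| <= d / 2 by rewrite ler_norml; apply/andP; split; lra.
lra.
Qed.

End BinaryCoding.

(** * Limiting code frequencies and the step functions they define *)

Section LimitWeights.
Variable R : realType.
Local Notation C := (R * R)%type.
Variables (U : set_system nat) (F : set C) (z : nat -> C).
Hypotheses (UU : UltraFilter U) (Fz : forall n, F (z n)).
Local Notation bcode := (@bcode R).

(* The limiting frequencies of the codes of [z] are realised as lengths of nested
   subintervals of [0, 1), so that a weak limit of the averaged point masses is the image of
   Lebesgue measure. *)
Definition freq (n : nat) (s : seq bool) : R :=
  n.+1%:R^-1 * \sum_(i < n.+1) (bcode (size s) (z i) == s)%:R.

Lemma freq_ge0 n s : 0 <= freq n s.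
Proof. by rewrite mulr_ge0 ?invr_ge0// sumr_ge0. Qed.

Lemma freq_le1 n s : freq n s <= 1.
Proof.
rewrite ler_pdivrMl// mulr1 -[leRHS]mulr_natl mulr1.
rewrite -[X in _ <= X%:R]card_ord -sumr_const.
by apply: ler_sum => i _; case: eqP.
Qed.

Lemma freq_nil n : freq n [::] = 1.
Proof.
rewrite /freq (eq_bigr (fun=> 1))// sumr_const card_ord.
by rewrite -[1 *+ _]mulr_natl mulr1 mulVf// pnatr_eq0.
Qed.

Lemma freq_split n s : freq n s = freq n (false :: s) + freq n (true :: s).
Proof.
rewrite /freq -mulrDr -big_split /=; congr (_ * _); apply: eq_bigr => i _.
rewrite !eqseq_cons; case: (bit _ _) => /=; rewrite ?addr0 ?add0r//.
Qed.

Lemma freq_cvg s : cvg (freq ^~ s @ U).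
Proof.
have f1 n : `|freq n s| <= 1 by rewrite ger0_norm ?freq_ge0 ?freq_le1.
have [a ha] := ultra_cvgR UU f1.
apply/cvg_ex; exists a; apply/cvgrPdist_lt => e e0.
by have := ha e e0; apply: filterS => n /=; rewrite distrC.
Qed.

Definition weight (s : seq bool) : R := lim (freq ^~ s @ U).

Lemma weight_cvg s : freq ^~ s @ U --> weight s.
Proof. exact: freq_cvg. Qed.

Lemma weight_ge0 s : 0 <= weight s.
Proof.
apply: limr_ge; first exact: freq_cvg.
by apply: nearW => n; exact: freq_ge0.
Qed.

Lemma weight_nil : weight [::] = 1.
Proof.
apply/cvg_lim => //; rewrite (_ : freq ^~ [::] = cst 1); first exact: cvg_cst.
by apply/funext => n; exact: freq_nil.
Qed.

Lemma weight_split s : weight s = weight (false :: s) + weight (true :: s).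
Proof.
apply/cvg_lim => //.
rewrite (_ : freq ^~ s = freq ^~ (false :: s) \+ freq ^~ (true :: s)).
  by apply: cvgD; exact: weight_cvg.
by apply/funext => n; exact: freq_split.
Qed.

(** Words carry their latest bit first, so [cons] refines: the interval of [s] is cut into those of
    [false :: s] and [true :: s], from left to right. *)
Fixpoint start (s : seq bool) : R :=
  if s is b :: s' then start s' + (if b then weight (false :: s') else 0) else 0.

Lemma start_bounds s : 0 <= start s /\ start s + weight s <= 1.
Proof.
elim: s => [|b s [h0 h1]] /=; first by rewrite weight_nil add0r.
move: h1; rewrite (weight_split s).
have := weight_ge0 (false :: s); have := weight_ge0 (true :: s).
by case: b => /= *; split; lra.
Qed.

Definition cell (s : seq bool) : set R := `[start s, start s + weight s[%classic.

Fixpoint word (k : nat) (x : R) : seq bool :=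
  if k is k'.+1 then (start (word k' x) + weight (false :: word k' x) <= x) :: word k' x
  else [::].

Lemma size_word k x : size (word k x) = k.
Proof. by elim: k => //= k ->. Qed.

Lemma cell_word k x : 0 <= x < 1 -> cell (word k x) x.
Proof.
move=> x01; rewrite /cell /=; elim: k => [|k IH].
  by rewrite /= in_itv /= weight_nil add0r.
move: IH; rewrite /= !in_itv /= => /andP[h1 h2].
set s := word k x in h1 h2 *; rewrite weight_split in h2.
have [h|h] := leP (start s + weight (false :: s)) x.
  by rewrite h /=; lra.
by rewrite addr0 h1.
Qed.

Lemma cell_sub b s : cell (b :: s) `<=` cell s.
Proof.
move=> x; rewrite /cell /= !in_itv /= => /andP[]; rewrite (weight_split s).
have := weight_ge0 (false :: s); have := weight_ge0 (true :: s).
by case: b => /= *; apply/andP; split; lra.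
Qed.

Lemma word_cell s x : cell s x -> word (size s) x = s.
Proof.
elim: s => //= b s IH h; have := IH (cell_sub h) => ->; congr (_ :: _).
move: h; rewrite /cell /= in_itv /=; case: b => /= /andP[h1 h2].
  by rewrite h1.
by apply/negbTE; rewrite -ltNge; lra.
Qed.

Lemma cell_sub01 s x : cell s x -> 0 <= x < 1.
Proof.
elim: s => [|b s IH] h; last exact: IH (cell_sub h).
by move: h; rewrite /cell /= in_itv /= weight_nil add0r.
Qed.

(** The default matters only for codes that never occur; these have weight 0 and an empty cell. *)
Definition rep (s : seq bool) : C :=
  xget (z 0%N) [set y | exists i, y = z i /\ bcode (size s) y = s].

Lemma rep_in s : F (rep s).
Proof.
by rewrite /rep; case: xgetP => [y _ [i [-> _]]|_]; exact: Fz.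
Qed.

Lemma rep_bcode i k : bcode k (rep (bcode k (z i))) = bcode k (z i).
Proof.
rewrite /rep size_bcode; case: xgetP => [y _ [j []]//|/(_ (z i))[]].
by exists i.
Qed.

Lemma rep_word k x : 0 <= x < 1 -> bcode k (rep (word k x)) = word k x.
Proof.
move=> x01; have := cell_word k x01; set s := word k x => sx.
have [i hi] : exists i, bcode (size s) (z i) = s.
  apply: contrapT => H; have w0 : weight s = 0.
    apply/cvg_lim => //; rewrite (_ : freq ^~ s = cst 0); first exact: cvg_cst.
    apply/funext => n; rewrite /freq big1 ?mulr0// => i _.
    by case: eqP => // h; case: H; exists i.
  by move: sx; rewrite /cell /= in_itv /= w0 addr0; lra.
have sk : size s = k by rewrite size_word.
by rewrite -hi sk rep_bcode.
Qed.

(** As [k] grows these simple functions approach the map that transports Lebesgue measure on the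
    unit interval to the weak limit. *)
Definition step (k : nat) (x : R) : C := if 0 <= x < 1 then rep (word k x) else z 0%N.

Lemma step_in k x : F (step k x).
Proof. by rewrite /step; case: ifP => _; [exact: rep_in|exact: Fz]. Qed.

Lemma drop_word k l x : (k <= l)%N -> drop (l - k) (word l x) = word k x.
Proof.
elim: l => [|l IH]; first by rewrite leqn0 => /eqP ->.
rewrite leq_eqVlt => /orP[/eqP ->|]; first by rewrite subnn drop0.
by rewrite ltnS => kl; rewrite subSn//= IH.
Qed.

Lemma drop_bcode k l y : (k <= l)%N -> drop (l - k) (bcode l y) = bcode k y.
Proof.
elim: l => [|l IH]; first by rewrite leqn0 => /eqP ->.
rewrite leq_eqVlt => /orP[/eqP ->|]; first by rewrite subnn drop0.
by rewrite ltnS => kl; rewrite subSn//= IH.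
Qed.

Lemma bcode_step k l x : (k <= l)%N -> bcode k (step l x) = bcode k (step k x).
Proof.
move=> kl; rewrite /step; case: ifPn => // x01.
by rewrite rep_word// -(drop_bcode _ kl) rep_word// drop_word.
Qed.

Fixpoint words (k : nat) : seq (seq bool) :=
  if k is k'.+1 then [seq false :: s | s <- words k'] ++ [seq true :: s | s <- words k'] else [:: [::]].

Lemma size_words k s : s \in words k -> size s = k.
Proof.
elim: k s => [|k IH] s /=; first by rewrite inE => /eqP ->.
by rewrite mem_cat => /orP[] /mapP[t /IH <- ->].
Qed.

Lemma mem_words s : s \in words (size s).
Proof.
elim: s => //= b s IH; rewrite mem_cat; case: b; apply/orP; [right|left]; exact: map_f.
Qed.

Lemma uniq_words k : uniq (words k).
Proof.
elim: k => //= k IH; rewrite cat_uniq !map_inj_uniq ?IH ?andbT//=; last 2 first.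
- by move=> s t [].
- by move=> s t [].
by apply/hasPn => _ /mapP[s _ ->]; apply/negP => /mapP[t _].
Qed.

Lemma sum_words k (g : seq bool -> R) s0 : size s0 = k ->
  \sum_(s <- words k) g s * (s0 == s)%:R = g s0.
Proof.
move=> sz; have m0 : s0 \in words k by rewrite -sz mem_words.
rewrite (bigD1_seq s0) ?uniq_words//= eqxx mulr1 big1 ?addr0// => s.
by rewrite eq_sym => /negbTE ->; rewrite mulr0.
Qed.

Lemma sum_freq k (g : seq bool -> R) n :
  \sum_(s <- words k) g s * freq n s = n.+1%:R^-1 * \sum_(i < n.+1) g (bcode k (z i)).
Proof.
rewrite mulr_sumr.
under eq_big_seq => s /size_words sk.
  rewrite /freq sk mulrCA mulr_sumr mulr_sumr.
  over.
rewrite exchange_big /=; apply: eq_bigr => i _.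
rewrite -mulr_sumr; congr (_ * _); exact: sum_words (size_bcode _ _).
Qed.

Lemma step_sum k (f : C -> R) x : f (step k x) =
  \sum_(s <- words k) f (rep s) * \1_(cell s) x + f (z 0%N) * \1_(~` `[0, 1[%classic) x.
Proof.
rewrite /step; case: ifPn => x01.
  rewrite [\1_(~` _) _]indicE memNset ?mulr0 ?addr0; last by rewrite /= in_itv /= x01.
  rewrite -(@sum_words k (fun s => f (rep s)) _ (size_word k x)).
  apply: eq_big_seq => s /size_words sk; congr (_ * _); rewrite indicE; congr (_%:R).
  congr nat_of_bool; apply/eqP/idP => [<-|]; first by rewrite inE; exact: cell_word.
  by rewrite inE => /word_cell; rewrite sk.
rewrite [\1_(~` _) _]indicE mem_set ?mulr1; last by rewrite /= in_itv /=; exact/negP.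
rewrite big1_seq ?add0r// => s _; rewrite indicE memNset ?mulr0// => /cell_sub01.
exact/negP.
Qed.

End LimitWeights.

(** * Lebesgue measure on the unit interval *)

Section UnitInterval.
Variable R : realType.
Local Notation T0 := (measurableTypeR R).

Lemma measurable_unit_itv : measurable (`[0, 1[%classic : set T0).
Proof. exact: measurable_itv. Qed.

Definition unit_leb : {measure set T0 -> \bar R} :=
  [the {measure set T0 -> \bar R} of mrestr (@lebesgue_measure R) measurable_unit_itv].

Lemma unit_lebE (A : set T0) : unit_leb A = lebesgue_measure (A `&` `[0, 1[%classic).
Proof. by []. Qed.

Lemma unit_leb_itv (a b : R) : 0 <= a -> a <= b -> b <= 1 ->
  unit_leb (`[a, b[%classic : set T0) = (b - a)%:E.
Proof.
move=> a0 ab b1; rewrite unit_lebE (_ : _ `&` _ = `[a, b[%classic).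
  have := lebesgue_measure_itv `[a, b[; rewrite /= lte_fin => ->.
  by case: ltP => // ba; rewrite (le_anti (introT andP (conj ab ba))) subrr.
apply/seteqP; split=> x /=; first by case.
by rewrite !in_itv /= => /andP[h1 h2]; split; apply/andP; split => //; lra.
Qed.

Lemma unit_lebT : unit_leb setT = 1%E.
Proof.
have := @unit_leb_itv 0 1 (lexx _) ler01 (lexx _); rewrite subr0 => <-.
by rewrite !unit_lebE setTI setIid.
Qed.

Lemma unit_leb_out : unit_leb (~` `[0, 1[%classic) = 0%E.
Proof. by rewrite unit_lebE setICl measure0. Qed.

Definition bmu (g : T0 -> R) : Prop :=
  measurable_fun setT g /\ exists b, forall x, `|g x| <= b.

Lemma bmu_integrable g : bmu g -> unit_leb.-integrable setT (EFin \o g).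
Proof.
move=> [mg [b hb]]; apply: measurable_bounded_integrable => //.
  by rewrite unit_lebT ltry.
exists b; split; first exact: num_real.
by move=> x bx t _ /=; rewrite (le_trans (hb t))// ltW.
Qed.

Lemma bmuD f g : bmu f -> bmu g -> bmu (fun x => f x + g x).
Proof.
move=> [mf [a ha]] [mg [b hb]]; split; first exact: measurable_funD.
by exists (a + b) => x; rewrite (le_trans (ler_normD _ _))// lerD.
Qed.

Lemma bmu_indicZ (A : set T0) c : measurable A -> bmu (fun x => c * \1_A x).
Proof.
move=> mA; split; first by apply: measurable_funM => //; exact: measurable_indic.
exists `|c| => x; rewrite normrM ler_piMr//.
by rewrite indicE; case: (_ \in _); rewrite ?normr1 ?normr0.
Qed.

Lemma int_indicZ (A : set T0) c : measurable A ->
  \int[unit_leb]_x (c * \1_A x) = c * fine (unit_leb A).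
Proof.
move=> mA; rewrite RintegralZl//; first by rewrite /Rintegral integral_indic// setIT.
by have := bmu_integrable (bmu_indicZ 1 mA); under eq_fun do rewrite mul1r.
Qed.

End UnitInterval.

(** * Weak limits of averaged point masses *)

Section LimitMeasure.
Variable R : realType.
Local Notation C := (R * R)%type.
Local Notation T0 := (measurableTypeR R).

Lemma filter_all_seq (T : eqType) (U : set_system nat) (s : seq T) (P : T -> set nat) :
  Filter U -> (forall x, U (P x)) -> U [set n | forall x, x \in s -> P x n].
Proof.
move=> UF h; elim: s => [|x s IH].
  by apply: (@filterS _ U _ setT) => //; exact: filterT.
apply: filterS (filterI (h x) IH) => n [hx hs] y; rewrite inE => /orP[/eqP ->//|].
exact: hs.
Qed.

(** A one-sided weak convergence with a uniform quantifier: a single [n] serves all functions with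
    Lipschitz constant [k] and bound [B]. The double limit of an energy needs this for all kernels
    [phi e w] with [w] in [F] at once. *)
Lemma limit_measure (F : set C) (z : nat -> C) : compact F -> (forall n, F (z n)) ->
  exists tau : cmeasure R, [/\ fin_on tau F, mass tau = 1 &
    forall (k B e : R) (N0 : nat), 0 <= k -> 0 <= B -> 0 < e -> exists n, (N0 <= n)%N /\
    forall f : C -> R, (forall y w, f y <= f w + k * cdist y w) ->
      (forall t, F t -> `|f t| <= B) ->
      n.+1%:R^-1 * (\sum_(i < n.+1) f (z i)) - e <= \int[tau]_t f t].
Proof.
move=> cF Fz; have [U [UU Uge]] := exists_ultrafilter.
have /choice[X hX] (x : T0) : exists a, F a /\ forall e : R, 0 < e ->
    U [set k | cdist (step U z k x) a < e].
  have [a Fa ha] := ultra_cvg UU cF (fun k => step_in U Fz k x).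
  by exists a.
have FX x : F (X x) by case: (hX x).
(* From level [k] on the values share their code of length [k], so [bcode_mesh] upgrades the
   pointwise ultralimit to uniform convergence. *)
have cvgX d : 0 < d -> exists k, forall l x, (k <= l)%N -> cdist (step U z l x) (X x) <= d.
  move=> d0; have d2 : 0 < d / 2 by rewrite divr_gt0.
  have [k hk] := bcode_mesh cF d2; exists k => l x kl.
  have [p [/= hp kp]] := filter_ex (filterI ((hX x).2 _ d2) (Uge k)).
  have := hk _ _ (step_in U Fz l x) (step_in U Fz p x); rewrite !bcode_step// => /(_ erefl).
  have := cdist_triangle (step U z p x) (step U z l x) (X x); lra.
have mcell s : measurable (cell U z s : set T0) by exact: measurable_itv.
have bstep (f : C -> R) k : bmu (fun x : T0 => f (step U z k x)).
  rewrite (_ : (fun x => _) = (fun x : T0 => \sum_(s <- words k) f (rep z s) * \1_(cell U z s) x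
     + f (z 0%N) * \1_(~` `[0, 1[%classic) x)); last first.
    by apply/funext => x; exact: step_sum.
  apply: bmuD; last by apply: bmu_indicZ; apply: measurableC; exact: measurable_itv.
  elim: (words k) => [|s ss IH].
    rewrite (_ : (fun x => _) = cst 0); first by split=> //; exists 0 => x; rewrite normr0.
    by apply/funext => x; rewrite big_nil.
  rewrite (_ : (fun x => _) = fun x : T0 => f (rep z s) * \1_(cell U z s) x +
    \sum_(s <- ss) f (rep z s) * \1_(cell U z s) x); last by apply/funext => x; rewrite big_cons.
  by apply: bmuD => //; exact: bmu_indicZ.
have unit_leb_cell s : fine (unit_leb R (cell U z s)) = weight U z s.
  have w0 := weight_ge0 z UU s.
  have [s0 s1] := start_bounds z UU s.
  by rewrite /cell unit_leb_itv ?lerDl// addrC addKr.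
have mX : measurable_fun [set: T0] X.
  have cv (g : C -> R) : (forall y w, `|g y - g w| <= cdist y w) ->
      forall x : T0, g (step U z k x) @[k --> \oo] --> g (X x).
    move=> hg x; apply/cvgrPdist_le => d d0; have [k hk] := cvgX d d0.
    exists k => // l kl /=; apply: le_trans (hg _ _) _; rewrite cdistC; exact: hk.
  apply/measurable_fun_pairP; split.
    apply: (measurable_fun_cvg (h := fun k (x : T0) => (step U z k x).1)).
      by move=> k; case: (bstep fst k).
    by move=> x _; apply: (cv fst) => y w; exact: abs1_le_cdist.
  apply: (measurable_fun_cvg (h := fun k (x : T0) => (step U z k x).2)).
    by move=> k; case: (bstep snd k).
  by move=> x _; apply: (cv snd) => y w; exact: abs2_le_cdist.
pose tau : cmeasure R :=
  measure_function_pushforward__canonical__measure_function_Measure (unit_leb R) mX.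
have tauT : tau setT = 1%E by rewrite /tau /= /pushforward preimage_setT unit_lebT.
have tauF : fin_on tau F.
  split=> //; last by rewrite tauT ltry.
  rewrite /tau /= /pushforward (_ : X @^-1` _ = set0) ?measure0//.
  by apply/seteqP; split => // x; apply; exact: FX.
exists tau; split=> //; first by rewrite /mass tauT.
move=> k B e N0 k0 B0 e0.
(* Three errors of at most [e / 3] follow: [X] against its step function ([d]), weights against
   frequencies ([h] below), and each [z i] against the representative of its code ([d] again). *)
pose d := e / (3 * (k + 1)).
have d0 : 0 < d by rewrite divr_gt0// mulr_gt0//; lra.
have kd : k * d <= e / 3.
  rewrite /d mulrA ler_pdivrMr; last by rewrite mulr_gt0//; lra.
  have -> : e / 3 * (3 * (k + 1)) = (k + 1) * e by field.
  by rewrite ler_pM2r//; lra.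
have [k1 hk1] := cvgX d d0; have [k2 hk2] := bcode_mesh cF d0.
pose m := maxn k1 k2.
pose W := (size (words m))%:R : R.
pose h := e / (3 * (B + 1) * (W + 1)).
have W0 : 0 <= W by exact: ler0n.
have h0 : 0 < h by rewrite divr_gt0// !mulr_gt0//; lra.
have BWh : B * (W * h) <= e / 3.
  apply: (@le_trans _ _ ((B + 1) * ((W + 1) * h))).
    apply: ler_pM => //; [by rewrite mulr_ge0// ltW|by lra|].
    by apply: ler_pM => //; [exact: ltW|lra].
  rewrite /h le_eqVlt; apply/orP; left; apply/eqP; field.
  by apply/andP; split; rewrite gt_eqF//; lra.
have U1 : U [set n | forall s, s \in words m -> `|weight U z s - freq z n s| < h].
  apply: filter_all_seq => s.
  have := @weight_cvg _ U z UU s; move/cvgrPdist_lt => /(_ h h0); exact.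
have [n [/= hn N0n]] := filter_ex (filterI U1 (Uge N0)).
exists n; split=> // f lip fB.
have mf : measurable_fun setT f.
  by apply: continuous_measurable2; exact: lipschitz_continuous lip.
have bf : bm F f by split=> //; exists B.
have bfX : bmu (f \o X).
  split; first exact: measurableT_comp.
  by exists B => x; exact: fB.
have E1 : \int[tau]_t f t = \int[unit_leb R]_x f (X x).
  rewrite /Rintegral /tau /=; congr fine.
  rewrite (@integral_pushforward _ _ _ _ _ _ mX _ setT (EFin \o f)) ?preimage_setT//.
    exact/measurable_EFinP.
  exact: (bmu_integrable bfX).
have E2 : \int[unit_leb R]_x f (step U z m x) = \sum_(s <- words m) f (rep z s) * weight U z s.
  rewrite (@eq_Rintegral _ _ _ _ _ (fun x : T0 => \sum_(s <- words m) f (rep z s) * \1_(cell U z s) x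
     + f (z 0%N) * \1_(~` `[0, 1[%classic) x)); last by move=> x _; exact: step_sum.
  have bsum ss : bmu (fun x : T0 => \sum_(s <- ss) f (rep z s) * \1_(cell U z s) x).
    elim: ss => [|s ss IH].
      rewrite (_ : (fun x => _) = cst 0); first by split=> //; exists 0 => x; rewrite normr0.
      by apply/funext => x; rewrite big_nil.
    rewrite (_ : (fun x => _) = fun x : T0 => f (rep z s) * \1_(cell U z s) x +
      \sum_(s <- ss) f (rep z s) * \1_(cell U z s) x); last by apply/funext => x; rewrite big_cons.
    by apply: bmuD => //; exact: bmu_indicZ.
  have mout : measurable (~` `[0, 1[%classic : set T0) by apply: measurableC; exact: measurable_itv.
  rewrite RintegralD//; [|exact: bmu_integrable|by apply: bmu_integrable; exact: bmu_indicZ].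
  rewrite int_indicZ// unit_leb_out mulr0 addr0.
  elim: (words m) => [|s ss IH].
    rewrite big_nil -[RHS](mul0r (fine (unit_leb R setT))) -Rintegral_cst//.
    by apply: eq_Rintegral => x _; rewrite big_nil.
  rewrite big_cons -IH -(@unit_leb_cell s).
  rewrite -int_indicZ// -RintegralD//; [|by apply: bmu_integrable; exact: bmu_indicZ|exact: bmu_integrable].
  by apply: eq_Rintegral => x _; rewrite big_cons.
have E3 := sum_freq z m (fun s => f (rep z s)) n.
rewrite E1.
have s1 : \int[unit_leb R]_x f (step U z m x) - k * d <= \int[unit_leb R]_x f (X x).
  have cstE (c : R) : \int[unit_leb R]_x c = c by rewrite Rintegral_cst// unit_lebT mulr1.
  have bc : bmu (fun _ : T0 => k * d) by split=> //; exists `|k * d|.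
  rewrite -[X in _ - X]cstE -RintegralB//; [|exact: bmu_integrable (bstep f m)|exact: bmu_integrable].
  apply: le_Rintegral => //; [|exact: bmu_integrable bfX|].
    have bc' : bmu (fun _ : T0 => - (k * d)) by split=> //; exists `|- (k * d)|.
    exact: bmu_integrable (bmuD (bstep f m) bc').
  move=> x _ /=; have := lip (step U z m x) (X x).
  have := hk1 m x (leq_maxl _ _) => hs.
  have := ler_wpM2l k0 hs; lra.
have s2 : \sum_(s <- words m) f (rep z s) * freq z n s - B * (W * h) <=
    \sum_(s <- words m) f (rep z s) * weight U z s.
  rewrite lerBlDr -lerBlDl -sumrB.
  have -> : B * (W * h) = \sum_(s <- words m) B * h.
    by rewrite big_const_seq count_predT iter_addr addr0 -[RHS]mulr_natl /W; ring.
  rewrite big_seq [leRHS]big_seq; apply: ler_sum => s sm; rewrite -mulrBr; apply: le_trans (ler_norm _) _.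
  rewrite normrM; apply: ler_pM => //; first by apply: fB; exact: rep_in.
  by rewrite distrC ltW// hn.
have s3 : n.+1%:R^-1 * (\sum_(i < n.+1) f (z i)) - k * d <=
    n.+1%:R^-1 * \sum_(i < n.+1) f (rep z (bcode m (z i))).
  have n0 : 0 < n.+1%:R :> R by rewrite ltr0n.
  have -> : k * d = n.+1%:R^-1 * \sum_(i < n.+1) k * d.
    by rewrite sumr_const card_ord -(mulr_natl (k * d)) mulKf// gt_eqF.
  rewrite -mulrBr -sumrB ler_pM2l ?invr_gt0//; apply: ler_sum => i _.
  rewrite lerBlDr; apply: le_trans (lip (z i) (rep z (bcode m (z i)))) _.
  rewrite lerD2l; apply: ler_wpM2l => //.
  apply: hk2 => //; first exact: rep_in.
  by apply: (@bcode_le _ _ m); [exact: leq_maxr|rewrite rep_bcode].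
rewrite E2 in s1; rewrite E3 in s2.
apply: le_trans (le_trans (lerD s2 (lexx (- (k * d)))) s1).
move: s3 BWh kd; move: (B * _) (k * d) (n.+1%:R^-1 * \sum_(i < n.+1) f (z i)).
move: (n.+1%:R^-1 * \sum_(i < n.+1) f (rep z (bcode m (z i)))) => a1 a3 a4 a5 h1 h2 h3.
lra.
Qed.

End LimitMeasure.

(** * A measure with low potential on a polar set *)

Section Evans.
Variable R : realType.
Local Notation C := (R * R)%type.
Local Notation eps := (@eps R).
Variable F : set C.
Hypothesis cF : compact F.

Lemma sum_dirac (s : seq C) : (forall w, w \in s -> F w) ->
  exists nu : cmeasure R, fin_on nu F /\ forall f, bm F f -> \int[nu]_t f t = \sum_(w <- s) f w.
Proof.
elim: s => [_|a s IH Fs].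
  exists (mzero_c R); split; first by split=> //=; exact: ltry.
  by move=> f _; rewrite big_nil /Rintegral integral_measure_zero.
have [|nu [nuF hnu]] := IH; first by move=> w ws; apply: Fs; rewrite inE ws orbT.
have Fa : F a by apply: Fs; rewrite inE eqxx.
have dF : fin_on [the cmeasure R of dirac a] F.
  split=> //=; first by rewrite diracE memNset//; apply.
  by rewrite diracE in_setT ltry.
exists (madd [the cmeasure R of dirac a] nu); split; first exact: fin_on_madd.
move=> f bf; rewrite (int_madd dF nuF bf) hnu// big_cons; congr (_ + _).
rewrite /Rintegral integral_dirac//; first by rewrite diracT mul1e.
by case: bf => mf _; exact/measurable_EFinP.
Qed.

(** The [n]-th point adds twice its sum over its predecessors, at least [- 2 L n], and one diagonal
    term; adding these up gives the square. *)
Lemma double_sum_ge (a : nat -> nat -> R) (L D : R) : 0 <= L ->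
  (forall i j, a i j = a j i) -> (forall n, - D <= a n n) ->
  (forall n, - L * n%:R <= \sum_(i < n) a n i) ->
  forall n, - L * n%:R ^+ 2 - D * n%:R <= \sum_(j < n) \sum_(i < n) a j i.
Proof.
move=> L0 aC aD aL; elim=> [|n IH]; first by rewrite big_ord0 expr0n /= !mulr0 subr0.
rewrite big_ord_recr /=; under eq_bigr do rewrite big_ord_recr /=.
have -> : \sum_(j < n) (\sum_(i < n) a j i + a j n) =
    \sum_(j < n) \sum_(i < n) a j i + \sum_(i < n) a n i.
  by rewrite big_split; congr (_ + _); apply: eq_bigr => i _.
rewrite big_ord_recr /= -natr1; move: IH (aL n) (aD n).
move: (\sum_(j < n) \sum_(i < n) a j i) (\sum_(i < n) a n i) (a n n) (n%:R : R) (ler0n R n).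
by move=> x y w m m0 h1 h2 h3; nra.
Qed.

Lemma phi_bounded e : 0 < e -> exists2 B : R, 0 <= B & forall z t, F z -> F t -> `|phi e z t| <= B.
Proof.
move=> e0; have [b b0 hb] := compact_cdist_bounded 0 cF.
exists (`|ln e| + `|ln (b + b + e)|); first exact: addr_ge0.
move=> z t Fz Ft; have h1 := phi_ge z t e0.
have h2 : phi e z t <= ln (b + b + e).
  apply: phi_le => //; rewrite lerD2r; apply: le_trans (cdist_triangle 0 _ _) _.
  by rewrite cdistC lerD ?hb.
rewrite ler_norml; have := ler_norm (- ln e); have := ler_norm (ln (b + b + e)).
have := normr_ge0 (ln e); have := normr_ge0 (ln (b + b + e)); rewrite normrN.
by move=> *; apply/andP; split; lra.
Qed.

(* Greedy choice: each new point has a high potential with respect to the previous ones, so a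
   weak limit of the averaged point masses has finite energy. *)
Lemma evans_weak : F !=set0 ->
  (forall (s : cmeasure R) (b : R), fin_on s F -> mass s = 1 ->
     ~ forall n, b <= \int[s]_z rpot (eps n) s z) ->
  forall L : R, exists tau : cmeasure R, [/\ fin_on tau F, mass tau = 1 &
    forall z, F z -> exists n, rpot (eps n) tau z < - L].
Proof.
move=> [x0 Fx0] polar L0; apply: contrapT => NH; pose L := `|L0|.
have L_ge0 : 0 <= L by exact: normr_ge0.
have /choice[g hg] (s : seq C) : exists z, (forall w, w \in s -> F w) ->
    F z /\ forall n, - L * (size s)%:R <= \sum_(w <- s) phi (eps n) z w.
  have [Fs|] := pselect (forall w, w \in s -> F w); last by exists x0.
  have [->|s0] := eqVneq s [::].
    by exists x0 => _; split=> // n; rewrite big_nil mulr0.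
  have ss : 0 < (size s)%:R :> R by rewrite ltr0n lt0n size_eq0.
  have [nu [nuF hnu]] := sum_dirac Fs.
  have a0 : 0 <= (size s)%:R^-1 :> R by rewrite invr_ge0.
  pose tau := mscaled (NngNum a0) nu.
  have tauF : fin_on tau F by exact: fin_on_mscaled.
  have tauE f : bm F f -> \int[tau]_t f t = (size s)%:R^-1 * \sum_(w <- s) f w.
    by move=> bf; rewrite (int_mscaled _ nuF bf) hnu.
  (* If no such point existed, the averaged point masses of [s] would already be the measure sought,
     against [NH]. *)
  have [z [Fz hz]] : exists z, F z /\ forall n, - L <= rpot (eps n) tau z.
    apply: contrapT => NE; apply: NH; exists tau; split=> //.
      rewrite -[LHS]mul1r -fin_cst tauE; last exact: bm_cst.
      by rewrite big_const_seq count_predT iter_addr addr0 -[1 *+ _]mulr_natl mulr1 mulVf// gt_eqF.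
    move=> z Fz; apply: contrapT => NE'; apply: NE; exists z; split=> // n.
    rewrite leNgt; apply/negP => h; apply: NE'; exists n; apply: lt_le_trans h _.
    by rewrite lerN2 ler_norm.
  exists z => _; split=> // n; have := hz n; rewrite /rpot tauE; last exact: bm_phi (eps_gt0 _ _).
  by rewrite ler_pdivlMl// mulrC.
pose sq := fix sq n := if n is n'.+1 then rcons (sq n') (g (sq n')) else [::].
pose z n := g (sq n).
have sqE n : sq n = [seq z i | i <- iota 0 n].
  by elim: n => // n IH; rewrite -addn1 iotaD map_cat add0n /= -IH cats1 addn1.
have Fsq n w : w \in sq n -> F w.
  elim: n w => // n IH w; rewrite /= mem_rcons inE => /orP[/eqP ->|]; last exact: IH.
  by have [] := hg (sq n) (IH).
have Fz n : F (z n) by have [] := hg (sq n) (@Fsq n).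
have hz n k : - L * n%:R <= \sum_(i < n) phi (eps k) (z n) (z i).
  have [_ /(_ k)] := hg (sq n) (@Fsq n); rewrite -/(z n) sqE size_map size_iota big_map.
  by rewrite -[X in iota 0 X]subn0 -/(index_iota 0 n) big_mkord.
have [tau [tauF tau1 htau]] := limit_measure cF Fz.
(* The greedy choice gives [- L]; the diagonal costs 1, and so does each of the two passages from
   averages to [tau]. *)
apply: (polar tau (- L - 3) tauF tau1) => k; have e0 := eps_gt0 R k; set e := eps k in e0 *.
have [B B0 hB] := phi_bounded e0.
(* At least [|ln e|] points are taken, so that the diagonal terms, each at least [ln e], contribute
   at most 1 after division by the squared number of points. *)
have [N0 _ hN0] := le_div_nat `|ln e| ltr01; rewrite mulr1 in hN0.
have ie0 : 0 <= e^-1 by rewrite invr_ge0 ltW.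
have [n [Nn hn]] := htau e^-1 B 1 N0 ie0 B0 ltr01.
set N : R := n.+1%:R in hn; have N_gt0 : 0 < N by rewrite ltr0n.
have pB w : F w -> `|rpot e tau w| <= B.
  have cstE (x : R) : \int[tau]_t x = x by rewrite fin_cst tau1 mulr1.
  move=> Fw; rewrite ler_norml; apply/andP; split.
    rewrite -[leLHS]cstE; apply: (fin_le tauF) => [||t Ft]; [exact: bm_cst|exact: bm_phi|].
    by have := hB w t Fw Ft; rewrite ler_norml => /andP[].
  rewrite -[leRHS]cstE; apply: (fin_le tauF) => [||t Ft]; [exact: bm_phi|exact: bm_cst|].
  by have := hB w t Fw Ft; rewrite ler_norml => /andP[].
have h1 w : F w -> N^-1 * \sum_(i < n.+1) phi e w (z i) - 1 <= rpot e tau w.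
  move=> Fw; apply: hn => [y v|t Ft]; last exact: hB.
  by rewrite phiC (phiC _ _ v) mulrC; exact: phi_lip.
have h2 : N^-1 * \sum_(j < n.+1) rpot e tau (z j) - 1 <= \int[tau]_z rpot e tau z.
  apply: hn => // y v; have := rpot_lip tauF y v e0; by rewrite tau1 mul1r.
have h3 : N^-1 * \sum_(j < n.+1) (N^-1 * \sum_(i < n.+1) phi e (z j) (z i) - 1) <=
    N^-1 * \sum_(j < n.+1) rpot e tau (z j).
  by rewrite ler_pM2l ?invr_gt0//; apply: ler_sum => j _; exact: h1.
have h4 := double_sum_ge L_ge0 (fun i j => phiC e (z i) (z j)) (D := `|ln e|) _ (fun n => hz n k).
have {}h4 := h4 _ n.+1.
have {}h4 : - L * N ^+ 2 - `|ln e| * N <= \sum_(j < n.+1) \sum_(i < n.+1) phi e (z j) (z i).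
  apply: h4 => i; apply: le_trans (phi_ge _ _ e0); rewrite lerNl; apply: le_trans (ler_norm _) _.
  by rewrite normrN.
have nN : `|ln e| <= N.
  by apply: le_trans hN0 _; rewrite ler_nat; exact: leqW.
rewrite sumrB -mulr_sumr sumr_const card_ord -/N mulrBr mulVf ?gt_eqF// in h3.
have h5 : - L - 1 <= N^-1 * (N^-1 * \sum_(j < n.+1) \sum_(i < n.+1) phi e (z j) (z i)).
  rewrite mulrA -invfM ler_pdivlMl ?mulr_gt0//; apply: le_trans h4.
  by have := ler_wpM2r (ltW N_gt0) nN; move: (`|ln e| * N) => x hx; rewrite expr2; lra.
move: h2 h3 h5; move: (N^-1 * _) (N^-1 * _) (\int[tau]_z _) => a1 a2 a3 *.
lra.
Qed.

End Evans.

(** * Sharpness of the constant *)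

Section Sharpness.
Variable R : realType.
Local Notation C := (R * R)%type.
Implicit Types (z t w : C) (e r : R).
Local Notation eps := (@eps R).

Lemma sum_indic_disjoint m (S : 'I_m -> set C) z k :
  S k z -> (forall j, S j z -> j = k) -> \sum_(j < m) \1_(S j) z = 1 :> R.
Proof.
move=> Sk h; rewrite (bigD1 k)//= indicE mem_set// big1 ?addr0// => j jk.
by rewrite indicE memNset// => /h e; rewrite e eqxx in jk.
Qed.

(** Ties go to the smallest index, so that the restrictions of a measure to the pieces add up to
    it. *)
Lemma disjoint_refinement m (A : 'I_m -> set C) : (forall k, measurable (A k)) ->
  (forall z, exists k, A k z) ->
  exists S : 'I_m -> set C, [/\ forall k, measurable (S k), forall k, S k `<=` A k &
    forall z, \sum_(k < m) \1_(S k) z = 1 :> R].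
Proof.
move=> mA cov; exists (fun k => A k `&` \bigcap_(j in [set j : 'I_m | (j < k)%N]) ~` A j); split.
- move=> k; apply: measurableI => //; apply: fin_bigcap_measurable => [|j _].
    exact: sub_finite_set (@subsetT _ _) (@finite_finset _ setT).
  exact: measurableC.
- by move=> k z [].
move=> z; have [k0 hk0] := cov z.
have [k /asboolP Ak hk] : {k : 'I_m | `[< A k z >] & forall j, `[< A j z >] -> (k <= j)%N}.
  case: (@arg_minnP _ k0 (fun k => `[< A k z >]) (fun k : 'I_m => k : nat)); first exact/asboolP.
  by move=> k Ak hk; exists k.
have lt (j : 'I_m) : (j < k)%N -> ~ A j z.
  by move=> jk Aj; move: jk; rewrite ltnNge hk//; exact/asboolP.
apply: (@sum_indic_disjoint _ _ _ k); first by split.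
move=> j [Aj nj]; apply/val_inj/eqP; rewrite eqn_leq; apply/andP; split.
  by rewrite leqNgt; apply/negP => /nj.
by rewrite leqNgt; apply/negP => /lt.
Qed.

Lemma sum_int_partition m (nu : cmeasure R) K (S : 'I_m -> set C) f : fin_on nu K ->
  (forall k, measurable (S k)) -> (forall z, \sum_(k < m) \1_(S k) z = 1 :> R) -> bm K f ->
  \sum_(k < m) \int[nu]_t (f t * \1_(S k) t) = \int[nu]_t f t.
Proof.
move=> nuK mS S1 bf; rewrite -(fin_sum nuK) => [|k]; last exact: bm_restr.
by apply: eq_Rintegral => t _; rewrite -mulr_sumr S1 mulr1.
Qed.

Variables (E : set C) (mu : cmeasure R).
Hypotheses (cE : compact E) (capE : (-oo < log_cap E)%E) (eqE : is_equilibrium E mu).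
Local Notation lc := (lc E).
Let muE : fin_on mu E. Proof. exact: eq_fin. Qed.
Let mass1 : mass mu = 1. Proof. exact: (eq_mass eqE). Qed.

Lemma bdry_other (a : C) : exists2 b, bdry E b & b != a.
Proof.
have lip z w : cdist a z <= cdist a w + 1 * cdist z w.
  by rewrite mul1r (cdistC z w); exact: cdist_triangle.
have [b Eb hb] := attains_max cE (E_nonempty cE eqE) lip.
have ab : cdist a b = dE E a.
  apply/eqP; rewrite eq_le (cdist_le_dE cE eqE)//=; exact: (dE_le cE eqE).
exists b; first exact: (farthest_bdry cE capE eqE Eb ab).
by rewrite eq_sym -cdist_eq0 ab gt_eqF// (dE_gt0 cE capE eqE).
Qed.

(** Two distinct points are wanted for splitting the additional mass. If all points of the tuple
    coincide, one of them is replaced by another boundary point; the old value survives at index 0,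
    so [max_dist] can only grow. *)
Lemma near_optimal_points m (c : R) : (c%:E < CEm E mu m.+2)%E ->
  exists (p : 'I_m.+2 -> C) (i0 i1 : 'I_m.+2) (U : R),
    [/\ forall k, bdry E (p k), p i0 != p i1, c + lc < U &
     (\int[mu]_z elog (max_dist 0 (points p) z) = U%:E)%E].
Proof.
move=> /ereal_sup_gt[_ [p [bp ->]]].
have [U _ [hU hU']] := CEm_value cE capE eqE p.
rewrite hU (log_capE cE capE eqE) -EFinB lte_fin => cU.
have [[i hi]|all] := pselect (exists i, p ord0 != p i).
  by exists p, ord0, i, U; split=> //; lra.
have [b bb ba] := bdry_other (p ord0).
pose i1 : 'I_m.+2 := lift ord0 ord0.
pose q k := if k == i1 then b else p k.
have [V _ [_ hV]] := CEm_value cE capE eqE q.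
exists q, ord0, i1, V; split=> //.
- by move=> k; rewrite /q; case: eqP.
- by rewrite /q eqxx /= eq_sym.
have : (U%:E <= V%:E)%E.
  rewrite -hU' -hV !(integral_on muE); do ?exact: measurable_elog_max_dist.
  apply: (le_integral_on muE); do ?(apply: measurable_funTS; exact: measurable_elog_max_dist).
  move=> t _; apply: le_elog_mono; first exact: max_dist_ge0.
  apply: max_dist_le => [|x /mapP[k _ ->]]; first exact: max_dist_ge0.
  have -> : p k = q ord0.
    by apply/eqP; rewrite /q /= eq_sym; apply: contrapT => /negP h; apply: all; exists k.
  by apply: max_dist_ub; exact: mem_points.
by rewrite lee_fin; lra.
Qed.

(* The exceptional set where the equilibrium potential exceeds log cap carries no measure of
   finite energy, so a small mass placed on it makes the potential there as low as desired. *)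
Lemma lowering_measure d : 0 < d -> forall L : R, exists tau : cmeasure R,
  [/\ fin_on tau E, mass tau = 1 &
   forall z, E z -> (forall n, lc + d <= rpot (eps n) mu z) -> exists n, rpot (eps n) tau z < - L].
Proof.
move=> d0 L; pose F := E `&` [set z | forall n, lc + d <= rpot (eps n) mu z].
have clF : closed F.
  apply: closedI; first exact: compact_closedC.
  have -> : [set z | forall n, lc + d <= rpot (eps n) mu z] =
      \bigcap_n [set z | lc + d <= rpot (eps n) mu z].
    by apply/seteqP; split=> z h n; [move=> _; exact: h|exact: h].
  by apply: closed_bigI => n _; apply: closed_rpot_ge muE _; exact: eps_gt0.
have FE : F `<=` E by move=> z [].
have cF : compact F by exact: subclosed_compact cE FE.
have [F0|/set0P/negP/negPn/eqP F0] := pselect (F !=set0); last first.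
  exists mu; split=> // z Ez hz; have : F z by [].
  by rewrite F0.
have polar (s : cmeasure R) (b : R) : fin_on s F -> mass s = 1 ->
    ~ forall n, b <= \int[s]_z rpot (eps n) s z.
  move=> sF s1 hb; have sE := fin_onS sF cE FE.
  have : lc + d <= lc; last by lra.
  apply: (variational cE capE eqE sE s1 hb) => n.
  rewrite -[lc + d]mulr1 -s1 -fin_cst; apply: (fin_le sF) => [||z [_ hz]]; [exact: bm_cst| |exact: hz].
  by apply: (bm_rpot muE) => //; exact: eps_gt0.
have [tau [tauF tau1 htau]] := evans_weak cF F0 polar L.
exists tau; split=> //; first exact: fin_onS tauF cE FE.
by move=> z Ez hz; exact: htau.
Qed.

Theorem sharpness m (c : R) : (2 <= m)%N -> (c%:E < CEm E mu m)%E ->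
  exists nu : 'I_m -> cmeasure R,
    [/\ forall j, compactly_supported (nu j), (\sum_(j < m) nu j setT)%E = 1%E &
     (c%:E + supE E (fun z => \sum_(j < m) potential (nu j) z)
        < \sum_(j < m) supE E (potential (nu j)))%E].
Proof.
case: m => [|[|m]]// _ /near_optimal_points[p [i0 [i1 [U [bp p01 cU hU]]]]].
pose rho := cdist (p i0) (p i1) / 2.
have rho0 : 0 < rho by rewrite divr_gt0// lt_def cdist_ge0 andbT cdist_eq0.
have [D D1 hD] := kernel_bound cE.
(* The final comparison amounts to [- g + d + h k < 0], where [k] collects the coefficients of [h];
   hence [d = g / 3] and [h k <= d]. *)
pose g := U - lc - c; have g0 : 0 < g by rewrite /g; lra.
pose d := g / 3; have d0 : 0 < d by rewrite divr_gt0.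
pose k := U - lc - d - ln rho + D.
pose h := Num.min (2^-1) (d / (2 * (`|k| + 1))).
have k1 : 0 < 2 * (`|k| + 1) by have := normr_ge0 k; lra.
have h0 : 0 < h by rewrite lt_min divr_gt0// invr_gt0 ltr0n.
have h2 : h <= 2^-1 by rewrite ge_min lexx.
have hk : h * k <= d.
  apply: le_trans (ler_norm _) _; rewrite normrM gtr0_norm//.
  have : h <= d / (2 * (`|k| + 1)) by rewrite ge_min lexx orbT.
  rewrite ler_pdivlMr// => hh; apply: le_trans hh; rewrite ler_pM2l//.
  by have := normr_ge0 k; lra.
have h1 : 0 <= 1 - h by lra.
(* Solves [(1 - h) D - h L = (1 - h) (lc + d) + h D]: at exceptional points, where [mu] is bounded
   by [D] only, [tau] restores the bound valid elsewhere. *)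
pose L := (1 - h) * (D - lc - d) / h - D.
have [tau [tauE tau1 htau]] := lowering_measure d0 L.
have mA (j : 'I_m.+2) : measurable [set z | max_dist 0 (points p) z <= cdist z (p j)].
  have mf : measurable_fun setT (fun z => cdist z (p j) - max_dist 0 (points p) z).
    by apply: measurable_funB; [exact: measurable_cdist|exact: measurable_max_dist].
  have := mf measurableT `[0, +oo[%classic (measurable_itv _); rewrite setTI.
  congr measurable; apply/seteqP; split=> z /=; rewrite in_itv /= andbT subr_ge0//.
have [|S [mS SA S1]] := disjoint_refinement mA.
  move=> z; have [j _ hj] : exists2 j, true & forall i, cdist z (p i) <= cdist z (p j).
    case: (@arg_maxP _ _ _ ord0 xpredT (fun j => cdist z (p j))) => // j _ hj.
    by exists j => // i; exact: hj.
  by exists j; apply: max_dist_le => [|x /mapP[i _ ->]]; [exact: cdist_ge0|exact: hj].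
pose B := [set t | cdist (p i0) t < rho].
have mB : measurable B by exact: measurable_cball.
(* The part of [tau] close to [p i0] is attached to [p i1], the rest to [p i0]; each part stays at
   distance at least [rho] from its own point. *)
pose T (j : 'I_m.+2) := if j == i0 then ~` B else if j == i1 then B else set0.
have mT j : measurable (T j).
  by rewrite /T; case: ifP => _; [exact: measurableC|case: ifP].
have i01 : i1 != i0 by apply: contraNneq p01 => ->.
have T1 z : \sum_(j < m.+2) \1_(T j) z = 1 :> R.
  have [Bz|nBz] := pselect (B z).
    apply: (@sum_indic_disjoint _ _ _ i1); first by rewrite /T (negbTE i01) eqxx.
    by move=> j; rewrite /T; case: ifP => // _; case: eqP.
  apply: (@sum_indic_disjoint _ _ _ i0); first by rewrite /T eqxx.
  by move=> j; rewrite /T; case: eqP => // _; case: eqP.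
have Td j t : T j t -> rho <= cdist (p j) t.
  rewrite /T; case: eqP => [-> /negP|_]; first by rewrite -leNgt.
  case: eqP => [->|//]; rewrite /B /= => Bt.
  by have := cdist_triangle t (p i0) (p i1); rewrite (cdistC t); rewrite /rho in Bt *; lra.
pose nu j := madd (mscaled (NngNum h1) (mrestricted mu (mS j)))
                  (mscaled (NngNum (ltW h0)) (mrestricted tau (mT j))).
have SE j : fin_on (mrestricted mu (mS j)) E by exact: fin_on_mrestricted.
have TE j : fin_on (mrestricted tau (mT j)) E by exact: fin_on_mrestricted.
have nuE j : fin_on (nu j) E by apply: fin_on_madd; exact: fin_on_mscaled.
have intE j f : bm E f -> \int[nu j]_t f t =
    (1 - h) * \int[mu]_t (f t * \1_(S j) t) + h * \int[tau]_t (f t * \1_(T j) t).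
  move=> bf; rewrite (int_madd (K := E))//; try exact: fin_on_mscaled.
  rewrite (int_mscaled _ (SE j) bf) (int_mscaled _ (TE j) bf) /=.
  by rewrite (int_mrestricted _ muE bf) (int_mrestricted _ tauE bf).
have sumE f : bm E f ->
    \sum_(j < m.+2) \int[nu j]_t f t = (1 - h) * \int[mu]_t f t + h * \int[tau]_t f t.
  move=> bf; rewrite (eq_bigr _ (fun j _ => intE j f bf)) big_split /= -!mulr_sumr.
  by rewrite (sum_int_partition muE mS S1 bf) (sum_int_partition tauE mT T1 bf).
have cstm (x : R) : \int[mu]_t x = x by exact: eq_cst eqE x.
have cstt (x : R) : \int[tau]_t x = x by rewrite fin_cst tau1 mulr1.
exists nu; split.
- by move=> j; exists E; case: (nuE j).
- rewrite (eq_bigr (fun j => (mass (nu j))%:E)) => [|j _]; last exact: massE (nuE j).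
  rewrite sumEFin; congr (_%:E).
  rewrite (eq_bigr (fun j => \int[nu j]_t 1)) => [|j _]; last by rewrite fin_cst mul1r.
  by rewrite sumE ?cstm ?cstt; [ring|exact: bm_cst].
(* Each potential is evaluated at its own [p j]: on [S j] the distance to [p j] is the largest one,
   so the [mu] parts add up to [U], and the [tau] parts to at least [ln rho]. *)
have low : (((1 - h) * U + h * ln rho)%:E <= \sum_(j < m.+2) supE E (potential (nu j)))%E.
  apply: (@le_trans _ _ (\sum_(j < m.+2) potential (nu j) (p j))%E); last first.
    apply: lee_sum => j _; apply: ereal_sup_ubound; exists (p j) => //.
    exact: bdry_closed_sub cE _ (bp j).
  apply: (le_sum_potential nuE) => n; have e0 := eps_gt0 R n.
  have bphi j : bm E (phi (eps n) (p j)) by exact: bm_phi.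
  rewrite (eq_bigr _ (fun j _ => intE j _ (bphi j))) big_split /= -!mulr_sumr.
  rewrite -!(fin_sum muE) -?(fin_sum tauE); [|by move=> j; exact: bm_restr..].
  apply: lerD; apply: ler_wpM2l => //; [|exact: ltW|].
    rewrite -lee_fin -hU; apply: (fin_ele muE).
    - exact: measurable_elog_max_dist.
    - by apply: bm_sum => j; exact: bm_restr.
    move=> t Et; have Sp j : S j t -> (elog (max_dist 0 (points p) t) <= (phi (eps n) (p j) t)%:E)%E.
      move=> St; apply: le_trans (elog_le_phi _ _ e0); rewrite cdistC.
      by apply: le_elog_mono; [exact: max_dist_ge0|exact: SA].
    have elt : (elog (max_dist 0 (points p) t) < +oo)%E by rewrite /elog; case: ifP => // _; exact: ltry.
    move: Sp elt; case: (elog _) => [v| |] Sp // _; last exact: leNye.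
    rewrite lee_fin -[leLHS]mulr1 -(S1 t) mulr_sumr; apply: ler_sum => j _.
    rewrite indicE; have [|_] := boolP (t \in S j); last by rewrite !mulr0.
    by rewrite inE !mulr1 => /Sp; rewrite lee_fin.
  rewrite -[leLHS]cstt; apply: (fin_le tauE); [exact: bm_cst| |].
    by apply: bm_sum => j; exact: bm_restr.
  move=> t Et; rewrite -[leLHS]mulr1 -(T1 t) mulr_sumr; apply: ler_sum => j _.
  rewrite indicE; have [|_] := boolP (t \in T j); last by rewrite !mulr0.
  rewrite inE !mulr1 => Tt; apply: ln_le => //.
  exact: le_trans (Td _ _ Tt) (cdist_le_smooth _ _ _).
have rle (s : cmeasure R) n z : fin_on s E -> mass s = 1 -> E z -> rpot (eps n) s z <= D.
  move=> sE s1 Ez; rewrite -[D]mulr1 -s1 -fin_cst; have e0 := eps_gt0 R n.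
  apply: (fin_le sE) => [||t Et]; [exact: bm_phi|exact: bm_cst|].
  by apply: hD => //; exact: eps_le1.
have up : (supE E (fun z => \sum_(j < m.+2) potential (nu j) z) <=
    ((1 - h) * (lc + d) + h * D)%:E)%E.
  apply: ge_ereal_sup => _ [z Ez <-].
  have [n hn] : exists n, (1 - h) * rpot (eps n) mu z + h * rpot (eps n) tau z <=
      (1 - h) * (lc + d) + h * D.
    (* At an exceptional point the bounds are [D] for [mu] and [- L] for [tau]; elsewhere [lc + d]
       for [mu], at a suitable scale, and [D] for [tau]. *)
    have [hz|/existsNP[n /negP]] := pselect (forall n, lc + d <= rpot (eps n) mu z).
      have [n hn] := htau z Ez hz; exists n.
      have a1 := ler_wpM2l h1 (rle mu n z muE mass1 Ez).
      have a2 := ler_wpM2l (ltW h0) (ltW hn).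
      have a3 : h * L = (1 - h) * (D - lc - d) - h * D.
        by rewrite /L mulrBr mulrC divfK// gt_eqF.
      apply: le_trans (lerD a1 a2) _; rewrite mulrN a3; lra.
    rewrite -ltNge => hn; exists n; apply: lerD; apply: ler_wpM2l => //; [exact: ltW|exact: ltW|].
    exact: rle.
  apply: (@le_trans _ _ (\sum_(j < m.+2) (rpot (eps n) (nu j) z)%:E)%E).
    by apply: lee_sum => j _; apply: (potential_le_rpot (nuE j)); exact: eps_gt0.
  rewrite sumEFin lee_fin; apply: le_trans hn.
  rewrite /rpot -sumE//; apply: bm_phi => //; exact: eps_gt0.
apply: le_lt_trans (leeD2l _ up) _; apply: lt_le_trans low.
rewrite -EFinD lte_fin; rewrite /k in hk; rewrite /d in hk *; rewrite /g in hk g0 *; lra.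
Qed.

End Sharpness.

Theorem theorem2p4 (R : realType) (E : set (R * R)%type) (mu : cmeasure R) :
  compact E ->
  (-oo < log_cap E)%E ->            (* cap(E) > 0 *)
  is_equilibrium E mu ->            (* mu = mu_E *)
  [/\
    (* the inequality *)
    (forall (m : nat) (nu : 'I_m -> cmeasure R),
        (forall j, compactly_supported (nu j)) ->
        (\sum_(j < m) nu j setT)%E = 1%E ->
        (\sum_(j < m) supE E (potential (nu j))
           <= CEm E mu m + supE E (fun z => \sum_(j < m) potential (nu j) z))%E),
    (* sharpness for each fixed m >= 2 *)
    (forall m : nat, (2 <= m)%N -> forall c : R, (c%:E < CEm E mu m)%E ->
        exists nu : 'I_m -> cmeasure R,
          [/\ (forall j, compactly_supported (nu j)),
              (\sum_(j < m) nu j setT)%E = 1%E &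
              (c%:E + supE E (fun z => \sum_(j < m) potential (nu j) z)
                 < \sum_(j < m) supE E (potential (nu j)))%E]),
    (* m < card(D_E) ==> C_E(m) < C_E *)
    (forall m : nat, (1 <= m)%N -> ~ cardD_le E mu m -> (CEm E mu m < CE E mu)%E),
    (* m >= card(D_E) ==> C_E(m) = C_E *)
    (forall m : nat, (1 <= m)%N -> cardD_le E mu m -> CEm E mu m = CE E mu) &
    (* D_E infinite ==> C_E(m) < C_E for all m >= 2 *)
    (cardD_infinite E mu -> forall m : nat, (2 <= m)%N -> (CEm E mu m < CE E mu)%E)].
Proof.
move=> cE capE eqE; split.
- exact: (reverse_triangle cE capE eqE).
- by move=> m m2 c; exact: (sharpness cE capE eqE).
- exact: (CEm_lt cE capE eqE).
- exact: (CEm_eq cE capE eqE).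
move=> Dinf m m2; apply: (CEm_lt cE capE eqE); first exact: ltnW.
by move=> [s [_ ds]]; exact: (Dinf s).
Qed.
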